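(* Let $\mathcal{H}_{g,d}$ be the simple Hurwitz space of genus $g$, degree $d$ covers of the rational line, and let $\mathcal{H}^+_{g,d}$ be its finite cover obtained by marking one branch point. Then $\mathcal{H}^+_{g,d}$ and $\mathcal{H}_{g,d}$ are uniruled when $d>g+1$.
   Context: We work over $\mathbb{C}$. A cover $\pi:C\to\mathbb{P}^1$ of genus $g$ and degree $d$ ($C$ a smooth connected projective curve of genus $g$, $\pi$ finite of degree $d$) is simply branched if over every branch point the fibre has ramification profile $(2,1^{d-2})$; it then has $2g+2d-2$ branch points. The Hurwitz space $\mathcal{H}_{g,d}$ parameterises isomorphism classes of simply branched covers $\pi:C\to\mathbb{P}^1$ of genus $g$ and degree $d$, where an isomorphism between $\pi:C\to\mathbb{P}^1$ and $\pi':C'\to\mathbb{P}^1$ is a pair of isomorphisms $C\to C'$ and $\mathbb{P}^1\to\mathbb{P}^1$ commuting with $\pi,\pi'$ (so $\dim\mathcal{H}_{g,d}=2g+2d-5$). The space $\mathcal{H}^+_{g,d}$ parameterises isomorphism classes of such covers together with the choice of one distinguished branch point (isomorphisms must preserve it); forgetting the choice is a finite morphism $\mathcal{H}^+_{g,d}\to\mathcal{H}_{g,d}$. A (not necessarily proper) variety is uniruled if a rational curve passes through a general point of a projective model, i.e. uniruledness is understood as a birational property.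
   Formalization: The case g = 0, d = 2 is excluded by assuming 2g+2d-5 ≥ 0: there both the Hurwitz space and its marked cover are a single point, which is not uniruled, so the claim as stated fails. *)

(* Defs.v *)
From mathcomp Require Import all_boot all_order all_algebra.
From mathcomp Require Import reals complex mpoly.

Set Implicit Arguments.
Unset Strict Implicit.
Unset Printing Implicit Defensive.

Import GRing.Theory.
Local Open Scope ring_scope.

(* Classical algebraic geometry over a field K, through closed points.  The    *)
(* definitions are meant for K algebraically closed of characteristic 0; the   *)
(* theorem takes K to be the complex numbers.  Varieties are quasi-projective, *)
(* reduced, and not assumed irreducible.                                       *)

(* The points of P^n are the lines of K^(n+1). *)
Definition point (K : fieldType) (n : nat) : Type :=
  {L : {vspace 'rV[K]_n.+1} | \dim L == 1%N}.

Definition coords (K : fieldType) (n : nat) (x : point K n) (i : 'I_n.+1) : K :=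
  vpick (val x) 0 i.

(* P^n and P^n x P^N, each with the functions on points obtained by evaluating *)
(* the (bi)homogeneous polynomials of a given (bi)degree at the coordinates    *)
(* chosen by [coords].  Zero loci of forms, and ratios of forms of the same    *)
(* degree, do not depend on this choice.                                       *)
Record ambient (K : fieldType) := Ambient {
  pt :> Type;
  deg : Type;
  form : deg -> (pt -> K) -> Prop
}.

Definition proj (K : fieldType) (n : nat) : ambient K :=
  @Ambient K (point K n) nat
    (fun d f => exists2 p : {mpoly K[n.+1]}, p \is d.-homog &
       forall x, f x = p.@[coords x]).

(* A bihomogeneous polynomial is a polynomial in the coordinates of P^N whose  *)
(* coefficients are polynomials in the coordinates of P^n.                     *)
Definition bihomog (K : fieldType) (n N d e : nat)
    (F : {mpoly {mpoly K[n.+1]}[N.+1]}) : Prop :=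
  F \is e.-homog /\ forall m, F@_m \is d.-homog.

Definition specialize (K : fieldType) (n N : nat)
    (F : {mpoly {mpoly K[n.+1]}[N.+1]}) (b : point K n) : {mpoly K[N.+1]} :=
  map_mpoly (meval (coords b)) F.

Definition biproj (K : fieldType) (n N : nat) : ambient K :=
  @Ambient K (point K n * point K N)%type (nat * nat)%type
    (fun d f => exists2 F : {mpoly {mpoly K[n.+1]}[N.+1]}, bihomog d.1 d.2 F &
       forall x, f x = (specialize F x.1).@[coords x.2]).

Section Zariski.
Variables (K : fieldType) (T : ambient K).
Implicit Types (X Y U Z : T -> Prop) (p : T).

Definition zclosed Z : Prop :=
  exists2 S : (T -> K) -> Prop, (forall f, S f -> exists d, form d f) &
    forall x, Z x <-> forall f, S f -> f x = 0.

Definition zopen U : Prop := zclosed (fun x => ~ U x).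

Definition locally_closed X : Prop :=
  exists Z U, [/\ zclosed Z, zopen U & forall x, X x <-> Z x /\ U x].

Definition closed_in X Y : Prop :=
  exists2 Z, zclosed Z & forall x, Y x <-> X x /\ Z x.

Definition dense_in X U : Prop :=
  forall V, zopen V -> (exists x, X x /\ V x) -> exists x, [/\ X x, U x & V x].

Definition zconnected X : Prop :=
  (exists x, X x) /\
  forall Z1 Z2, zclosed Z1 -> zclosed Z2 ->
    (forall x, X x -> Z1 x \/ Z2 x) -> (forall x, X x -> ~ (Z1 x /\ Z2 x)) ->
    (forall x, X x -> Z1 x) \/ (forall x, X x -> Z2 x).

Definition near X p (Q : T -> Prop) : Prop :=
  exists U, [/\ zopen U, U p & forall y, X y -> U y -> Q y].

Definition regular_at X p (f : T -> K) : Prop :=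
  exists d s t, [/\ form d s, form d t &
    near X p (fun y => t y != 0 /\ f y = s y / t y)].

(* A generator of the maximal ideal of the local ring of X at p. *)
Definition uniformizer X p (t : T -> K) : Prop :=
  [/\ regular_at X p t, t p = 0 &
   forall f, regular_at X p f -> f p = 0 ->
     exists2 v, regular_at X p v & near X p (fun y => f y = v y * t y)].

(* The values of f are locally given by forms of the same degree without       *)
(* common zero (the row of forms spans a line, hence is nonzero).              *)
Definition morphism (m : nat) X (Y : proj K m -> Prop) (f : T -> proj K m) :
    Prop :=
  (forall x, X x -> Y (f x)) /\
  forall p, X p -> exists d (s : 'I_m.+1 -> T -> K),
    (forall i, form d (s i)) /\
    near X p (fun y => val (f y) = <[\row_i s i y]>%VS).

(* The restrictions to X of the forms of degree d have dimension k. *)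
Definition form_dim X (d : deg T) (k : nat) : Prop :=
  exists s : 'I_k -> T -> K,
    [/\ forall i, form d (s i),
        forall c : 'I_k -> K,
          (forall x, X x -> \sum_i c i * s i x = 0) -> forall i, c i = 0 &
        forall f, form d f ->
          exists c : 'I_k -> K, forall x, X x -> f x = \sum_i c i * s i x].

End Zariski.

Definition whole (T : Type) (_ : T) : Prop := True.

Definition isomorphism (K : fieldType) (n m : nat)
    (X : proj K n -> Prop) (Y : proj K m -> Prop)
    (f : proj K n -> proj K m) : Prop :=
  morphism X Y f /\ exists h : proj K m -> proj K n,
    [/\ morphism Y X h, forall x, X x -> h (f x) = x &
        forall y, Y y -> f (h y) = y].

(* For reducible varieties: an isomorphism between dense open subsets. *)
Definition birational (K : fieldType) (n m : nat)
    (X : proj K n -> Prop) (Y : proj K m -> Prop) : Prop :=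
  exists U V,
    [/\ zopen U, zopen V, dense_in X U, dense_in Y V &
        exists f, isomorphism (fun x => X x /\ U x) (fun y => Y y /\ V y) f].

Definition rational_curve_through (K : fieldType) (m : nat)
    (Y : proj K m -> Prop) (y : proj K m) : Prop :=
  exists f : proj K 1 -> proj K m,
    [/\ morphism (@whole _) Y f, exists s t, f s <> f t & exists t, f t = y].

Definition uniruled (K : fieldType) (n : nat) (X : proj K n -> Prop) : Prop :=
  exists m (Y : proj K m -> Prop),
    [/\ zclosed Y, birational X Y &
        exists U, [/\ zopen U, dense_in Y U &
          forall y, Y y -> U y -> rational_curve_through Y y]].

Section Curves.
Variables (K : fieldType) (N : nat).
Implicit Types (C : proj K N -> Prop) (pi : proj K N -> proj K 1).

Definition jacobian (r : nat) (F : 'I_r -> {mpoly K[N.+1]}) (x : proj K N) :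
    'M[K]_(r, N.+1) :=
  \matrix_(i, j) ((F i)^`M(j)).@[coords x].

(* Jacobian criterion: C is smooth of dimension 1 at each of its points. *)
Definition smooth_curve C : Prop :=
  forall x, C x -> exists (r : nat) (F : 'I_r -> {mpoly K[N.+1]}),
    [/\ r.+1 = N,
        forall i, exists d, F i \is d.-homog,
        \rank (jacobian F x) = r &
        near (@whole _) x (fun y => C y <-> forall i, (F i).@[coords y] = 0)].

(* The Hilbert polynomial of C is D * k + 1 - g. *)
Definition genus C (g : nat) : Prop :=
  exists D k0 : nat, forall k, (k0 <= k)%N ->
    exists2 h, @form_dim K (proj K N) C k h & (h + g = D * k + 1)%N.

(* The order of vanishing at p of the pull-back of a local parameter z at pi p. *)
Definition ramification_index C pi (p : proj K N) (e : nat) : Prop :=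
  exists z t v,
    [/\ @uniformizer K (proj K 1) (@whole _) (pi p) z, uniformizer C p t,
        regular_at C p v, v p != 0 &
        near C p (fun y => z (pi y) = v y * t y ^+ e)].

(* The fibre over q consists of size s distinct points, whose ramification     *)
(* indices are the entries of s.                                               *)
Definition profile C pi (q : proj K 1) (s : seq nat) : Prop :=
  exists a : 'I_(size s) -> proj K N,
    [/\ injective a,
        forall x, (C x /\ pi x = q) <-> (exists i, x = a i) &
        forall i, ramification_index C pi (a i) (nth 0%N s i)].

Definition branch_point C pi (q : proj K 1) : Prop :=
  exists p e, [/\ C p, pi p = q, ramification_index C pi p e & (1 < e)%N].

Definition has_degree C pi (d : nat) : Prop :=
  forall q, exists2 s, profile C pi q s & sumn s = d.

End Curves.

Record cover (K : fieldType) := Cover {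
  cdim : nat;
  curve : proj K cdim -> Prop;
  cmap : proj K cdim -> proj K 1
}.

Arguments Cover {K} cdim curve cmap.

Definition simple_cover (K : fieldType) (g d : nat) (c : cover K) : Prop :=
  [/\ [/\ zclosed (@curve K c), zconnected (@curve K c),
          smooth_curve (@curve K c) & genus (@curve K c) g],
      morphism (@curve K c) (@whole _) (@cmap K c),
      has_degree (@curve K c) (@cmap K c) d &
      forall q, branch_point (@curve K c) (@cmap K c) q ->
        profile (@curve K c) (@cmap K c) q (2 :: nseq (d - 2) 1)%N].

Definition cover_iso_via (K : fieldType) (c c' : cover K)
    (beta : proj K 1 -> proj K 1) : Prop :=
  isomorphism (@whole _) (@whole _) beta /\
  exists2 alpha, isomorphism (@curve K c) (@curve K c') alpha &
    forall x, curve x -> @cmap K c' (alpha x) = beta (@cmap K c x).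

Definition cover_iso (K : fieldType) (c c' : cover K) : Prop :=
  exists beta, cover_iso_via c c' beta.

Definition marked_simple_cover (K : fieldType) (g d : nat)
    (c : cover K * proj K 1) : Prop :=
  simple_cover g d c.1 /\ branch_point (@curve K c.1) (@cmap K c.1) c.2.

Definition marked_cover_iso (K : fieldType) (c c' : cover K * proj K 1) : Prop :=
  exists2 beta, cover_iso_via c.1 c'.1 beta & beta c.2 = c'.2.

(* A family over B (contained in P^n) is a closed subvariety of B x P^N with a *)
(* morphism to P^1.  Covers of P^1 are polarized by the pull-back of O(1), so  *)
(* families of covers over quasi-projective bases are of this form.  Families  *)
(* with values in a P^1-bundle over B become such families etale locally on B, *)
(* and so define the same coarse space.                                        *)
Record cover_family (K : fieldType) (n : nat) := CoverFamily {
  fdim : nat;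
  total : biproj K n fdim -> Prop;
  fmap : biproj K n fdim -> proj K 1
}.

Definition fibre (K : fieldType) (n : nat) (E : cover_family K n)
    (b : proj K n) : cover K :=
  Cover (fdim E) (fun x => @total K n E (b, x)) (fun x => @fmap K n E (b, x)).

(* Relative Jacobian criterion for E -> B, smooth of relative dimension 1.     *)
(* The subscheme of B x P^N cut out by the F i is smooth over the reduced B at *)
(* x, hence reduced there, so that comparing point sets is enough.             *)
Definition smooth_family (K : fieldType) (n N : nat) (B : proj K n -> Prop)
    (E : biproj K n N -> Prop) : Prop :=
  forall x, E x ->
    exists (r : nat) (F : 'I_r -> {mpoly {mpoly K[n.+1]}[N.+1]}),
      [/\ r.+1 = N,
          forall i, exists d e, bihomog d e (F i),
          \rank (jacobian (fun i => specialize (F i) x.1) x.2) = r &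
          near (fun y : biproj K n N => B y.1) x (fun y =>
            E y <-> forall i, (specialize (F i) y.1).@[coords y.2] = 0)].

Definition simple_cover_family (K : fieldType) (g d n : nat)
    (B : proj K n -> Prop) (E : cover_family K n) : Prop :=
  [/\ closed_in (fun y : biproj K n (fdim E) => B y.1) (@total K n E),
      smooth_family B (@total K n E),
      morphism (@total K n E) (@whole _) (@fmap K n E) &
      forall b, B b -> simple_cover g d (fibre E b)].

Section Moduli.
Variables (K : fieldType) (O : Type).
(* A moduli problem: the objects, their isomorphisms, and the maps b |-> F b   *)
(* which are the families of objects over a base B.                            *)
Variables (obj : O -> Prop) (iso : O -> O -> Prop)
  (family : forall n, (proj K n -> Prop) -> (proj K n -> O) -> Prop).

(* A natural transformation from families up to isomorphism to the functor of  *)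
(* points of X; as bases are reduced, it is determined by its values on        *)
(* objects.                                                                    *)
Definition natural_map n (X : proj K n -> Prop) (phi : O -> proj K n) : Prop :=
  [/\ forall a, obj a -> X (phi a),
      forall a b, obj a -> obj b -> iso a b -> phi a = phi b &
      forall m (B : proj K m -> Prop) F, locally_closed B -> family B F ->
        morphism B X (fun b => phi (F b))].

Definition coarse_moduli_space n (X : proj K n -> Prop) : Prop :=
  locally_closed X /\
  exists phi : O -> proj K n,
    [/\ natural_map X phi,
        forall x, X x -> exists2 a, obj a & phi a = x,
        forall a b, obj a -> obj b -> phi a = phi b -> iso a b &
        forall m (Z : proj K m -> Prop) psi,
          locally_closed Z -> natural_map Z psi ->
          exists2 h, morphism X Z h & forall a, obj a -> psi a = h (phi a)].

End Moduli.

Definition hurwitz_space (K : fieldType) (g d n : nat) (H : proj K n -> Prop) :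
    Prop :=
  coarse_moduli_space (simple_cover g d) (@cover_iso K)
    (fun m B F => exists2 E : cover_family K m, simple_cover_family g d B E &
       forall b, B b -> F b = fibre E b) H.

(* In a family the marked branch point is a section b |-> q b. *)
Definition marked_hurwitz_space (K : fieldType) (g d n : nat)
    (H : proj K n -> Prop) : Prop :=
  coarse_moduli_space (marked_simple_cover g d) (@marked_cover_iso K)
    (fun m B F => exists (E : cover_family K m) (q : proj K m -> proj K 1),
       [/\ simple_cover_family g d B E, morphism B (@whole _) q,
           forall b, B b ->
             branch_point (@curve K (fibre E b)) (@cmap K (fibre E b)) (q b) &
           forall b, B b -> F b = (fibre E b, q b)]) H.

(* Main.v *)
(* Let pi : C -> P^1 be a simple cover with branch point q, let D be its fibre over q, and let
   f = A o pi for an affine coordinate A with pole q.  Since deg D = d > g + 1, Riemann's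
   inequality gives a function h with poles at most D such that 1, f and h are independent.
   For almost all l, and for l = 0, the function f + l h again has polar divisor D and, away from
   D, only simple ramification with distinct critical values; so it defines a simple cover of
   the same curve C, branched over q.  The moduli map from the space of these l extends to the
   whole line, and gives a curve through the point of pi in the closure of the moduli space.
   It is not constant: if the covers attached to infinitely many l were isomorphic, there would
   be automorphisms al of C with (f + l h) o al = a (f + m h) + b.  These permute the points of
   D, and by the pigeonhole principle we may take them to fix D pointwise.  Functions with poles
   in D are then eigenvectors with eigenvalues that are roots of unity of bounded order, so a
   suitable power of such a function is invariant; pigeonhole on its level sets makes
   f + l h - a (f + m h) - b vanish at more than d points, whence l = m.  When the branch
   point is not marked, pigeonhole on the finitely many ramification points reduces to
   isomorphisms fixing q.

   Riemann's inequality is read off the Hilbert polynomial which defines the genus: functions are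
   ratios of forms, forms of large degree separate jets of points, and a nonzero form of degree k
   has at most as many zeros as the leading term of the Hilbert polynomial allows.  Arguments with
   differentials are replaced by the derivation d/df, whose zeros and poles are computed with
   1-jets. *)

From mathcomp Require Import all_boot all_order all_algebra.
From mathcomp Require Import reals complex mpoly boolp ring zify.
Require Import Defs.

Set Implicit Arguments.
Unset Strict Implicit.
Unset Printing Implicit Defensive.

Import Order.TTheory GRing.Theory Num.Theory.
Local Open Scope ring_scope.

(** * Abstract curves and orders of vanishing *)

(** The divisor D = 2 p1 + s stays the polar divisor of the whole pencil, so the branching over q
    comes for free and only ramification away from D has to be controlled. The bound d > g + 1 gives
    dim L(D) >= 3, which leaves room for h beside 1 and f. The parameter l = 0 must be good as well
    as the general one: it makes the rational curve pass through the given point. This is why the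
    simple branching of f itself enters the genericity argument. That general members have distinct
    critical values comes from two functions, [kap] = dh/df and [crit] = f - h / [kap], which
    together separate almost all points: a member ramified at x and y with equal critical values has
    equal [kap] and equal [crit] there. For nonconstancy, the automorphisms in question need not be
    shown to form a finite group; one nonconstant function invariant under all of them is enough.
    Three fixed points provide it for any h. When d = 3 the divisor D has only two distinct points;
    then g <= 1 and h has to be chosen so that the relation between members of the pencil, or a
    second eigenfunction, bounds the eigenvalues. *)

Definition cofin (T : eqType) (Q : T -> Prop) : Prop :=
  exists l : seq T, forall x, x \notin l -> Q x.

Lemma cofin_sub (T : eqType) (Q R : T -> Prop) :
  cofin Q -> (forall x, Q x -> R x) -> cofin R.
Proof. by case=> l H QR; exists l => x /H /QR. Qed.

Lemma cofin_and (T : eqType) (Q R : T -> Prop) :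
  cofin Q -> cofin R -> cofin (fun x => Q x /\ R x).
Proof.
move=> [l Ql] [m Rm]; exists (l ++ m) => x; rewrite mem_cat negb_or.
by case/andP=> /Ql ? /Rm.
Qed.

Lemma cofin_all (T : eqType) (Q : T -> Prop) : (forall x, Q x) -> cofin Q.
Proof. by move=> H; exists [::]. Qed.

Lemma cofin_notin (T : eqType) (l : seq T) : cofin (fun x => x \notin l).
Proof. by exists l. Qed.

Lemma cofin_forall (T : eqType) (I : finType) (Q : I -> T -> Prop) :
  (forall i, cofin (Q i)) -> cofin (fun x => forall i, Q i x).
Proof.
move=> /choice[l Hl]; exists (flatten [seq l i | i <- enum I]) => x nx i.
apply: Hl; apply: contra nx => xl; apply/flattenP; exists (l i) => //.
by apply: map_f; rewrite mem_enum.
Qed.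

(** Functions are total on the points and matter only up to finite sets, so they may carry junk
    values anywhere; [hv p f a] says that the rational function represented by f is regular at p
    with value a, whatever [f p] is. The fields are what the function theory below consumes;
    [form_curve] supplies them for a projective curve. *)
Record abs_curve (K : fieldType) := AbsCurve {
  pts :> eqType;
  rat : (pts -> K) -> Prop;
  hv : pts -> (pts -> K) -> K -> Prop;
  unif : pts -> pts -> K;
  pts_infinite : forall l : seq pts, exists x, x \notin l;
  rat_inv : forall f, rat f -> rat (fun x => (f x)^-1);
  rat_zero : forall f, rat f ->
    cofin (fun x => f x = 0) \/ cofin (fun x => f x != 0);
  hv_rat : forall p f a, hv p f a -> rat f;
  rat_add : forall f g, rat f -> rat g -> rat (fun x => f x + g x);
  rat_mul : forall f g, rat f -> rat g -> rat (fun x => f x * g x);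
  hv_const : forall p c, hv p (fun=> c) c;
  hv_add : forall p f g a b,
    hv p f a -> hv p g b -> hv p (fun x => f x + g x) (a + b);
  hv_mul : forall p f g a b,
    hv p f a -> hv p g b -> hv p (fun x => f x * g x) (a * b);
  hv_inv : forall p f a, hv p f a -> a != 0 -> hv p (fun x => (f x)^-1) a^-1;
  rat_ae : forall f g, rat f -> cofin (fun x => f x = g x) -> rat g;
  hv_ae : forall p f g a, hv p f a -> cofin (fun x => f x = g x) -> hv p g a;
  hv_uniq : forall p f a b, hv p f a -> hv p f b -> a = b;
  hv_generic : forall f, rat f -> cofin (fun x => hv x f (f x));
  hv_unif : forall p, hv p (unif p) 0;
  unif_ne0 : forall p, cofin (fun x => unif p x != 0);
  ord_exists : forall p f, rat f -> ~ cofin (fun x => f x = 0) ->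
    exists n a, a != 0 /\ hv p (fun x => f x * unif p x ^ (- n)) a;
  liouville : forall f, rat f -> (forall p, exists a, hv p f a) ->
    exists c, cofin (fun x => f x = c)
}.

Arguments rat {K a0} _.
Arguments hv {K a0} _ _ _.
Arguments unif {K a0} _ _.

Section CurveBasics.
Variables (K : fieldType) (X : abs_curve K).
Implicit Types (p : X) (f g h : X -> K) (m n : int) (a b c : K).

Definition reg p f := exists a, hv p f a.
Definition ae0 f := cofin (fun x => f x = 0).
(** The order is kept as a relation because the zero function has none: it satisfies [ordge] for
    every n and [ordeq] for no n. *)
Definition ordge p n f := reg p (fun x => f x * unif p x ^ (- n)).
Definition ordeq p n f := exists2 a, a != 0 & hv p (fun x => f x * unif p x ^ (- n)) a.

Lemma cofin_ex (Q : X -> Prop) : cofin Q -> exists x, Q x.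
Proof. by case=> l H; have [x /H] := pts_infinite l; exists x. Qed.

Lemma hv_ext p f g a b : hv p f a -> f =1 g -> a = b -> hv p g b.
Proof. by move=> fa /funext <- <-. Qed.

Lemma hv_eqv p f a b : hv p f a -> a = b -> hv p f b.
Proof. by move=> fa <-. Qed.

Lemma hv_opp p f a : hv p f a -> hv p (fun x => - f x) (- a).
Proof.
move=> fa; apply: hv_ext (hv_mul (hv_const p (-1)) fa) _ _ => [x|]; ring.
Qed.

Lemma hv_sub p f g a b : hv p f a -> hv p g b -> hv p (fun x => f x - g x) (a - b).
Proof. by move=> fa /hv_opp; apply: hv_add. Qed.

Lemma hv_exp p f a (k : nat) : hv p f a -> hv p (fun x => f x ^+ k) (a ^+ k).
Proof.
move=> fa; elim: k => [|k IH]; first exact: hv_const.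
apply: hv_ext (hv_mul fa IH) _ _ => [x|]; by rewrite exprS.
Qed.

Lemma hv_sum p (I : Type) (r : seq I) (F : I -> X -> K) (A : I -> K) :
  (forall i, hv p (F i) (A i)) ->
  hv p (fun x => \sum_(i <- r) F i x) (\sum_(i <- r) A i).
Proof.
move=> FA; elim: r => [|i r IH].
  by apply: hv_ext (hv_const p 0) _ _ => [x|]; rewrite big_nil.
by apply: hv_ext (hv_add (FA i) IH) _ _ => [x|]; rewrite big_cons.
Qed.

Lemma rat_const c : rat (fun _ : X => c).
Proof. by have [p _] := pts_infinite (a0 := X) [::]; exact: hv_rat (hv_const p c). Qed.

Lemma rat_scale c f : rat f -> rat (fun x => c * f x).
Proof. exact/rat_mul/rat_const. Qed.

Lemma rat_sub f g : rat f -> rat g -> rat (fun x => f x - g x).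
Proof.
move=> rf rg; have := rat_add rf (rat_scale (-1) rg).
by under eq_fun do rewrite mulN1r.
Qed.

Lemma rat_exp f (k : nat) : rat f -> rat (fun x => f x ^+ k).
Proof.
move=> rf; elim: k => [|k IH]; first exact: rat_const.
by have := rat_mul rf IH; under eq_fun do rewrite -exprS.
Qed.

Lemma rat_sum (I : Type) (r : seq I) (F : I -> X -> K) :
  (forall i, rat (F i)) -> rat (fun x => \sum_(i <- r) F i x).
Proof.
move=> FA; elim: r => [|i r IH].
  by under eq_fun do rewrite big_nil; apply: rat_const.
by under eq_fun do rewrite big_cons; apply: rat_add.
Qed.

Lemma rat_unif p : rat (unif p).
Proof. exact: hv_rat (hv_unif p). Qed.

Lemma rat_expz f n : rat f -> rat (fun x => f x ^ n).
Proof.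
move=> rf; case: n => k; first exact: rat_exp.
by have := rat_inv (rat_exp k.+1 rf).
Qed.

Lemma rat_horner (P : {poly K}) f : rat f -> rat (fun x => P.[f x]).
Proof.
move=> rf; elim/poly_ind: P => [|P c IH].
  by under eq_fun do rewrite horner0; apply: rat_const.
under eq_fun do rewrite hornerMXaddC.
exact: rat_add (rat_mul IH rf) (rat_const c).
Qed.

Lemma hv_horner p (P : {poly K}) f a : hv p f a -> hv p (fun x => P.[f x]) P.[a].
Proof.
move=> fa; elim/poly_ind: P => [|P c IH].
  by apply: hv_ext (hv_const p 0) _ _ => [x|]; rewrite horner0.
apply: hv_ext (hv_add (hv_mul IH fa) (hv_const p c)) _ _ => [x|];
by rewrite hornerMXaddC.
Qed.

Lemma ae0_not f : cofin (fun x => f x != 0) -> ~ ae0 f.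
Proof. by move=> A B; have [x [/eqP fx /fx]] := cofin_ex (cofin_and A B). Qed.

Lemma not_ae0 f : rat f -> ~ ae0 f -> cofin (fun x => f x != 0).
Proof. by move=> /rat_zero[]. Qed.

Lemma ae0M f g : rat f -> rat g -> ae0 (fun x => f x * g x) -> ae0 f \/ ae0 g.
Proof.
move=> rf rg fg0.
case: (rat_zero rf) => [|f0]; first by left.
right; apply: cofin_sub (cofin_and f0 fg0) _ => x [fx /eqP].
by rewrite mulf_eq0 (negbTE fx) => /eqP.
Qed.

Lemma unifD p m n :
  cofin (fun x => unif p x ^ (m + n) = unif p x ^ m * unif p x ^ n).
Proof. by apply: cofin_sub (unif_ne0 p) _ => x t0; rewrite expfzDr. Qed.

Lemma hv_unifn p (k : nat) : hv p (fun x => unif p x ^ k%:Z) (k == 0%N)%:R.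
Proof.
apply: hv_ext (hv_exp k (hv_unif p)) _ _ => [x //|].
by case: k => [|k]; rewrite ?expr0 // expr0n.
Qed.

Lemma ordeq_ge p n f : ordeq p n f -> ordge p n f.
Proof. by case=> a _ fa; exists a. Qed.

Lemma ordge_rat p n f : ordge p n f -> rat f.
Proof.
case=> a /hv_rat rfa; apply: rat_ae (rat_mul rfa (rat_expz n (rat_unif p))) _.
apply: cofin_sub (cofin_and (unif_ne0 p) (unifD p (- n) n)) _ => x [t0 E].
by rewrite -mulrA -E addrC subrr expr0z mulr1.
Qed.

Lemma ordeq_rat p n f : ordeq p n f -> rat f.
Proof. by move/ordeq_ge/ordge_rat. Qed.

Lemma ordge_ae p n f g : ordge p n f -> cofin (fun x => f x = g x) -> ordge p n g.
Proof.
by case=> a fa E; exists a; apply: hv_ae fa _; apply: cofin_sub E _ => x ->.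
Qed.

Lemma ordeq_ae p n f g : ordeq p n f -> cofin (fun x => f x = g x) -> ordeq p n g.
Proof.
by case=> a ? fa E; exists a => //; apply: hv_ae fa _; apply: cofin_sub E _ => x ->.
Qed.

Lemma hv_shift p m n f a : (m < n)%R -> hv p (fun x => f x * unif p x ^ (- n)) a ->
  hv p (fun x => f x * unif p x ^ (- m)) 0.
Proof.
move=> mn fa; have [k nk] : exists k : nat, n - m = k.+1%:Z.
  by exists (`|n - m|%N.-1); lia.
apply: hv_ae (hv_eqv (hv_mul fa (hv_unifn p k.+1)) (mulr0 _)) _.
apply: cofin_sub (unifD p (- n) k.+1%:Z) _ => x E.
by rewrite -mulrA -E -nk; congr (_ * _ ^ _); ring.
Qed.

Lemma ordge_le p m n f : (m <= n)%R -> ordge p n f -> ordge p m f.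
Proof.
rewrite le_eqVlt => /orP[/eqP-> //|mn [a fa]].
by exists 0; apply: hv_shift fa.
Qed.

Lemma ordge_eq_le p m n f : ordge p m f -> ordeq p n f -> (m <= n)%R.
Proof.
move=> [a fa] [b b0 fb]; rewrite leNgt; apply/negP => nm.
by move: b0; rewrite (hv_uniq fb (hv_shift nm fa)) eqxx.
Qed.

Lemma ordeq_uniq p m n f : ordeq p m f -> ordeq p n f -> m = n.
Proof.
move=> A B; apply/eqP; rewrite eq_le.
by rewrite (ordge_eq_le (ordeq_ge A) B) (ordge_eq_le (ordeq_ge B) A).
Qed.

Lemma ordgeM p m n f g : ordge p m f -> ordge p n g ->
  ordge p (m + n) (fun x => f x * g x).
Proof.
move=> [a fa] [b gb]; exists (a * b); apply: hv_ae (hv_mul fa gb) _.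
apply: cofin_sub (unifD p (- m) (- n)) _ => x E.
by rewrite opprD E; ring.
Qed.

Lemma ordeqM p m n f g : ordeq p m f -> ordeq p n g ->
  ordeq p (m + n) (fun x => f x * g x).
Proof.
move=> [a a0 fa] [b b0 gb]; exists (a * b); first by rewrite mulf_neq0.
apply: hv_ae (hv_mul fa gb) _.
apply: cofin_sub (unifD p (- m) (- n)) _ => x E.
by rewrite opprD E; ring.
Qed.

Lemma ordeqV p n f : ordeq p n f -> ordeq p (- n) (fun x => (f x)^-1).
Proof.
move=> [a a0 fa]; exists a^-1; first by rewrite invr_eq0.
by apply: hv_ext (hv_inv fa a0) _ _ => // x; rewrite invfM invr_expz.
Qed.

Lemma ordgeD p n f g : ordge p n f -> ordge p n g -> ordge p n (fun x => f x + g x).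
Proof.
move=> [a fa] [b gb]; exists (a + b).
by apply: hv_ext (hv_add fa gb) _ _ => // x; rewrite mulrDl.
Qed.

Lemma ordgeZ p n c f : ordge p n f -> ordge p n (fun x => c * f x).
Proof.
move=> [a fa]; exists (c * a).
by apply: hv_ext (hv_mul (hv_const p c) fa) _ _ => // x; rewrite mulrA.
Qed.

Lemma ordge_sum p n (I : Type) (r : seq I) (F : I -> X -> K) :
  (forall i, ordge p n (F i)) -> ordge p n (fun x => \sum_(i <- r) F i x).
Proof.
move=> /choice[A FA]; exists (\sum_(i <- r) A i).
by apply: hv_ext (hv_sum r FA) _ _ => // x; rewrite mulr_suml.
Qed.

Lemma ordeq_ex p f : rat f -> ~ ae0 f -> exists n, ordeq p n f.
Proof. by move=> rf f0; have [n [a [a0 fa]]] := ord_exists p rf f0; exists n, a. Qed.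

Lemma ordeq_not0 p n f : ordeq p n f -> ~ ae0 f.
Proof.
move=> [a a0 fa] f0; have E : cofin (fun x => f x * unif p x ^ (- n) = 0).
  by apply: cofin_sub f0 _ => x ->; rewrite mul0r.
by move: a0; rewrite (hv_uniq (hv_ae fa E) (hv_const p 0)) eqxx.
Qed.

Lemma ordge0E p f : ordge p 0 f <-> reg p f.
Proof.
split=> -[a fa]; exists a; apply: hv_ext fa _ _ => // x;
by rewrite oppr0 expr0z mulr1.
Qed.

Lemma ordeq0E p f : ordeq p 0 f <-> exists2 a, a != 0 & hv p f a.
Proof.
split=> -[a a0 fa]; exists a => //; apply: hv_ext fa _ _ => // x;
by rewrite oppr0 expr0z mulr1.
Qed.

Lemma ordeq_unif p n : ordeq p n (fun x => unif p x ^ n).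
Proof.
exists 1; first exact: oner_neq0.
apply: hv_ae (hv_const p 1) _; apply: cofin_sub (unifD p n (- n)) _ => x <-.
by rewrite subrr expr0z.
Qed.

Lemma ordge1_hv p f : ordge p 1 f -> hv p f 0.
Proof.
move=> [a fa]; apply: hv_ext (hv_shift (m := 0) _ fa) _ _ => // x.
by rewrite oppr0 expr0z mulr1.
Qed.

Lemma ae0_ordge p n f : rat f -> ae0 f -> ordge p n f.
Proof.
move=> rf f0; exists 0; apply: hv_ae (hv_const p 0) _.
by apply: cofin_sub f0 _ => x ->; rewrite mul0r.
Qed.

Lemma hv_ordge1 p f : hv p f 0 -> ordge p 1 f.
Proof.
move=> f0; have rf := hv_rat f0; case: (pselect (ae0 f)) => [|nf]; first exact: ae0_ordge.
have [n fn] := ordeq_ex p rf nf.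
have : (0 <= n)%R by apply: ordge_eq_le fn; apply/ordge0E; exists 0.
rewrite le_eqVlt => /orP[/eqP n0|n0]; last by apply: ordge_le (ordeq_ge fn); lia.
move: fn; rewrite -n0 => /ordeq0E[a a0 fa].
by move: a0; rewrite (hv_uniq fa f0) eqxx.
Qed.

Lemma ordeq_exp p n f (k : nat) : ordeq p n f -> ordeq p (n * k) (fun x => f x ^+ k).
Proof.
move=> fn; elim: k => [|k IH].
  by rewrite mulr0; apply/ordeq0E; exists 1; [exact: oner_neq0|exact: hv_const].
rewrite (_ : n * k.+1 = n + n * k); last by rewrite -[k.+1]addn1 PoszD mulrDr mulr1 addrC.
by under [X in ordeq _ _ X]eq_fun do rewrite exprS; apply: ordeqM.
Qed.

Lemma ordge_exp p n f (k : nat) : ordge p n f -> ordge p (n * k) (fun x => f x ^+ k).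
Proof.
move=> fn; elim: k => [|k IH].
  by rewrite mulr0; apply/ordge0E; exists 1; exact: hv_const.
rewrite (_ : n * k.+1 = n + n * k); last by rewrite -[k.+1]addn1 PoszD mulrDr mulr1 addrC.
by under [X in ordge _ _ X]eq_fun do rewrite exprS; apply: ordgeM.
Qed.

Lemma ordeqZ p n c f : c != 0 -> ordeq p n f -> ordeq p n (fun x => c * f x).
Proof.
move=> c0 fn; rewrite -[n]add0r; apply: ordeqM fn.
by apply/ordeq0E; exists c => //; apply: hv_const.
Qed.

Lemma ordeq_addge p n f g : ordeq p n f -> ordge p (n + 1) g -> ordeq p n (fun x => f x + g x).
Proof.
move=> [a a0 fa] [b gb]; exists a => //.
have /(hv_shift (m := n)) gb' := gb.
apply: hv_ext (hv_add fa (gb' _)) _ _ => [|x|]; [lia|by rewrite mulrDl|exact: addr0].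
Qed.

Lemma rat_value f c : rat f -> ~ cofin (fun x => f x = c) -> cofin (fun x => f x != c).
Proof.
move=> rf nc; apply: cofin_sub (not_ae0 (rat_sub rf (rat_const c)) _) _ => [|x].
  move=> H; apply: nc; apply: cofin_sub H _ => x /eqP.
  by rewrite subr_eq0 => /eqP.
by rewrite subr_eq0.
Qed.

End CurveBasics.

(** * Divisors *)

Section Divisors.
Variables (K : fieldType) (X : abs_curve K).
Implicit Types (p : X) (f g h : X -> K) (a b c : K) (D E Z : seq X).

Definition indep (I : finType) (w : I -> X -> K) : Prop :=
  forall c : I -> K, ae0 (fun x => \sum_i c i * w i x) -> forall i, c i = 0.

Definition ordge_fun (m : X -> int) f := forall p, ordge p (m p) f.

(* The divisors of poles are finite lists of points, repeated as often as their multiplicity. *)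
Definition LL D f := ordge_fun (fun p => - (count_mem p D)%:Z) f.

Definition lin_closed (S : (X -> K) -> Prop) :=
  forall f g e, S f -> S g -> S (fun x => f x - e * g x).

Lemma ordge_lin m p : lin_closed (ordge p m).
Proof.
move=> f g e fm gm; under eq_fun do rewrite -mulNr.
exact/ordgeD/ordgeZ.
Qed.

(** Gaussian elimination of one linear condition a: multiples of a pivot with nonzero entry are
    subtracted from the other functions. If all entries vanish any pivot will do, and one function
    is given up all the same. *)
Lemma indep_drop n (w : 'I_n.+1 -> X -> K) (a : 'I_n.+1 -> K) :
  exists w' : 'I_n -> X -> K,
    (forall j, exists i i0 e, w' j = (fun x => w i x - e * w i0 x) /\ a i - e * a i0 = 0)
    /\ (indep w -> indep w').
Proof.
have [i0 Hi0] : exists i0, forall i, a i0 = 0 -> a i = 0.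
  case: (pselect (exists i, a i != 0)) => [[i ai]|na].
    by exists i => j ai0; rewrite ai0 eqxx in ai.
  by exists ord0 => i _; apply/eqP/negPn/negP => ai; apply: na; exists i.
pose e j := a (lift i0 j) / a i0.
exists (fun j x => w (lift i0 j) x - e j * w i0 x); split.
  move=> j; exists (lift i0 j), i0, (e j); split=> //; rewrite /e.
  have [a0|a0] := eqVneq (a i0) 0; first by rewrite (Hi0 _ a0) a0 !mul0r subrr.
  by rewrite mulfVK // subrr.
move=> iw c H j.
pose c' i := if unlift i0 i is Some j then c j else - \sum_j c j * e j.
have := iw c' _ (lift i0 j); rewrite /c' liftK; apply.
apply: cofin_sub H _ => x H; rewrite (bigD1_ord i0) //= unlift_none.
rewrite -[RHS]H mulNr mulr_suml -sumrN -big_split /=.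
apply: eq_bigr => k _; have -> : unlift i0 (lift i0 k) = Some k by rewrite liftK.
ring.
Qed.

(** Each point of E costs at most one dimension: raising the bound m by one at q means killing the
    leading coefficients there. The predicate S is carried along so that the surviving functions
    keep their shape: affine in f in [free_from_ex], quotients of forms in [form_curve_riemann]. *)
Lemma indep_codim (S : (X -> K) -> Prop) (m : X -> int) E n (w : 'I_n -> X -> K) :
  lin_closed S -> indep w -> (forall i, S (w i)) -> (forall i, ordge_fun m (w i)) ->
  exists w' : 'I_(n - size E) -> X -> K,
    [/\ indep w', forall i, S (w' i) &
        forall i, ordge_fun (fun p => m p + (count_mem p E)%:Z) (w' i)].
Proof.
move=> Scl; elim: E n w m => [|q E IH] n w m iw Sw mw.
  rewrite subn0; exists w; split=> // i p /=; rewrite addr0; exact: mw.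
case: n w iw Sw mw => [|n] w iw Sw mw.
  by rewrite sub0n; exists w; split=> // -[].
have /choice[a wa] : forall i, exists a, hv q (fun x => w i x * unif q x ^ (- m q)) a.
  by move=> i; have [a wa] := mw i q; exists a.
have [w' [Hw' iw']] := indep_drop w a.
pose m' p := m p + (p == q)%:Z.
have Sw' j : S (w' j).
  by have [i [i0 [e [-> _]]]] := Hw' j; apply: Scl.
have mw' j : ordge_fun m' (w' j).
  move=> p; have [i [i0 [e [-> ae]]]] := Hw' j; rewrite /m'.
  have [->|npq] := eqVneq p q; last first.
    by rewrite addr0; exact: ordge_lin (mw i p) (mw i0 p).
  have : hv q (fun x => (w i x - e * w i0 x) * unif q x ^ (- m q)) 0.
    apply: hv_ext (hv_sub (wa i) (hv_mul (hv_const q e) (wa i0))) _ ae => x; ring.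
  case/hv_ordge1 => b Hb; exists b; apply: hv_ae Hb _.
  apply: cofin_sub (unifD q (- m q) (- 1)) _ => x E'.
  by rewrite opprD E' mulrA.
have [w'' [iw'' Sw'' mw'']] := IH _ _ _ (iw' iw) Sw' mw'.
rewrite subSS; exists w''; split=> // i p; have := mw'' i p.
rewrite /m' /= PoszD addrA; suff -> : (p == q)%:Z = (q == p) :> int by [].
by rewrite eq_sym.
Qed.

(** Imposing the zeros D leaves functions without poles, which are constants, and two constants are
    already dependent. *)
Lemma LL_indep_le D n (w : 'I_n -> X -> K) :
  indep w -> (forall i, LL D (w i)) -> (n <= (size D).+1)%N.
Proof.
move=> iw wD.
have [w' [iw' _ Hw']] := indep_codim (S := fun=> True) D (fun _ _ _ _ _ => I) iw (fun=> I) wD.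
have {}Hw' i : exists c, cofin (fun x => w' i x = c).
  apply: liouville.
    by have [p _] := @pts_infinite _ X [::]; exact: ordge_rat (Hw' i p).
  move=> p; apply/ordge0E; have := Hw' i p.
  by rewrite (_ : - (count_mem p D)%:Z + (count_mem p D)%:Z = 0) //; lia.
rewrite leqNgt; apply/negP => lt.
have lt1 : (1 < n - size D)%N by lia.
pose i0 := Ordinal (ltnW lt1); pose i1 := Ordinal lt1.
have [c0 H0] := Hw' i0; have [c1 H1] := Hw' i1.
have i01 : i1 == i0 = false by [].
have i10 : i0 == i1 = false by [].
have key (v : 'I_(n - size D) -> K) :
    cofin (fun x => v i0 * w' i0 x + v i1 * w' i1 x = 0) ->
    (forall i, i != i0 -> i != i1 -> v i = 0) -> forall i, v i = 0.
  move=> Hc cz; apply: iw'; apply: cofin_sub Hc _ => x H.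
  rewrite (bigD1 i0) //= (bigD1 i1) //= big1 ?addr0 // => i /andP[n0 n1].
  by rewrite cz ?mul0r.
have c10 : c1 = 0.
  have := key (fun i => if i == i0 then c1 else if i == i1 then - c0 else 0) _ _ i0.
  rewrite eqxx; apply=> [|i /negbTE-> /negbTE-> //]; rewrite i01 eqxx.
  by apply: cofin_sub (cofin_and H0 H1) _ => x [-> ->]; ring.
have : (1 : K) = 0.
  have := key (fun i => (i == i1)%:R) _ _ i1; rewrite eqxx; apply.
    by apply: cofin_sub H1 _ => x /= ->; rewrite c10 mulr0 mul0r addr0.
  by move=> i _ /negbTE->.
by move/eqP; rewrite (negbTE (oner_neq0 K)).
Qed.

Lemma LL_dep (I : finType) D (w : I -> X -> K) :
  (forall i, LL D (w i)) -> ((size D).+1 < #|I|)%N ->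
  exists2 c : I -> K, (exists i, c i != 0) & ae0 (fun x => \sum_i c i * w i x).
Proof.
move=> wD lt; apply: contrapT => H.
have iw : indep w.
  move=> c Hc i; apply/eqP/negPn/negP => ci; apply: H; exists c => //; by exists i.
have iw' : indep (fun k : 'I_#|I| => w (enum_val k)).
  move=> c Hc k.
  have := iw (fun i => c (enum_rank i)) _ (enum_val k); rewrite enum_valK; apply.
  apply: cofin_sub Hc _ => x Hx; rewrite -[RHS]Hx.
  rewrite (reindex (fun k : 'I_#|I| => enum_val k)) /=; last first.
    by exists enum_rank => j _; rewrite ?enum_valK ?enum_rankK.
  by apply: eq_bigr => j _; rewrite enum_valK.
have := LL_indep_le iw' (fun k => wD (enum_val k)); lia.
Qed.

(** This is dim L(D) >= deg D + 1 - gn; the subtraction is truncated, so nothing is claimed for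
    small D. *)
Definition riemann_ineq (gn : nat) := forall D,
  exists2 w : 'I_((size D).+1 - gn) -> X -> K, indep w & forall i, LL D (w i).

Lemma count_flatten_nseq p (n : nat) D :
  count_mem p (flatten (nseq n D)) = (n * count_mem p D)%N.
Proof. by elim: n => //= n IH; rewrite count_cat IH mulSn. Qed.

Lemma size_flatten_nseq (T : Type) (n : nat) (D : seq T) :
  size (flatten (nseq n D)) = (n * size D)%N.
Proof. by elim: n => //= n IH; rewrite size_cat IH mulSn. Qed.

Lemma finsupp_seq (m : X -> nat) : cofin (fun x => m x = 0%N) ->
  exists D, forall p, count_mem p D = m p.
Proof.
case=> l Hl; exists (flatten [seq nseq (m x) x | x <- undup l]) => p.
have : uniq (undup l) := undup_uniq l.
have : p \notin undup l -> m p = 0%N by rewrite mem_undup; apply: Hl.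
elim: (undup l) => [|q s IH] /=; first by move=> ->.
move=> Hp /andP[qs us]; rewrite count_cat count_nseq.
have [eqp|npq] /= := eqVneq q p.
  subst q; rewrite ?eqxx ?mul1n (_ : count_mem p _ = 0%N) ?addn0 //.
  apply/eqP; rewrite -leqn0 leqNgt -has_count has_pred1.
  apply: contra qs => /flattenP[t /mapP[x xs ->]].
  by rewrite mem_nseq => /andP[_ /eqP->].
rewrite ?(negbTE npq) mul0n add0n; apply: IH us => ps; apply: Hp; rewrite inE negb_or ps.
by rewrite eq_sym npq.
Qed.

Lemma divisor_ex f : rat f -> ~ ae0 f -> exists m : X -> int,
  (forall p, ordeq p (m p) f) /\ cofin (fun x => m x = 0).
Proof.
move=> rf f0; have /choice[m Hm] := fun p => ordeq_ex p rf f0.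
exists m; split=> //; apply: cofin_sub (cofin_and (hv_generic rf) (not_ae0 rf f0)) _.
move=> x [hx fx]; apply: ordeq_uniq (Hm x) _.
by apply/ordeq0E; exists (f x).
Qed.

Lemma zeros_poles f : rat f -> ~ ae0 f -> exists Z E,
  forall p, ordeq p ((count_mem p Z)%:Z - (count_mem p E)%:Z) f /\
            (count_mem p Z = 0%N \/ count_mem p E = 0%N).
Proof.
move=> rf f0; have [m [Hm mf]] := divisor_ex rf f0.
have [|Z HZ] := @finsupp_seq (fun p => if (0 <= m p)%R then `|m p|%N else 0%N).
  by apply: cofin_sub mf _ => x ->.
have [|E HE] := @finsupp_seq (fun p => if (0 <= m p)%R then 0%N else `|m p|%N).
  by apply: cofin_sub mf _ => x ->.
exists Z, E => p; rewrite HZ HE; case: ifP => H.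
  by split; [rewrite (_ : _ - _ = m p) //; lia|right].
by split; [rewrite (_ : _ - _ = m p) //; lia|left].
Qed.

Lemma indep_mul n (w : 'I_n -> X -> K) f : rat f -> ~ ae0 f -> (forall i, rat (w i)) ->
  indep w -> indep (fun i x => w i x * f x).
Proof.
move=> rf f0 rw iw c H; apply: iw.
have : ae0 (fun x => f x * \sum_i c i * w i x).
  apply: cofin_sub H _ => x H; rewrite -[RHS]H mulr_sumr.
  by apply: eq_bigr => i _; ring.
case/(ae0M rf (rat_sum _ (fun i => rat_scale (c i) (rw i)))) => //.
Qed.

Lemma LL_rat D f : LL D f -> rat f.
Proof. by have [p _] := @pts_infinite _ X [::] => /(_ p); apply: ordge_rat. Qed.

Lemma ae0_inv f : ae0 (fun x => (f x)^-1) -> ae0 f.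
Proof. by move=> H; apply: cofin_sub H _ => x /eqP; rewrite invr_eq0 => /eqP. Qed.

(** Multiplication by f^-n embeds L(n E) into L(n Z). For n = gn + 1, an excess of deg E over deg Z
    would gain at least n dimensions, more than the defect gn of Riemann's inequality. *)
Lemma deg_poles_le gn f Z E : riemann_ineq gn -> rat f -> ~ ae0 f ->
  (forall p, ordeq p ((count_mem p Z)%:Z - (count_mem p E)%:Z) f) ->
  (size E <= size Z)%N.
Proof.
move=> RR rf f0 Hf; pose n := gn.+1.
have [w iw wE] := RR (flatten (nseq n E)).
have rfi := rat_exp n (rat_inv rf).
have nfi : ~ ae0 (fun x => (f x)^-1 ^+ n).
  move=> H; apply: f0; apply: cofin_sub H _ => x /eqP.
  by rewrite expf_eq0 /= invr_eq0 => /eqP.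
have wfZ i : LL (flatten (nseq n Z)) (fun x => w i x * (f x)^-1 ^+ n).
  move=> p; have := ordgeM (wE i p) (ordeq_ge (ordeq_exp n (ordeqV (Hf p)))).
  by rewrite !count_flatten_nseq; apply: ordge_le; rewrite /n; lia.
have := LL_indep_le (indep_mul rfi nfi (fun i => LL_rat (wE i)) iw) wfZ.
rewrite !size_flatten_nseq /n => H.
rewrite leqNgt; apply/negP => lt.
have : (gn.+1 * (size Z).+1 <= gn.+1 * size E)%N by rewrite leq_mul2l.
rewrite mulnS; lia.
Qed.

(* The powers of 1/f identify L(n E) with L(n Z), so the degrees of E and Z agree asymptotically. *)
Lemma deg_zeros_poles gn f Z E : riemann_ineq gn -> rat f -> ~ ae0 f ->
  (forall p, ordeq p ((count_mem p Z)%:Z - (count_mem p E)%:Z) f) ->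
  size Z = size E.
Proof.
move=> RR rf f0 Hf; apply/eqP; rewrite eqn_leq (deg_poles_le RR rf f0 Hf) andbT.
apply: deg_poles_le RR (rat_inv rf) (fun H => f0 (ae0_inv H)) _ => p.
have := ordeqV (Hf p); rewrite (_ : - _ = (count_mem p E)%:Z - (count_mem p Z)%:Z) //; lia.
Qed.

(** A nonzero f would have a divisor Z' - E' of degree 0 with Z + E' <= Z' + D at every point, which
    forces deg Z <= deg D. *)
Lemma LL_zeros gn D Z f : riemann_ineq gn -> LL D f ->
  (forall p, ordge p ((count_mem p Z)%:Z - (count_mem p D)%:Z) f) ->
  (size D < size Z)%N -> ae0 f.
Proof.
move=> RR fD fZ lt; apply: contrapT => f0; have rf := LL_rat fD.
have [Z' [E' H]] := zeros_poles rf f0.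
have e := deg_zeros_poles RR rf f0 (fun p => (H p).1).
have pos p : (count_mem p Z + count_mem p E' <= count_mem p Z' + count_mem p D)%N.
  have := ordge_eq_le (fZ p) (H p).1; lia.
have [u Hu] : exists u : seq X, perm_eq ((Z ++ E') ++ u) (Z' ++ D).
  have [|u Hu] := @finsupp_seq (fun p => count_mem p (Z' ++ D) - count_mem p (Z ++ E'))%N.
    apply: cofin_sub (cofin_notin (Z' ++ D)) _ => x nx.
    by have /count_memPn-> := nx.
  exists u; apply/permP => a; apply/permP/allP => p _ /=.
  by rewrite !count_cat Hu !count_cat; have := pos p; lia.
have := perm_size Hu; rewrite !size_cat; lia.
Qed.

End Divisors.

(** * Jets and derivations *)

Section Jets.
Variables (K : numClosedFieldType) (X : abs_curve K).
Implicit Types (p : X) (f g h : X -> K) (a b c : K) (D E Z : seq X).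

(* f = a + b t modulo the square of the maximal ideal at p. *)
Definition jet p f a b :=
  hv p f a /\ hv p (fun x => (f x - a) * (unif p x)^-1) b.

Lemma jet_ex p f a : hv p f a -> exists b, jet p f a b.
Proof.
move=> fa; have := hv_sub fa (hv_const p a); rewrite subrr => /hv_ordge1[b H].
by exists b; split=> //; apply: hv_ext H _ _ => // x; rewrite exprN1.
Qed.

Lemma jet_const p c : jet p (fun=> c) c 0.
Proof.
split; first exact: hv_const.
by apply: hv_ext (hv_const p 0) _ _ => // x; rewrite subrr mul0r.
Qed.

Lemma jet_add p f g a b a' b' : jet p f a b -> jet p g a' b' ->
  jet p (fun x => f x + g x) (a + a') (b + b').
Proof.
move=> [fa fb] [ga gb]; split; first exact: hv_add.
apply: hv_ext (hv_add fb gb) _ _ => // x; ring.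
Qed.

Lemma jet_mul p f g a b a' b' : jet p f a b -> jet p g a' b' ->
  jet p (fun x => f x * g x) (a * a') (a * b' + a' * b).
Proof.
move=> [fa fb] [ga gb]; split; first exact: hv_mul.
apply: hv_ext (hv_add (hv_mul (hv_const p a) gb) (hv_mul ga fb)) _ _ => // x; ring.
Qed.

Lemma jet_inv p f a b : jet p f a b -> a != 0 ->
  jet p (fun x => (f x)^-1) a^-1 (- b / a ^+ 2).
Proof.
move=> [fa fb] a0; split; first exact: hv_inv.
have f0 : cofin (fun x => f x != 0).
  apply: not_ae0 (hv_rat fa) _ => H; move: a0.
  by rewrite (hv_uniq (hv_ae fa H) (hv_const p 0)) eqxx.
apply: hv_ae (hv_eqv (hv_mul (hv_opp fb) (hv_inv (hv_mul fa (hv_const p a)) _)) _) _.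
- by rewrite mulf_neq0.
- by rewrite expr2.
- by apply: cofin_sub f0 _ => x fx; have [t0|t0] := eqVneq (unif p x) 0;
    [rewrite t0 invr0; ring|field; rewrite a0 fx t0].
Qed.

Lemma jet_unif p : jet p (unif p) 0 1.
Proof.
split; first exact: hv_unif.
apply: hv_ae (hv_const p 1) _; apply: cofin_sub (unif_ne0 p) _ => x t0.
by rewrite subr0 divff.
Qed.

Lemma jet_uniq p f a b a' b' : jet p f a b -> jet p f a' b' -> a = a' /\ b = b'.
Proof.
move=> [fa fb] [fa' fb']; have e := hv_uniq fa fa'; split=> //.
by rewrite -e in fb'; apply: hv_uniq fb fb'.
Qed.

Lemma jet_ae p f g a b : jet p f a b -> cofin (fun x => f x = g x) -> jet p g a b.
Proof.
move=> [fa fb] E; split; first exact: hv_ae fa E.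
by apply: hv_ae fb _; apply: cofin_sub E _ => x ->.
Qed.

Lemma jet_horner p (P : {poly K}) f a b : jet p f a b ->
  jet p (fun x => P.[f x]) P.[a] (P^`().[a] * b).
Proof.
move=> jf; elim/poly_ind: P => [|P c IH].
  rewrite horner0 deriv0 horner0 mul0r; under eq_fun do rewrite horner0.
  exact: jet_const.
under eq_fun do rewrite hornerMXaddC.
rewrite hornerMXaddC derivMXaddC hornerD hornerMX.
have := jet_add (jet_mul IH jf) (jet_const p c).
rewrite addr0; suff -> : (P.[a] + P^`().[a] * a) * b = P.[a] * b + a * (P^`().[a] * b) by [].
ring.
Qed.

(* Q(f, g), where the coefficients of Q are evaluated at f. *)
Definition ev2 (Q : {poly {poly K}}) (a b : K) : K := (Q.[b%:P]).[a].

Lemma ev2_rat Q f g : rat f -> rat g -> rat (fun x => ev2 Q (f x) (g x)).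
Proof.
move=> rf rg; rewrite /ev2; elim/poly_ind: Q => [|Q c IH].
  under eq_fun do rewrite !horner0; exact: rat_const.
under eq_fun do rewrite hornerMXaddC hornerD hornerM hornerC.
exact: rat_add (rat_mul IH rg) (rat_horner c rf).
Qed.

(** The chain rule: QX is the partial derivative of Q in its first variable, the same at all
    points. *)
Lemma jet_ev2 (Q : {poly {poly K}}) : exists QX, forall p f g a b a' b',
  jet p f a b -> jet p g a' b' ->
  jet p (fun x => ev2 Q (f x) (g x)) (ev2 Q a a')
    (ev2 QX a a' * b + ev2 Q^`() a a' * b').
Proof.
rewrite /ev2; elim/poly_ind: Q => [|Q c [QX IH]].
  exists 0 => p f g a b a' b' jf jg; rewrite deriv0 !horner0 !mul0r addr0.
  under eq_fun do rewrite !horner0; exact: jet_const.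
exists (QX * 'X + c^`()%:P) => p f g a b a' b' jf jg.
under eq_fun do rewrite hornerMXaddC hornerD hornerM hornerC.
rewrite hornerMXaddC hornerD hornerM hornerC derivMXaddC.
have H := jet_add (jet_mul (IH _ _ _ _ _ _ _ jf jg) jg) (jet_horner c jf).
suff -> : ((QX * 'X + c^`()%:P).[a'%:P]).[a] * b + (Q + Q^`() * 'X).[a'%:P].[a] * b' =
   Q.[a'%:P].[a] * b' + a' * (QX.[a'%:P].[a] * b + Q^`().[a'%:P].[a] * b') + c^`().[a] * b.
  by [].
rewrite hornerMXaddC !hornerD !hornerM !hornerX !hornerC.
ring.
Qed.

Definition nonconst f := forall c, ~ cofin (fun x => f x = c).

Lemma nonconst_horner f (P : {poly K}) : rat f -> nonconst f -> P != 0 ->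
  cofin (fun x => P.[f x] != 0).
Proof.
move=> rf nf P0; have [rs ers] := closed_field_poly_normal P.
have H : cofin (fun x => f x \notin rs).
  elim: {ers} rs => [|r rs IH]; first exact: cofin_all.
  apply: cofin_sub (cofin_and IH (rat_value rf (nf r))) _ => x [A B].
  by rewrite inE negb_or B.
apply: cofin_sub H _ => x nx; rewrite ers hornerZ mulf_neq0 ?lead_coef_eq0 //.
by apply: contra nx; rewrite -root_prod_XsubC.
Qed.

Lemma LL_ex f : rat f -> exists E, LL E f.
Proof.
move=> rf; case: (pselect (ae0 f)) => [f0|f0].
  by exists [::] => p; apply: ae0_ordge.
have [Z [E H]] := zeros_poles rf f0; exists E => p.
by apply: ordge_le (ordeq_ge (H p).1); lia.
Qed.

Lemma LL_sub D E f : (forall p, count_mem p D <= count_mem p E)%N -> LL D f -> LL E f.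
Proof. by move=> DE fD p; apply: ordge_le (fD p); have := DE p; lia. Qed.

Lemma LL_mul D E f g : LL D f -> LL E g -> LL (D ++ E) (fun x => f x * g x).
Proof.
move=> fD gE p; have := ordgeM (fD p) (gE p).
by rewrite count_cat; apply: ordge_le; lia.
Qed.

Lemma LL_exp D f (n : nat) : LL D f -> LL (flatten (nseq n D)) (fun x => f x ^+ n).
Proof.
move=> fD p; have := ordge_exp n (fD p).
by rewrite count_flatten_nseq; apply: ordge_le; lia.
Qed.

(** The (n + 1)^2 monomials f^i g^j with i, j <= n lie in L(2 n E), whose dimension grows only
    linearly in n. *)
Lemma algebraic_dep f g : rat f -> rat g ->
  exists2 Q : {poly {poly K}}, Q != 0 & ae0 (fun x => ev2 Q (f x) (g x)).
Proof.
move=> /LL_ex[E1 f1] /LL_ex[E2 g2]; pose E := E1 ++ E2.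
have fE : LL E f by apply: LL_sub f1 => p; rewrite count_cat leq_addr.
have gE : LL E g by apply: LL_sub g2 => p; rewrite count_cat leq_addl.
(* With this n, the bound 2 n deg E + 1 on the dimension equals n^2 - n + 1. *)
pose n := (2 * size E).+1.
pose w (ij : 'I_n.+1 * 'I_n.+1) x := f x ^+ ij.1 * g x ^+ ij.2.
have wE ij : LL (flatten (nseq (n + n) E)) (w ij).
  apply: LL_sub (LL_mul (LL_exp ij.1 fE) (LL_exp ij.2 gE)) => p.
  rewrite count_cat !count_flatten_nseq -mulnDl leq_mul2r.
  by apply/orP; right; apply: leq_add; rewrite -ltnS.
have [|c [[i0 j0] c0] Hc] := LL_dep wE.
  rewrite size_flatten_nseq card_prod card_ord /n; nia.
exists (\poly_(j < n.+1) \poly_(i < n.+1) c (inord i, inord j)).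
  apply: contra c0 => /eqP/(congr1 (fun Q : {poly {poly K}} => Q`_j0`_i0)).
  by rewrite coef_poly ltn_ord coef_poly ltn_ord !coef0 !inord_val => ->.
apply: cofin_sub Hc _ => x H; rewrite -[RHS]H /ev2 horner_poly horner_sum.
rewrite (eq_bigr (fun j : 'I_n.+1 => \sum_(i < n.+1) c (i, j) * w (i, j) x)); last first.
  move=> j _; rewrite -polyC_exp hornerM hornerC horner_poly mulr_suml.
  by apply: eq_bigr => i _; rewrite !inord_val /w /= mulrA.
rewrite exchange_big /= pair_bigA /=.
by apply: eq_bigr => -[i j].
Qed.

(* The minimal relation is separable in characteristic 0. *)
Lemma separable_rel f g : rat f -> rat g -> nonconst f ->
  exists2 Q : {poly {poly K}}, ae0 (fun x => ev2 Q (f x) (g x)) &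
    cofin (fun x => ev2 Q^`() (f x) (g x) != 0).
Proof.
move=> rf rg nf.
pose P n := `[< exists Q : {poly {poly K}},
  [/\ Q != 0, size Q = n & ae0 (fun x => ev2 Q (f x) (g x))] >].
have exP : exists n, P n.
  have [Q Q0 HQ] := algebraic_dep rf rg.
  by exists (size Q); apply/asboolP; exists Q.
case: (ex_minnP exP) => n /asboolP[Q [Q0 sQ HQ]] min.
exists Q => //; apply: not_ae0 => [|H0]; first exact: ev2_rat.
have [d0|d0] := eqVneq Q^`() 0; last first.
  have : P (size Q^`()) by apply/asboolP; exists Q^`().
  by move/min; rewrite leqNgt -sQ lt_size_deriv.
(* In characteristic 0 a vanishing derivative makes Q constant in the second variable; the relation
   is then a polynomial equation for f alone, which a nonconstant f cannot satisfy. *)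
have s1 : (size Q <= 1)%N.
  rewrite leqNgt; apply/negP => s2.
  have := congr1 (fun R : {poly {poly K}} => R`_(size Q).-2) d0.
  rewrite coef_deriv coef0 prednK; last by rewrite -subn1 subn_gt0.
  move=> /polyP/(_ (size (lead_coef Q)).-1); rewrite coefMn coef0 => /eqP.
  rewrite mulrn_eq0 -/(lead_coef _) -/(lead_coef _) !lead_coef_eq0 (negbTE Q0) orbF.
  by case: (size Q) s2 => [|[]].
move: HQ; rewrite (size1_polyC s1) => HQ.
have c0 : Q`_0 != 0 by apply: contra Q0 => /eqP e; rewrite (size1_polyC s1) e.
apply: (ae0_not (nonconst_horner rf nf c0)).
by apply: cofin_sub HQ _ => x; rewrite /ev2 hornerC.
Qed.

End Jets.

(** * The derivation d/df and its local behaviour *)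

Section Derivations.
Variables (K : numClosedFieldType) (X : abs_curve K).
Implicit Types (p : X) (f g h : X -> K) (a b c : K).

(* The local ring at p is the localization of an algebra generated by the y i. *)
Definition generates p (I : finType) (y : I -> X -> K) : Prop :=
  (forall i, reg p (y i)) /\
  forall A : (X -> K) -> Prop,
    (forall c, A (fun=> c)) -> (forall i, A (y i)) ->
    (forall f g, A f -> A g -> A (fun x => f x + g x)) ->
    (forall f g, A f -> A g -> A (fun x => f x * g x)) ->
    (forall f a, A f -> hv p f a -> a != 0 -> A (fun x => (f x)^-1)) ->
    (forall f g, A f -> cofin (fun x => f x = g x) -> A g) ->
  forall f, reg p f -> A f.

(** Besides generators at each point, one family is asked to generate at almost all points and to
    separate almost all points, as affine coordinates do. *)
Definition finitely_generated : Prop :=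
  (forall p, exists (I : finType) (y : I -> X -> K), generates p y) /\
  exists (I : finType) (y : I -> X -> K),
    [/\ forall i, rat (y i), cofin (fun p => generates p y) &
        exists l : seq X, forall x x', x \notin l -> x' \notin l ->
          (forall i, y i x = y i x') -> x = x'].

Hypothesis FG : finitely_generated.

(** Where the relations Q_i(f, y_i) = 0 have nonzero partial derivative in y_i, a zero slope of f
    forces a zero slope of every generator y_i, hence of every regular function; but the uniformizer
    has slope 1. *)
Lemma unramified_cofin f : rat f -> nonconst f ->
  cofin (fun p => exists2 b, b != 0 & jet p f (f p) b).
Proof.
move=> rf nf; have [_ [I [y [ry gy _]]]] := FG.
have /choice[Q HQ] : forall i, exists Q, ae0 (fun x => ev2 Q (f x) (y i x)) /\
    cofin (fun x => ev2 Q^`() (f x) (y i x) != 0).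
  by move=> i; have [Q Q1 Q2] := separable_rel rf (ry i) nf; exists Q.
have A1 := cofin_forall (fun i => (HQ i).2).
have A2 := cofin_forall (fun i => hv_generic (ry i)).
have A3 := hv_generic rf.
apply: cofin_sub (cofin_and (cofin_and A1 A2) (cofin_and A3 gy)) _.
move=> p [[B1 B2] [B3 [gr gen]]].
have [b jf] := jet_ex B3; exists b => //; apply/eqP => b0; subst b.
have yb i : jet p (y i) (y i p) 0.
  have [b jy] := jet_ex (B2 i); have [QX /(_ _ _ _ _ _ _ _ jf jy) J] := jet_ev2 X (Q i).
  have [_ /eqP] := jet_uniq (jet_ae J (HQ i).1) (jet_const p 0).
  rewrite mulr0 add0r mulf_eq0 (negbTE (B1 i)) => /eqP b0.
  by rewrite b0 in jy.
have [] // := gen (fun g => exists a, jet p g a 0) _ _ _ _ _ _ (unif p).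
- by move=> c; exists c; apply: jet_const.
- by move=> i; exists (y i p).
- by move=> g h [a ja] [a' jh]; exists (a + a'); have := jet_add ja jh; rewrite addr0.
- move=> g h [a ja] [a' jh]; exists (a * a'); have := jet_mul ja jh.
  by rewrite !mulr0 addr0.
- move=> g a' [a ja] ga a0; have e := hv_uniq ga ja.1; subst a'.
  by exists a^-1; have := jet_inv ja a0; rewrite oppr0 mul0r.
- by move=> g h [a ja] e; exists a; apply: jet_ae ja e.
- by exists 0; apply: hv_unif.
- move=> a /(jet_uniq (jet_unif p))[_ /eqP].
  by rewrite (negbTE (oner_neq0 K)).
Qed.

Variable f : X -> K.
Hypotheses (rf : rat f) (nf : nonconst f).

(* D represents dg/df. *)
Definition deriv_of g (D : X -> K) := rat D /\
  cofin (fun p => forall a b a' b', jet p f a b -> jet p g a' b' -> D p * b = b').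

(** Implicit differentiation of Q(f, g) = 0, with D = - Q_X / Q_Y. *)
Lemma deriv_ex g : rat g -> exists D, deriv_of g D.
Proof.
move=> rg; have [Q Q0 QY] := separable_rel rf rg nf.
have [QX J] := jet_ev2 X Q.
exists (fun x => - (ev2 QX (f x) (g x) * (ev2 Q^`() (f x) (g x))^-1)); split.
  have := rat_scale (-1) (rat_mul (ev2_rat QX rf rg) (rat_inv (ev2_rat Q^`() rf rg))).
  by under eq_fun do rewrite mulN1r.
apply: cofin_sub (cofin_and QY (cofin_and (hv_generic rf) (hv_generic rg))) _.
move=> p [q0 [hf hg]] a b a' b' jf jg.
have [ea eb] := jet_uniq (jet_ae (J _ _ _ _ _ _ _ jf jg) Q0) (jet_const p 0).
rewrite (hv_uniq hf jf.1) (hv_uniq hg jg.1) in q0 *.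
rewrite mulNr mulrAC; apply/eqP; rewrite eqr_oppLR; apply/eqP.
by apply: (mulIf q0); rewrite mulfVK // mulNr (mulrC b'); apply/eqP; rewrite -subr_eq0 opprK; apply/eqP.
Qed.


(** The slope of f is nonzero at almost all points, so the slopes of f and g determine D there. *)
Lemma deriv_uniq g g' D D' : rat g -> cofin (fun x => g x = g' x) ->
  deriv_of g D -> deriv_of g' D' -> cofin (fun x => D x = D' x).
Proof.
move=> rg gg' [rD H] [rD' H'].
apply: cofin_sub (cofin_and (cofin_and H H') (cofin_and (unramified_cofin rf nf) (hv_generic rg))) _.
move=> p [[A A'] [[b b0 jf] hg]]; have [b' jg] := jet_ex hg.
have := A' _ _ _ _ jf (jet_ae jg gg'); rewrite -(A _ _ _ _ jf jg).
by move/(mulIf b0).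
Qed.

Lemma deriv_const c : deriv_of (fun=> c) (fun=> 0).
Proof.
split; first exact: rat_const.
apply: cofin_all => p a b a' b' _ /jet_uniq/(_ (jet_const p c))[_ ->].
by rewrite mul0r.
Qed.

Lemma deriv_id : deriv_of f (fun=> 1).
Proof.
split; first exact: rat_const.
by apply: cofin_all => p a b a' b' jf /(jet_uniq jf)[_ <-]; rewrite mul1r.
Qed.

Lemma deriv_ae g g' D : deriv_of g D -> cofin (fun x => g x = g' x) -> deriv_of g' D.
Proof.
move=> [rD H] e; split=> //; apply: cofin_sub H _ => p H a b a' b' jf jg.
apply: H jf (jet_ae jg _); by apply: cofin_sub e _.
Qed.

Lemma deriv_add g h D D' : rat g -> rat h -> deriv_of g D -> deriv_of h D' ->
  deriv_of (fun x => g x + h x) (fun x => D x + D' x).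
Proof.
move=> rg rh [rD H] [rD' H']; split; first exact: rat_add.
apply: cofin_sub (cofin_and (cofin_and H H') (cofin_and (hv_generic rg) (hv_generic rh))) _.
move=> p [[A A'] [/jet_ex[bg jg] /jet_ex[bh jh]]] a b a' b' jf js.
have [_ <-] := jet_uniq (jet_add jg jh) js.
by rewrite mulrDl (A _ _ _ _ jf jg) (A' _ _ _ _ jf jh).
Qed.

Lemma deriv_mul g h D D' : rat g -> rat h -> deriv_of g D -> deriv_of h D' ->
  deriv_of (fun x => g x * h x) (fun x => g x * D' x + h x * D x).
Proof.
move=> rg rh [rD H] [rD' H']; split; first exact/rat_add/rat_mul/rD/rh/rat_mul.
apply: cofin_sub (cofin_and (cofin_and H H') (cofin_and (hv_generic rg) (hv_generic rh))) _.
move=> p [[A A'] [/jet_ex[bg jg] /jet_ex[bh jh]]] a b a' b' jf js.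
have [_ <-] := jet_uniq (jet_mul jg jh) js.
by rewrite mulrDl -!mulrA (A _ _ _ _ jf jg) (A' _ _ _ _ jf jh).
Qed.

Lemma deriv_inv g D : rat g -> ~ ae0 g -> deriv_of g D ->
  deriv_of (fun x => (g x)^-1) (fun x => - D x / g x ^+ 2).
Proof.
move=> rg g0 [rD H]; split.
  apply: rat_mul (rat_inv (rat_exp 2 rg)).
  by have := rat_scale (-1) rD; under eq_fun do rewrite mulN1r.
apply: cofin_sub (cofin_and H (cofin_and (hv_generic rg) (not_ae0 rg g0))) _.
move=> p [A [/jet_ex[bg jg] gp]] a b a' b' jf js.
have [_ <-] := jet_uniq (jet_inv jg gp) js.
by rewrite -(A _ _ _ _ jf jg); ring.
Qed.

Lemma deriv_rat g D : deriv_of g D -> rat D. Proof. by case. Qed.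

Lemma deriv_exp g D (n : nat) : rat g -> deriv_of g D ->
  deriv_of (fun x => g x ^+ n) (fun x => n%:R * g x ^+ n.-1 * D x).
Proof.
move=> rg dg; elim: n => [|n IH].
  under [X in deriv_of _ X]eq_fun do rewrite !mul0r; exact: deriv_const.
under [X in deriv_of X _]eq_fun do rewrite exprS.
have := deriv_mul rg (rat_exp n rg) dg IH.
rewrite (_ : (fun x => _ * (_ * _) + _) = (fun x => n.+1%:R * g x ^+ n.+1.-1 * D x)) //.
apply/funext => x /=; case: n {IH} => [|n] /=; first by rewrite !mul0r mulr0 add0r !mul1r.
by rewrite [in RHS]exprS exprS (natrD _ 1 n.+1); ring.
Qed.

Lemma deriv_horner g D (P : {poly K}) : rat g -> deriv_of g D ->
  deriv_of (fun x => P.[g x]) (fun x => P^`().[g x] * D x).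
Proof.
move=> rg [rD H]; split; first exact/rat_mul/rD/rat_horner.
apply: cofin_sub (cofin_and H (hv_generic rg)) _ => p [A /jet_ex[bg jg]] a b a' b' jf js.
have [_ <-] := jet_uniq (jet_horner P jg) js.
by rewrite -mulrA (A _ _ _ _ jf jg).
Qed.

Lemma deriv_not0 g D : rat g -> nonconst g -> deriv_of g D -> ~ ae0 D.
Proof.
move=> rg ng [rD H]; apply: ae0_not.
apply: cofin_sub (cofin_and H (cofin_and (unramified_cofin rg ng) (hv_generic rf))) _.
move=> p [A [[b b0 jg] /jet_ex[bf jf]]]; apply: contra b0 => /eqP D0.
by rewrite -(A _ _ _ _ jf jg) D0 mul0r.
Qed.

Section Local.
Variables (p : X) (T : X -> K).
Hypothesis dT : deriv_of (unif p) T.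

Lemma unif_nonconst : nonconst (unif p).
Proof.
move=> c H; have e := hv_uniq (hv_ae (hv_unif p) H) (hv_const p c); subst c.
exact: ae0_not (unif_ne0 p) H.
Qed.

Lemma unif_deriv_not0 : ~ ae0 T.
Proof. exact: deriv_not0 (rat_unif p) unif_nonconst dT. Qed.

Let rT : rat T := deriv_rat dT.

(** A common bound holds for the finitely many generators of the local ring, and sums, products and
    inverses of units preserve it. Uniformity in g is what makes the Taylor remainder negligible in
    [local_deriv]. *)
Lemma deriv_bounded : exists c : nat, forall g, reg p g ->
  exists2 D, deriv_of g D & ordge p (- c%:Z) D.
Proof.
have [/(_ p)[I [y [ry gen]]] _] := FG.
have /choice[Dy HD] i : exists D, deriv_of (y i) D.
  by apply: deriv_ex; have [a /hv_rat] := ry i.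
have /choice[e He] i : exists e : nat, ordge p (- e%:Z) (Dy i).
  case: (pselect (ae0 (Dy i))) => [H|H].
    by exists 0%N; apply: ae0_ordge H; apply: deriv_rat (HD i).
  have [n Hn] := ordeq_ex p (deriv_rat (HD i)) H.
  by exists `|n|%N; apply: ordge_le (ordeq_ge Hn); lia.
pose c := \max_i e i; exists c => g rg.
suff : reg p g /\ exists2 D, deriv_of g D & ordge p (- c%:Z) D by case.
apply: (gen (fun g => reg p g /\ exists2 D, deriv_of g D & ordge p (- c%:Z) D)) rg.
  - move=> k; split; first by exists k; apply: hv_const.
    exists (fun=> 0); first exact: deriv_const.
    by apply: ae0_ordge; [exact: rat_const|exact: cofin_all].
  - move=> i; split=> //; exists (Dy i) => //; apply: ordge_le (He i).
    by have : (e i <= c)%N := leq_bigmax i; lia.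
  - move=> g1 g2 [[a1 h1] [D1 d1 o1]] [[a2 h2] [D2 d2 o2]].
    split; first by exists (a1 + a2); apply: hv_add.
    exists (fun x => D1 x + D2 x); last exact: ordgeD.
    exact: deriv_add (hv_rat h1) (hv_rat h2) _ _.
  - move=> g1 g2 [[a1 h1] [D1 d1 o1]] [[a2 h2] [D2 d2 o2]].
    split; first by exists (a1 * a2); apply: hv_mul.
    exists (fun x => g1 x * D2 x + g2 x * D1 x).
      exact: deriv_mul (hv_rat h1) (hv_rat h2) _ _.
    apply: ordgeD; rewrite -[- _]add0r; apply: ordgeM => //; apply/ordge0E.
      by exists a1.
    by exists a2.
  - move=> g1 a [[a1 h1] [D1 d1 o1]] h1' a0.
    split; first by exists a^-1; apply: hv_inv.
    exists (fun x => - D1 x / g1 x ^+ 2).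
      apply: deriv_inv d1; first exact: hv_rat h1.
      by apply: (@ordeq_not0 _ _ p 0); apply/ordeq0E; exists a.
    rewrite -[- _]addr0; apply: ordgeM.
      have := ordgeZ (-1) o1; by under eq_fun do rewrite mulN1r.
    apply/ordge0E; exists (a ^+ 2)^-1.
    by apply: hv_inv; [exact: hv_exp|rewrite expf_neq0].
  - move=> g1 g2 [[a1 h1] [D1 d1 o1]] E.
    split; first by exists a1; apply: hv_ae h1 E.
    by exists D1 => //; apply: deriv_ae d1 E.
Qed.

Lemma taylor (n : nat) g : reg p g -> exists (P : {poly K}) (r : X -> K), reg p r /\
  cofin (fun x => g x = P.[unif p x] + unif p x ^+ n * r x).
Proof.
elim: n g => [|n IH] g rg.
  by exists 0, g; split=> //; apply: cofin_all => x; rewrite horner0 add0r mul1r.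
have [a ga] := rg; have [b [_ jb]] := jet_ex ga.
have [P [r [rr E]]] := IH _ (ex_intro _ b jb).
exists (P * 'X + a%:P), r; split=> //.
apply: cofin_sub (cofin_and E (unif_ne0 p)) _ => x [Ex t0].
rewrite hornerMXaddC exprS; apply: (mulIf (x := (unif p x)^-1)); first by rewrite invr_eq0.
apply: (addIr (- (a / unif p x))); rewrite -mulrBl Ex; field.
exact: t0.
Qed.

(* Expanding g to a high order in the uniformizer, the remainder contributes nothing. *)
Lemma local_deriv g a b D : jet p g a b -> deriv_of g D -> hv p (fun x => D x / T x) b.
Proof.
move=> jg dg; have [c Hc] := deriv_bounded.
have [m Hm] := ordeq_ex p rT unif_deriv_not0.
(* The part c + |m| absorbs the pole of the derivative of r and the order of T; the part 2 makes the
   first-order jet of the n-th power of the uniformizer vanish and leaves one order to spare. *)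
pose n := (2 + c + `|m|)%N.
have [P [r [rr E]]] := taylor n (ex_intro _ a jg.1).
have [Dr dr or] := Hc r rr.
have [r0 hr] := rr; have [r1 jr] := jet_ex hr.
have jtn := jet_horner ('X^n) (jet_unif p).
have {}jtn : jet p (fun x => unif p x ^+ n) 0 0.
  have := jtn; under eq_fun do rewrite hornerXn.
  by rewrite hornerXn derivXn hornerMn hornerXn /n !expr0n /= mul0rn mul0r.
have [_ ->] := jet_uniq (jet_ae jg E) (jet_add (jet_horner P (jet_unif p)) (jet_mul jtn jr)).
have dg' := deriv_add (rat_horner P (rat_unif p)) (rat_mul (rat_exp n (rat_unif p)) (hv_rat hr))
  (deriv_horner P (rat_unif p) dT)
  (deriv_mul (rat_exp n (rat_unif p)) (hv_rat hr) (deriv_exp n (rat_unif p) dT) dr).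
have ED := deriv_uniq (hv_rat jg.1) E dg dg'.
have h1 : hv p (fun x => unif p x ^+ n * (Dr x / T x)) 0.
  apply: ordge1_hv; have := ordgeM (ordeq_ge (ordeq_exp n (ordeq_exp 1 (ordeq_unif p 1))))
    (ordgeM or (ordeq_ge (ordeqV Hm))).
  by apply: ordge_le; rewrite /n; lia.
have h2 := hv_mul (hv_mul (hv_const p n%:R) (hv_exp n.-1 (hv_unif p))) hr.
have h3 := hv_horner P^`() (hv_unif p).
apply: hv_ae (hv_eqv (hv_add (hv_add h3 h2) h1) _) _.
  by rewrite /n expr0n /=; ring.
apply: cofin_sub (cofin_and ED (not_ae0 rT unif_deriv_not0)) _ => x [-> T0].
by field.
Qed.

(** Product rule for g = u t^n: the term u' t^n is of higher order, so n u(p) is the leading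
    coefficient. In characteristic 0 it is nonzero as soon as n and a are, and the order of the
    derivative is known exactly. *)
Lemma local_deriv_ord g D (n : int) a : hv p (fun x => g x * unif p x ^ (- n)) a ->
  deriv_of g D -> hv p (fun x => D x / T x * unif p x ^ (- (n - 1))) (n%:~R * a).
Proof.
move=> ha dg; pose u x := g x * unif p x ^ (- n).
have [b ju] := jet_ex ha; have [Du du] := deriv_ex (hv_rat ha).
have hu := local_deriv ju du.
have rt := rat_unif p.
have nt : ~ ae0 (unif p) := ae0_not (unif_ne0 p).
have [Dn dn EDn] : exists2 Dn, deriv_of (fun x => unif p x ^ n) Dn &
    cofin (fun x => Dn x = n%:~R * unif p x ^ (n - 1) * T x).
  case: (intP n) => [|k|k].
  - exists (fun=> 0); first exact: deriv_const.
    by apply: cofin_all => x; rewrite !mul0r.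
  - exists (fun x => k.+1%:R * unif p x ^+ k * T x); first exact (deriv_exp k.+1 rt dT).
    by apply: cofin_all => x; have -> : k.+1%:Z - 1 = k by lia.
  - exists (fun x => - (k.+1%:R * unif p x ^+ k * T x) / (unif p x ^+ k.+1) ^+ 2).
      under [X in deriv_of X _]eq_fun do rewrite -invr_expz.
      apply: deriv_inv (deriv_exp k.+1 rt dT); first exact: rat_exp.
      by move=> H; apply: nt; apply: cofin_sub H _ => x /eqP; rewrite expf_eq0 => /eqP.
    apply: cofin_sub (unif_ne0 p) _ => x t0.
    have -> : - k.+1%:Z - 1 = - k.+2%:Z by lia.
    rewrite -[unif p x ^ - _]invr_expz -exprnP mulrNz mulNr.
    rewrite (exprS _ k.+1) (exprS _ k).
    have tk : unif p x ^+ k != 0 by rewrite expf_neq0.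
    by field; rewrite tk t0.
have E : cofin (fun x => g x = u x * unif p x ^ n).
  apply: cofin_sub (cofin_and (unif_ne0 p) (unifD p (- n) n)) _ => x [t0 e].
  by rewrite /u -mulrA -e addrC subrr expr0z mulr1.
have rg : rat g by apply: (@ordge_rat _ _ p n); exists a.
have ED := deriv_uniq rg E dg (deriv_mul (hv_rat ha) (rat_expz n rt) du dn).
apply: hv_ae (hv_eqv (hv_add (hv_mul hu (hv_unif p)) (hv_mul (hv_const p n%:~R) ha)) _) _.
  by rewrite mulr0 add0r.
apply: cofin_sub (cofin_and (cofin_and ED EDn) (cofin_and (not_ae0 rT unif_deriv_not0)
  (cofin_and (unif_ne0 p) (unifD p n (- 1))))) _ => x [[-> ->] [T0 [t0 e]]].
rewrite opprB e.
have -> : unif p x ^ (1 - n) = unif p x / unif p x ^ n by rewrite expfzDr // expr1z -invr_expz.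
have tn : unif p x ^ n != 0 by rewrite expfz_neq0.
rewrite /u -invr_expz exprN1; field.
by rewrite T0 t0 tn.
Qed.

End Local.
End Derivations.

(** * Ramification in a pencil *)

Lemma cofin_in (T : eqType) (U : eqType) (s : seq U) (Q : U -> T -> Prop) :
  (forall x, x \in s -> cofin (Q x)) -> cofin (fun y => forall x, x \in s -> Q x y).
Proof.
elim: s => [|u s IH] H; first exact: cofin_all.
have A : cofin (Q u) by apply: H; rewrite mem_head.
have B : cofin (fun y => forall x, x \in s -> Q x y).
  by apply: IH => x xs; apply: H; rewrite inE xs orbT.
by apply: cofin_sub (cofin_and A B) _ => y [a b] x; rewrite inE => /orP[/eqP->|/b].
Qed.

Lemma cofin_lin (K : fieldType) (a b : K) : a != 0 \/ b != 0 ->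
  cofin (fun l : K => a + l * b != 0).
Proof.
move=> ab; exists [:: - a / b] => l; rewrite inE => nl; apply: contra nl => /eqP e.
have [b0|b0] := eqVneq b 0; last by apply/eqP; apply: (mulIf b0); rewrite mulfVK // -[LHS](addKr a) e addr0.
by move: e ab; rewrite b0 mulr0 addr0 => ->; rewrite eqxx => -[].
Qed.

Section Pencil.
Variables (K : numClosedFieldType) (X : abs_curve K).
Implicit Types (p : X) (a b c l : K).
Hypothesis FG : finitely_generated X.
Variables (D : seq X) (f h : X -> K).

Definition no_triple (F : X -> K) := forall p, p \notin D -> ~ ordge p 3 (fun x => F x - F p).
Definition ramif (F : X -> K) p := ordge p 2 (fun x => F x - F p).
Definition sep_ram (F : X -> K) := forall p p', p \notin D -> p' \notin D ->
  ramif F p -> ramif F p' -> F p = F p' -> p = p'.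
Definition poles (F : X -> K) := forall p, p \in D -> ordeq p (- (count_mem p D)%:Z) F.

Hypotheses (Dne : D != [::]) (fD : poles f)
  (fv : forall p, p \notin D -> hv p f (f p))
  (hv_ : forall p, p \notin D -> hv p h (h p)) (hD : LL D h)
  (fh : forall b c, ~ cofin (fun x => h x = b * f x + c))
  (f3 : no_triple f) (fsep : sep_ram f).

Let count_gt0 p : p \in D -> (0 < count_mem p D)%N.
Proof. by move=> pD; rewrite -has_count has_pred1. Qed.

Let D_ex : exists p, p \in D.
Proof. by case: (D) Dne => // p s _; exists p; rewrite mem_head. Qed.

Let rf : rat f.
Proof. by have [p /fD/ordeq_rat] := D_ex. Qed.

Let rh : rat h := LL_rat hD.

Lemma poles_nonconst : nonconst f.
Proof.
move=> c H; have [p pD] := D_ex; have Hp := fD pD; have := count_gt0 pD.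
have : ordge p 0 f by apply/ordge0E; exists c; apply: hv_ae (hv_const p c) _; apply: cofin_sub H _ => x ->.
by move=> /ordge_eq_le/(_ Hp); lia.
Qed.
Let nf := poles_nonconst.

Lemma ordge2_jet p F a b : jet p F a b -> ordge p 2 (fun x => F x - a) <-> b = 0.
Proof.
move=> [Fa Fb]; split.
  case=> e He; apply: hv_uniq Fb _; have lt12 : (1 < 2 :> int) by [].
  by apply: hv_ext (hv_shift lt12 He) _ _ => // x; rewrite exprN1.
move=> b0; rewrite b0 in Fb; have [e He] := hv_ordge1 Fb; exists e.
apply: hv_ae He _; apply: cofin_sub (unifD p (- 1) (- 1)) _ => x E.
by rewrite -[in LHS]exprN1 -mulrA -E.
Qed.

Lemma ramif_jet p F b : jet p F (F p) b -> ramif F p <-> b = 0.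
Proof. exact: ordge2_jet. Qed.

Variable kap : X -> K.
Hypothesis dh : deriv_of f h kap.

Let rk : rat kap := deriv_rat dh.

Let unif_T p : exists2 T, deriv_of f (unif p) T & rat T /\ ~ ae0 T.
Proof.
have [T dT] := deriv_ex rf nf (rat_unif p); exists T => //; split.
  exact: deriv_rat dT.
exact (unif_deriv_not0 FG rf dT).
Qed.

Let kap_split p T : cofin (fun x => T x != 0) -> forall n m,
  ordge p n (fun x => kap x / T x) -> ordeq p m (fun x => 1 / T x) -> ordge p (n - m) kap.
Proof.
move=> T0 n m A B; apply: ordge_ae (ordgeM A (ordeq_ge (ordeqV B))) _.
apply: cofin_sub T0 _ => x t0; field; exact: t0.
Qed.

Let kap_spliteq p T : cofin (fun x => T x != 0) -> forall n m,
  ordeq p n (fun x => kap x / T x) -> ordeq p m (fun x => 1 / T x) -> ordeq p (n - m) kap.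
Proof.
move=> T0 n m A B; apply: ordeq_ae (ordeqM A (ordeqV B)) _.
apply: cofin_sub T0 _ => x t0; field; exact: t0.
Qed.

Let df1 (a : K) : deriv_of f (fun x => f x - a) (fun=> 1).
Proof.
have := deriv_add rf (rat_const X (- a)) (deriv_id f) (deriv_const f (- a)).
by under [X in deriv_of _ _ X]eq_fun do rewrite addr0.
Qed.

Let dhc (a : K) : deriv_of f (fun x => h x - a) kap.
Proof.
have := deriv_add rh (rat_const X (- a)) dh (deriv_const f (- a)).
by under [X in deriv_of _ _ X]eq_fun do rewrite addr0.
Qed.

(** At p the function f has a pole of exact order n > 0 and h one of order at most n. After
    differentiation by the uniformizer the orders are exactly -n - 1 and at least -n - 1. *)
Lemma kap_pole p : p \in D -> ordge p 0 kap.
Proof.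
move=> pD; have [T dT [rT T0]] := unif_T p.
have [a a0 fa] := fD pD; have [b hb] := hD p.
have A := local_deriv_ord FG rf nf dT fa (deriv_id f).
have B := local_deriv_ord FG rf nf dT hb dh.
set n := - (count_mem p D)%:Z in A B.
rewrite -(subrr (n - 1)); apply: (kap_split (not_ae0 rT T0)).
  by eexists; exact: B.
exists (n%:~R * a) => //; rewrite mulf_neq0 // intr_eq0 /n.
by have := count_gt0 pD; lia.
Qed.

Lemma kap_unram p b b' : p \notin D -> jet p f (f p) b -> jet p h (h p) b' -> b != 0 ->
  hv p kap (b' / b).
Proof.
move=> pD jf jh b0; have [T dT [rT T0]] := unif_T p.
have A := local_deriv FG rf nf dT jf (deriv_id f).
have B := local_deriv FG rf nf dT jh dh.
apply: hv_ae (hv_mul B (hv_inv A b0)) _.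
apply: cofin_sub (not_ae0 rT T0) _ => x t0; field; exact: t0.
Qed.

(** By [f3] the function f - f p has order exactly 2, so df has a simple zero at p, and dh/df has a
    pole there precisely when the slope b' of h is nonzero. *)
Lemma kap_ram p b' : p \notin D -> jet p f (f p) 0 -> jet p h (h p) b' ->
  ordge p (-1) kap /\ if b' == 0 then ordge p 0 kap else ordeq p (-1) kap.
Proof.
move=> pD jf jh; have [T dT [rT T0]] := unif_T p.
have r2 : ordge p 2 (fun x => f x - f p) by apply/(ordge2_jet jf).
have [a fa] := r2.
have a0 : a != 0.
  apply/eqP => a0; apply: (f3 pD); rewrite a0 in fa.
  have [e He] := hv_ordge1 fa; exists e; apply: hv_ae He _.
  by apply: cofin_sub (unifD p (- 2) (- 1)) _ => x E; rewrite -mulrA -E.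
have A := local_deriv_ord FG rf nf dT fa (df1 (f p)).
have B := local_deriv FG rf nf dT jh dh.
have A1 : ordeq p 1 (fun x => 1 / T x).
  by exists (2%:~R * a) => //; rewrite mulf_neq0 // intr_eq0.
have B0 : ordge p 0 (fun x => kap x / T x) by apply/ordge0E; exists b'.
split; first by rewrite -(sub0r 1); apply: (kap_split (not_ae0 rT T0)) B0 A1.
have [b0|b0] := eqVneq b' 0.
  rewrite -(subrr 1); apply: (kap_split (not_ae0 rT T0)) A1.
  by rewrite b0 in B; apply: hv_ordge1.
rewrite -(sub0r 1); apply: (kap_spliteq (not_ae0 rT T0)) A1.
by apply/ordeq0E; exists b'.
Qed.

(** The ramification points of f that do not persist for l nonzero, h being unramified there. They
    are the poles of [kap], all simple. *)
Definition moving p := p \notin D /\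
  exists2 b', b' != 0 & jet p f (f p) 0 /\ jet p h (h p) b'.

Lemma moving_list : exists2 R : seq X, uniq R & forall p, p \in R <-> moving p.
Proof.
have [l Hl] := unramified_cofin FG rf nf.
exists (undup [seq p <- l | `[< moving p >]]); first exact: undup_uniq.
move=> p; rewrite mem_undup mem_filter; split; first by case/andP=> /asboolP.
move=> mp; apply/andP; split; first exact/asboolP.
apply/negPn/negP => /Hl[b b0 jf]; have [_ [b' _ [jf' _]]] := mp.
by have [_ e] := jet_uniq jf jf'; rewrite e eqxx in b0.
Qed.

Lemma kap_not_moving p : ~ moving p -> ordge p 0 kap.
Proof.
move=> nm; have [pD|pD] := boolP (p \in D); first exact: kap_pole.
have [b jf] := jet_ex (fv pD); have [b' jh] := jet_ex (hv_ pD).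
have [b0|b0] := eqVneq b 0; last by apply/ordge0E; eexists; apply: kap_unram jf jh b0.
rewrite b0 in jf; have [_] := kap_ram pD jf jh; case: eqP => // /eqP b'0 _.
by case: nm; split=> //; exists b'.
Qed.

Lemma kap_moving p : moving p -> ordeq p (-1) kap.
Proof.
case=> pD [b' b0 [jf jh]]; have [_] := kap_ram pD jf jh.
by rewrite (negbTE b0).
Qed.

(** Without such points [kap] has no poles and is a constant c; then h - c f has derivative 0 and is
    constant, against [fh]. *)
Lemma moving_ex : exists p, moving p.
Proof.
apply: contrapT => nm.
have [|c Hc] := liouville rk.
  by move=> p; apply/ordge0E/kap_not_moving => mp; apply: nm; exists p.
pose g x := h x - c * f x.
have rg : rat g by apply: rat_sub rh (rat_scale c rf).
have dg : deriv_of f g (fun x => kap x - c).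
  have := deriv_add rh (rat_scale (- c) rf) dh
    (deriv_mul (rat_const X (- c)) rf (deriv_const f (- c)) (deriv_id f)).
  rewrite (_ : (fun x => h x + - c * f x) = g); last by apply/funext => x; rewrite /g mulNr.
  by under [X in deriv_of _ _ X]eq_fun do rewrite mulr0 addr0 mulr1.
apply: (deriv_not0 FG rf rg _ dg).
  move=> e He; apply: (fh (b := c) (c := e)); apply: cofin_sub He _ => x <-.
  by rewrite /g; ring.
by apply: cofin_sub Hc _ => x ->; rewrite subrr.
Qed.

Lemma kap_nonconst : nonconst kap.
Proof.
have [p /kap_moving kp] := moving_ex => c H.
have : ordge p 0 kap by apply/ordge0E; exists c; apply: hv_ae (hv_const p c) _; apply: cofin_sub H _ => x ->.
by move=> /ordge_eq_le/(_ kp).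
Qed.

Let k0 : cofin (fun x => kap x != 0) := rat_value rk (@kap_nonconst 0).

(* Where the member of the pencil ramified at x takes its critical value. *)
Definition crit x := f x - h x / kap x.

Lemma crit_rat : rat crit.
Proof. exact: rat_sub rf (rat_mul rh (rat_inv rk)). Qed.

Lemma kapV_moving p : moving p -> hv p (fun x => (kap x)^-1) 0.
Proof. by move/kap_moving/ordeqV/ordeq_ge/ordge1_hv. Qed.

Lemma crit_moving p : moving p -> hv p crit (f p).
Proof.
move=> mp; have [pD _] := mp.
apply: hv_eqv (hv_sub (fv pD) (hv_mul (hv_ pD) (kapV_moving mp))) _.
by rewrite mulr0 subr0.
Qed.

(** Since [kap] is infinite at p, division by its e-th power isolates the coefficient of degree
    e. *)
Lemma horner_kap_lead p (c : {poly K}) (e : nat) : moving p -> (size c <= e.+1)%N ->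
  hv p (fun x => c.[kap x] * (kap x)^-1 ^+ e) c`_e.
Proof.
move=> mp sc.
have H : hv p (fun x => \sum_(i < e.+1) c`_i * (kap x)^-1 ^+ (e - i))
    (\sum_(i < e.+1) c`_i * 0 ^+ (e - i)).
  by apply: hv_sum => i; apply: hv_mul (hv_const p _) (hv_exp _ (kapV_moving mp)).
apply: hv_ae (hv_eqv H _) _.
  rewrite big_ord_recr /= subnn expr0 mulr1 big1 ?add0r // => i _.
  by rewrite expr0n subn_eq0 leqNgt ltn_ord /= mulr0.
apply: cofin_sub k0 _ => x kx; rewrite (horner_coef_wide _ sc) mulr_suml.
apply: eq_bigr => i _; rewrite -mulrA; congr (_ * _).
have ie : (i <= e)%N by rewrite -ltnS.
have -> : (kap x)^-1 ^+ e = (kap x)^-1 ^+ (e - i) * (kap x)^-1 ^+ i by rewrite -exprD subnK.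
by rewrite mulrCA -exprMn mulfV // expr1n mulr1.
Qed.

(** Divide a relation by the highest power of [kap] and evaluate at the moving points: there [crit]
    takes the values f p, distinct by [fsep]. The leading coefficients thus form a polynomial of
    degree less than #R with #R distinct roots. *)
Lemma crit_indep (R : seq X) (c : 'I_(size R) -> {poly K}) :
  uniq R -> (forall p, p \in R <-> moving p) ->
  ae0 (fun x => \sum_j (c j).[kap x] * crit x ^+ j) -> forall j, c j = 0.
Proof.
move=> uR HR H; apply: contrapT => /existsNP[j0 cj0].
pose s := \max_j size (c j).
have s0 : (0 < s)%N.
  by apply: leq_trans (leq_bigmax j0); rewrite size_poly_gt0; apply/eqP.
pose C k := if insub k is Some i then c i else 0.
have CE (i : 'I_(size R)) : C i = c i by rewrite /C valK.
pose P := \poly_(j < size R) (C j)`_s.-1.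
have P0 : P = 0.
  apply/eqP/negPn/negP => P0; have := max_poly_roots (rs := map f R) P0.
  rewrite size_map ltnNge size_poly /= => /(_ _ _)/negP[] //.
    apply/allP => y /mapP[p pR ->]; have mp := (HR p).1 pR.
    rewrite rootE horner_poly; apply/eqP.
    have A : hv p (fun x => \sum_(j < size R) ((c j).[kap x] * (kap x)^-1 ^+ s.-1) * crit x ^+ j)
       (\sum_(j < size R) (c j)`_s.-1 * f p ^+ j).
      apply: hv_sum => j; apply: hv_mul (hv_exp _ (crit_moving mp)).
      apply: horner_kap_lead mp _; rewrite prednK //.
      exact: (leq_bigmax (F := fun i => size (c i)) j).
    have B : cofin (fun x => \sum_(j < size R) ((c j).[kap x] * (kap x)^-1 ^+ s.-1) * crit x ^+ j = 0).
      apply: cofin_sub H _ => x Hx.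
      transitivity ((\sum_j (c j).[kap x] * crit x ^+ j) * (kap x)^-1 ^+ s.-1).
        by rewrite mulr_suml; apply: eq_bigr => j _; ring.
      by rewrite Hx mul0r.
    have := hv_uniq (hv_ae A B) (hv_const p 0) => E.
    by rewrite -[RHS]E; apply: eq_bigr => j _; rewrite CE.
  rewrite map_inj_in_uniq // => p q /HR mp /HR mq; apply: fsep; first by case: mp.
  - by case: mq.
  - by case: mp => _ [b _ [jf _]]; apply/(ramif_jet jf).
  - by case: mq => _ [b _ [jf _]]; apply/(ramif_jet jf).
have [j1 sj1] : exists j1, size (c j1) = s.
  have [|j1 _ e] := @eq_bigmax_cond 'I_(size R) predT (fun j => size (c j)).
    by apply/card_gt0P; exists j0.
  by exists j1; rewrite -e.
have := congr1 (fun Q : {poly K} => Q`_j1) P0.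
rewrite coef_poly ltn_ord coef0 CE -sj1 -/(lead_coef _) => /eqP.
by rewrite lead_coef_eq0 -size_poly_eq0 sj1 eqn0Ngt s0.
Qed.

Lemma LL_ex_fin (I : finType) (w : I -> X -> K) : (forall i, rat (w i)) ->
  exists E, forall i, LL E (w i).
Proof.
move=> rw; have /choice[E HE] := fun i => LL_ex (rw i).
exists (flatten [seq E i | i <- enum I]) => i; apply: LL_sub (HE i) => p.
have : i \in enum I by rewrite mem_enum.
elim: (enum I) => // j s IH; rewrite inE /= count_cat => /orP[/eqP->|/IH]; lia.
Qed.

Lemma moving_LL (R : seq X) : uniq R -> (forall p, p \in R <-> moving p) -> LL R kap.
Proof.
move=> uR HR p; rewrite count_uniq_mem //; case: (boolP (p \in R)) => [/HR/kap_moving/ordeq_ge //|pR].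
by apply: kap_not_moving => /HR; rewrite (negbTE pR).
Qed.

(* K(X) has degree at most #moving over K(kap), so by crit_indep it is generated by crit. *)
Lemma crit_generates g : rat g ->
  exists l : seq X, forall x y, x \notin l -> y \notin l ->
    kap x = kap y -> crit x = crit y -> g x = g y.
Proof.
move=> rg; have [R uR HR] := moving_list; pose M := size R.
pose u (j : 'I_M.+1) x := if (j < M)%N then crit x ^+ j else g x.
have ru j : rat (u j) by rewrite /u; case: (j < M)%N => //; apply: rat_exp crit_rat.
(* The (M + 1)(n + 1) products below lie in L(n R + E), of dimension at most n M + deg E + 1 = n M +
   n. *)
have [E HE] := LL_ex_fin ru; pose n := (size E).+1.
pose w (ji : 'I_M.+1 * 'I_n.+1) x := kap x ^+ ji.2 * u ji.1 x.
have wL ji : LL (flatten (nseq n R) ++ E) (w ji).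
  apply: LL_sub (LL_mul (LL_exp ji.2 (moving_LL uR HR)) (HE ji.1)) => p.
  rewrite !count_cat leq_add2r !count_flatten_nseq; have le : (ji.2 <= n)%N by rewrite -ltnS.
  exact: leq_mul le (leqnn (count_mem p R)).
have [|c [[j0 i0] c0] Hc] := LL_dep wL.
  by rewrite size_cat size_flatten_nseq card_prod !card_ord -/M /n; nia.
pose C j := \poly_(i < n.+1) c (j, inord i).
have CE x : \sum_ji c ji * w ji x = \sum_j (C j).[kap x] * u j x.
  rewrite (eq_bigr (fun ji => c (ji.1, ji.2) * w (ji.1, ji.2) x)); last by case.
  rewrite -(pair_bigA _ (fun j i => c (j, i) * w (j, i) x)) /=.
  apply: eq_bigr => j _; rewrite horner_poly mulr_suml; apply: eq_bigr => i _.
  by rewrite inord_val /w /= mulrA.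
have {Hc} H : cofin (fun x => \sum_(j < M) (C (widen_ord (leqnSn M) j)).[kap x] * crit x ^+ j +
     (C ord_max).[kap x] * g x = 0).
  apply: cofin_sub Hc _ => x; rewrite CE big_ord_recr /= /u ltnn => Hx; rewrite -[RHS]Hx.
  by congr (_ + _); apply: eq_bigr => j _ /=; rewrite ltn_ord.
have CM : C ord_max != 0.
  apply/eqP => CM; have Cz := crit_indep (c := fun j => C (widen_ord (leqnSn M) j)) uR HR.
  have {}Cz : forall j : 'I_M, C (widen_ord (leqnSn M) j) = 0.
    by apply: Cz; apply: cofin_sub H _ => x Hx; rewrite -[RHS]Hx CM horner0 mul0r addr0.
  have Cj : C j0 = 0.
    have [jM|jM] := ltnP j0 M; last first.
      suff -> : j0 = ord_max by [].
      apply: val_inj; apply/eqP.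
      by rewrite eqn_leq jM andbT -ltnS; exact: ltn_ord j0.
    by have -> : j0 = widen_ord (leqnSn M) (Ordinal jM) by apply: val_inj.
  move: c0; have := congr1 (fun Q : {poly K} => Q`_i0) Cj.
  by rewrite coef_poly ltn_ord inord_val coef0 => ->; rewrite eqxx.
have [l Hl] := cofin_and H (nonconst_horner rk kap_nonconst CM).
exists l => x y /Hl[Hx Cx] /Hl[Hy _] ek ec.
apply: (mulfI Cx); apply: (addrI (\sum_(j < M) (C (widen_ord (leqnSn M) j)).[kap x] * crit x ^+ j)).
by rewrite Hx ek ec Hy.
Qed.

(** By [crit_generates] the coordinates that separate almost all points are themselves determined by
    [kap] and [crit]. *)
Lemma kap_crit_separate : exists l : seq X, forall x y, x \notin l -> y \notin l ->
  kap x = kap y -> crit x = crit y -> x = y.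
Proof.
have [_ [I [y [ry _ [l0 sep]]]]] := FG.
have /choice[l Hl] := fun i => crit_generates (ry i).
exists (l0 ++ flatten [seq l i | i <- enum I]) => x x'.
rewrite !mem_cat !negb_or => /andP[x0 xl] /andP[x'0 x'l] ek ec.
apply: sep => // i; apply: Hl ek ec.
  apply: contra xl => xi; apply/flattenP; exists (l i) => //.
  by apply: map_f; rewrite mem_enum.
apply: contra x'l => xi; apply/flattenP; exists (l i) => //.
by apply: map_f; rewrite mem_enum.
Qed.

Definition pencil l x := f x + l * h x.

Lemma pencil_jet l p b b' : jet p f (f p) b -> jet p h (h p) b' ->
  jet p (pencil l) (pencil l p) (b + l * b').
Proof.
move=> jf jh; have := jet_add jf (jet_mul (jet_const p l) jh).
by rewrite mulr0 addr0.
Qed.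

Let jets p : p \notin D -> exists b b', jet p f (f p) b /\ jet p h (h p) b'.
Proof.
move=> pD; have [b jf] := jet_ex (fv pD); have [b' jh] := jet_ex (hv_ pD).
by exists b, b'.
Qed.

Lemma good_points : exists X0 : seq X,
  [/\ forall x, x \notin X0 -> x \notin D,
      forall x, x \notin X0 -> exists b b', [/\ b != 0, jet x f (f x) b, jet x h (h x) b' &
         kap x = b' / b],
      forall x, x \notin X0 -> exists2 e, e != 0 & jet x kap (kap x) e &
      forall x y, x \notin X0 -> y \notin X0 -> kap x = kap y -> crit x = crit y -> x = y].
Proof.
have [l1 H1] := cofin_and (unramified_cofin FG rf nf) (hv_generic rk).
have [l2 H2] := unramified_cofin FG rk kap_nonconst.
have [l3 H3] := kap_crit_separate.
exists (D ++ l1 ++ l2 ++ l3); split=> x.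
- by rewrite mem_cat negb_or => /andP[].
- rewrite !mem_cat !negb_or => /and4P[xD /H1[[b b0 jf] kx] _ _].
  have [_ [b' [_ jh]]] := jets xD.
  exists b, b'; split=> //; apply: hv_uniq kx _; exact: kap_unram.
- by rewrite !mem_cat !negb_or => /and4P[_ _ /H2].
- move=> y; rewrite !mem_cat !negb_or => /and4P[_ _ _ x3] /and4P[_ _ _ y3].
  exact: H3.
Qed.

Lemma ramif_moving l x b b' : b != 0 -> jet x f (f x) b -> jet x h (h x) b' ->
  kap x = b' / b -> ramif (pencil l) x ->
  [/\ kap x != 0, l = - (kap x)^-1 & pencil l x = crit x].
Proof.
move=> b0 jf jh kx /(ramif_jet (pencil_jet l jf jh)) e.
have b'0 : b' != 0.
  by apply: contra b0 => /eqP b'0; move: e; rewrite b'0 mulr0 addr0 => ->.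
have el : l = - (kap x)^-1.
  by rewrite kx; apply: (mulIf b'0); rewrite -[LHS](addKr b) e; field; rewrite b0 b'0.
split=> //; first by rewrite kx mulf_neq0 // invr_eq0.
by rewrite /pencil /crit el; ring.
Qed.

(** Outside the finite set X0 a member can be ramified at x only for l = - 1 / [kap] x, with
    critical value [crit] x. Points of X0 are treated one by one, each condition excluding finitely
    many l. *)
Theorem pencil_simple : exists B : seq K, 0 \notin B /\ forall l, l \notin B ->
  [/\ poles (pencil l), no_triple (pencil l) & sep_ram (pencil l)].
Proof.
have [X0 [X0D X0j X0k X0s]] := good_points.
have C1 : cofin (fun l => forall p, p \in D -> ordeq p (- (count_mem p D)%:Z) (pencil l)).
  apply: cofin_in => p pD; have [a a0 fa] := fD pD; have [b hb] := hD p.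
  apply: cofin_sub (cofin_lin (b := b) (or_introl a0)) _ => l ab; exists (a + l * b) => //.
  by apply: hv_ext (hv_add fa (hv_mul (hv_const p l) hb)) _ _ => // x; rewrite /pencil; ring.
(* On X0 the only ramification that survives is at points where both f and h have slope 0. *)
have C2 : cofin (fun l => forall x, x \in X0 -> x \notin D -> l != 0 -> ramif (pencil l) x ->
    jet x f (f x) 0 /\ jet x h (h x) 0).
  apply: cofin_in => x _; have [xD|xD] := boolP (x \in D); first exact: cofin_all.
  have [b [b' [jf jh]]] := jets xD.
  have [b0|b0] := eqVneq b 0; last first.
    apply: cofin_sub (cofin_lin (b := b') (or_introl b0)) _ => l bl _ _.
    by move/(ramif_jet (pencil_jet l jf jh)) => e; rewrite e eqxx in bl.
  apply: cofin_all => l _ l0; move/(ramif_jet (pencil_jet l jf jh)).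
  rewrite b0 add0r => /eqP; rewrite mulf_eq0 (negbTE l0) => /eqP b'0.
  by rewrite b0 b'0 in jf jh.
have C3 : cofin (fun l => forall x, x \in X0 -> forall y, y \in X0 -> f x != f y ->
    pencil l x != pencil l y).
  apply: cofin_in => x _; apply: cofin_in => y _.
  have [e|ne] := eqVneq (f x) (f y); first exact: cofin_all.
  apply: cofin_sub (cofin_lin (a := f x - f y) (b := h x - h y) _) _ => [|l H _].
    by left; rewrite subr_eq0.
  by rewrite -subr_eq0; apply: contra H => /eqP e; apply/eqP; rewrite -[RHS]e /pencil; ring.
(* No critical value at a point y outside X0 may meet the critical value at a point x where every
   member is ramified. *)
have C4 : cofin (fun l => forall x, x \in X0 -> x \notin D -> jet x f (f x) 0 -> jet x h (h x) 0 ->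
    forall y, y \notin X0 -> l = - (kap y)^-1 -> pencil l x != crit y).
  apply: cofin_in => x _.
  have [[xD [jf jh]]|nx] := pselect (x \notin D /\ jet x f (f x) 0 /\ jet x h (h x) 0); last first.
    by apply: cofin_all => l xD jf jh; case: nx.
  (* The member ramified at y has l = - 1 / [kap] y, hence the value f x - h x / [kap] y at x. The
     difference g is not the zero function: at a moving point r its value is f r - f x, nonzero by
     [fsep]. *)
  pose g y := crit y - (f x - h x / kap y).
  have rg : rat g by apply: rat_sub crit_rat (rat_sub (rat_const X _) (rat_scale _ (rat_inv rk))).
  have [r mr] := moving_ex.
  have [rD [b' b'0 [jfr jhr]]] := mr.
  have nfx : f r != f x.
    apply/eqP => e; have E : r = x by apply: fsep => //; [apply/(ramif_jet jfr)|apply/(ramif_jet jf)].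
    by subst r; have [_ e'] := jet_uniq jh jhr; rewrite -e' eqxx in b'0.
  have g0 : cofin (fun y => g y != 0).
    apply: not_ae0 => // H.
    have Hr : hv r g (f r - (f x - h x * 0)).
      by apply: hv_sub (crit_moving mr) (hv_sub (hv_const _ _) (hv_mul (hv_const _ _) (kapV_moving mr))).
    have := hv_uniq (hv_ae Hr H) (hv_const r 0).
    by rewrite mulr0 subr0 => /eqP; rewrite subr_eq0 (negbTE nfx).
  have [ly Hly] := g0; exists [seq - (kap y)^-1 | y <- ly] => l nl _ _ _ y _ el.
  have yl : y \notin ly by apply: contra nl => yl; rewrite el; apply: map_f.
  have := Hly y yl; rewrite /g subr_eq0 eq_sym; apply: contra => /eqP <-.
  by rewrite /pencil el; apply/eqP; ring.
(* The second-order coefficient of the member is a + l b, with a nonzero by [f3]. *)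
have C5 : cofin (fun l => forall x, x \in X0 -> x \notin D -> jet x f (f x) 0 -> jet x h (h x) 0 ->
    ~ ordge x 3 (fun y => pencil l y - pencil l x)).
  apply: cofin_in => x _.
  have [[xD [jf jh]]|nx] := pselect (x \notin D /\ jet x f (f x) 0 /\ jet x h (h x) 0); last first.
    by apply: cofin_all => l xD jf jh; case: nx.
  have /(ordge2_jet jf)[a fa] := erefl (0 : K).
  have /(ordge2_jet jh)[b hb] := erefl (0 : K).
  have a0 : a != 0.
    apply/eqP => a0; apply: (f3 xD); rewrite a0 in fa.
    have [e He] := hv_ordge1 fa; exists e; apply: hv_ae He _.
    by apply: cofin_sub (unifD x (- 2) (- 1)) _ => y E; rewrite -mulrA -E.
  apply: cofin_sub (cofin_lin (b := b) (or_introl a0)) _ => l ab _ _ _ [e He].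
  have lt23 : (2 < 3 :> int) by [].
  have := hv_shift lt23 He => H.
  have H' := hv_add fa (hv_mul (hv_const x l) hb).
  move: ab; rewrite (hv_uniq (hv_ext H' _ erefl) H) ?eqxx // => y.
  by rewrite /pencil; ring.
have C := cofin_and (cofin_and C1 C2) (cofin_and C3 (cofin_and C4 C5)).
(* The value 0 can be taken out of the bad set because the member at 0 is f, good by hypothesis. *)
case: C => B HB; exists [seq b <- B | b != 0]; split; first by rewrite mem_filter eqxx.
move=> l; rewrite mem_filter negb_and negbK => lB.
have [->|l0] := eqVneq l 0.
  have -> : pencil 0 = f by apply/funext => x; rewrite /pencil mul0r addr0.
  by split.
move: lB; rewrite (negbTE l0) /= => /HB[[H1 H2] [H3 [H4 H5]]]; split=> //.
- move=> x xD x3; have x2 : ramif (pencil l) x by apply: ordge_le x3.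
  have [xX|xX] := boolP (x \in X0).
    have [jf jh] := H2 x xX xD l0 x2; exact: (H5 x xX xD jf jh x3).
  have [b [b' [b0 jf jh kx]]] := X0j x xX.
  have [k0x el _] := ramif_moving b0 jf jh kx x2.
  have [e e0 jk] := X0k x xX.
  have [T dT [rT T0]] := unif_T x.
  have [a xa] := x3.
  have dp : deriv_of f (fun y => pencil l y - pencil l x) (fun y => 1 + l * kap y).
    have := deriv_add (rat_sub rf (rat_const X (f x))) (rat_scale l (rat_sub rh (rat_const X (h x)))) (df1 (f x))
      (deriv_mul (rat_const X l) (rat_sub rh (rat_const X (h x))) (deriv_const f l) (dhc (h x))).
    rewrite (_ : (fun y => _ + _) = (fun y => pencil l y - pencil l x)); last first.
      by apply/funext => y; rewrite /pencil; ring.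
    by under [X in deriv_of _ _ X]eq_fun do rewrite mulr0 addr0.
  have A := local_deriv_ord FG rf nf dT xa dp.
  have B1 := local_deriv FG rf nf dT jf (deriv_id f).
  have B2 : ordeq x 0 (fun y => 1 / T y) by apply/ordeq0E; exists b.
  (* Outside X0, f is unramified and 1 + l [kap] is the derivative of the member along f. A triple
     point would make it vanish to order 2, although [kap] has nonzero slope at x. *)
  have o2 : ordge x 2 (fun y => 1 + l * kap y).
    have A' : ordge x 2 (fun y => (1 + l * kap y) / T y) by exists (3%:~R * a).
    have := ordgeM A' (ordeq_ge (ordeqV B2)); rewrite oppr0 addr0.
    move/ordge_ae; apply; apply: cofin_sub (not_ae0 rT T0) _ => y t0; field; exact: t0.
  have J := jet_add (jet_const x 1) (jet_mul (jet_const x l) jk).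
  have e1 : 1 + l * kap x = 0 by rewrite el mulNr mulVf // subrr.
  rewrite e1 in J; have : 0 + (l * e + kap x * 0) = 0.
    by apply/(ordge2_jet J); apply: ordge_ae o2 _; apply: cofin_all => y; rewrite subr0.
  by rewrite mulr0 addr0 add0r => /eqP; rewrite mulf_eq0 (negbTE l0) (negbTE e0).
- move=> x y xD yD rx ry exy.
  have [xX|xX] := boolP (x \in X0); have [yX|yX] := boolP (y \in X0).
  + have [jf jh] := H2 x xX xD l0 rx; have [jf' jh'] := H2 y yX yD l0 ry.
    apply: fsep => //; [exact/(ramif_jet jf)|exact/(ramif_jet jf')|].
    apply/eqP/negPn/negP => ne; have := H3 x xX y yX ne.
    by rewrite exy eqxx.
  + have [jf jh] := H2 x xX xD l0 rx; have [b [b' [b0 jf' jh' kx]]] := X0j y yX.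
    have [_ el e'] := ramif_moving b0 jf' jh' kx ry.
    by have := H4 x xX xD jf jh y yX el; rewrite exy e' eqxx.
  + have [jf jh] := H2 y yX yD l0 ry; have [b [b' [b0 jf' jh' kx]]] := X0j x xX.
    have [_ el e'] := ramif_moving b0 jf' jh' kx rx.
    by have := H4 y yX yD jf jh x xX el; rewrite -exy e' eqxx.
  (* Both points are critical for the same l, so [kap] agrees on them; equal critical values make
     [crit] agree. *)
  + have [b [b' [b0 jf jh kx]]] := X0j x xX.
    have [b1 [b1' [b10 jf' jh' kx']]] := X0j y yX.
    have [_ el e] := ramif_moving b0 jf jh kx rx.
    have [_ el' e'] := ramif_moving b10 jf' jh' kx' ry.
    apply: X0s => //; last by rewrite -e -e'.
    by apply: invr_inj; apply: oppr_inj; rewrite -el -el'.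
Qed.

End Pencil.

(** * Isotrivial pencils *)

Definition infinitely_many (T : eqType) (L : T -> Prop) :=
  forall s : seq T, exists2 l, l \notin s & L l.

Lemma pigeonhole (T : eqType) (V : eqType) (vals : seq V) (L : T -> Prop) (R : T -> V -> Prop) :
  infinitely_many L -> (forall l, L l -> exists2 v, v \in vals & R l v) ->
  exists2 v, v \in vals & infinitely_many (fun l => L l /\ R l v).
Proof.
elim: vals L => [|v vals IH] L iL HL.
  by have [l _ /HL[]] := iL [::].
have [iv|niv] := pselect (infinitely_many (fun l => L l /\ R l v)).
  by exists v => //; rewrite mem_head.
have [s0 Hs0] : exists s0 : seq T, forall l, l \notin s0 -> L l -> ~ R l v.
  move/existsNP: niv => [s0 Hs0]; exists s0 => l ls Ll Rl; apply: Hs0.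
  by exists l.
have [|l [Ll ls]|w wv iw] := IH (fun l => L l /\ l \notin s0).
- move=> s; have [l] := iL (s ++ s0); rewrite mem_cat negb_or => /andP[ls l0] Ll.
  by exists l.
- have [w] := HL l Ll; rewrite inE => /orP[/eqP->|wv Rw]; last by exists w.
  by move/(Hs0 l ls Ll).
exists w; first by rewrite inE wv orbT.
by move=> s; have [l ls [[Ll _] Rl]] := iw s; exists l.
Qed.

(** One application of [pigeonhole] per point of xs; infinitely many parameters survive each of
    them. *)
Lemma pigeonhole_map (T X : eqType) (xs : seq X) (vals : X -> seq X) (G : T -> (X -> X) -> Prop) :
  infinitely_many (fun l => exists al, G l al) ->
  (forall l al, G l al -> forall x, x \in xs -> al x \in vals x) ->
  exists ys : X -> X,
    infinitely_many (fun l => exists2 al, G l al & forall x, x \in xs -> al x = ys x).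
Proof.
elim: xs G => [|x xs IH] G iG HG.
  by exists id => s; have [l ls [al Ga]] := iG s; exists l => //; exists al.
have [|v _ iv] := pigeonhole (vals := vals x) (R := fun l v => exists2 al, G l al & al x = v) iG.
  by move=> l [al Ga]; exists (al x); [apply: HG Ga _ _; rewrite mem_head|exists al].
have [|l al [Ga _] y ys|ys Hys] := IH (fun l al => G l al /\ al x = v).
- by move=> s; have [l ls [_ [al Ga e]]] := iv s; exists l => //; exists al.
- by apply: HG Ga _ _; rewrite inE ys orbT.
exists (fun y => if y == x then v else ys y) => s.
have [l ls [al [Ga e] Hal]] := Hys s; exists l => //; exists al => // y.
by rewrite inE; case: eqP => [->|_ /Hal].
Qed.

Lemma cofin_uniq_seq (T : eqType) (Q : T -> Prop) (n : nat) :
  (forall l : seq T, exists x, x \notin l) -> cofin Q ->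
  exists s : seq T, [/\ uniq s, size s = n & forall x, x \in s -> Q x].
Proof.
move=> inf [l Hl]; elim: n => [|n [s [us ss Hs]]]; first by exists [::].
have [x] := inf (l ++ s); rewrite mem_cat negb_or => /andP[xl xs].
exists (x :: s); rewrite /= xs us ss; split=> // y.
by rewrite inE => /orP[/eqP->|/Hs //]; apply: Hl.
Qed.

(** * Automorphisms of a curve with fixed points, and their invariant functions *)

Section Rigidity.
Variables (K : numClosedFieldType) (X : abs_curve K).
Implicit Types (p q : X) (f g : X -> K) (a b c e l : K).

Definition pullback_ok (al : X -> X) := forall g a p, hv (al p) g a -> hv p (g \o al) a.

Definition auto (al al' : X -> X) :=
  [/\ cancel al al', cancel al' al, pullback_ok al & pullback_ok al'].

Lemma auto_sym al al' : auto al al' -> auto al' al.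
Proof. by case. Qed.

Lemma auto_comp al al' be be' : auto al al' -> auto be be' -> auto (al \o be) (be' \o al').
Proof.
move=> [a1 a2 a3 a4] [b1 b2 b3 b4]; split; try exact: can_comp.
  by move=> g a p /a3/b3.
by move=> g a p /b4/a4.
Qed.

Lemma cofin_auto al al' (Q : X -> Prop) : auto al al' -> cofin Q -> cofin (fun x => Q (al x)).
Proof.
move=> [a1 _ _ _] [s Hs]; exists (map al' s) => x nx; apply: Hs.
by apply: contra nx => /(map_f al'); rewrite a1.
Qed.

Lemma ordeq_expz p (m n : int) f : ordeq p m f -> ordeq p (m * n) (fun x => f x ^ n).
Proof.
move=> fm; case: (intP n) => [|k|k].
- exact: (ordeq_exp 0 fm).
- exact: (ordeq_exp k.+1 fm).
- by rewrite mulrN; under [X in ordeq _ _ X]eq_fun do rewrite -invr_expz;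
    apply: ordeqV; apply: (ordeq_exp k.+1 fm).
Qed.

(** Pulling back by al and by its inverse multiplies orders by m >= 1 and m' >= 1, and m m' = 1
    because the composite is the identity. *)
Lemma auto_unif al al' p : auto al al' -> ordeq p 1 (unif (al p) \o al).
Proof.
move=> [a1 a2 a3 a4].
have ex al1 al1' q : auto al1 al1' -> exists2 m : int, (1 <= m)%R & ordeq q m (unif (al1 q) \o al1).
  move=> A; have [_ _ b3 _] := A; have H := b3 _ _ _ (hv_unif (al1 q)).
  have [|m Hm] := ordeq_ex q (hv_rat H).
    by apply: ae0_not; have := cofin_auto A (unif_ne0 (al1 q)).
  by exists m => //; apply: ordge_eq_le Hm; apply: hv_ordge1.
have A : auto al al' by split.
have [m m1 Hm] := ex _ _ p A.
have [m' m1' [a a0 Hm']] := ex _ _ (al p) (auto_sym A).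
rewrite a1 in Hm'.
have H1 : ordeq p (m * m' + 0) (fun x => (unif (al p) (al x)) ^ m' *
    (unif p (al' (al x)) * unif (al p) (al x) ^ (- m'))).
  by apply: ordeqM (ordeq_expz m' Hm) _; apply/ordeq0E; exists a => //; apply: (a3 _ _ _ Hm').
have H2 : ordeq p (m * m' + 0) (fun x => unif p x ^ 1).
  apply: ordeq_ae H1 _; apply: cofin_sub (cofin_and (cofin_auto A (unif_ne0 (al p)))
    (cofin_auto A (unifD (al p) m' (- m')))) _ => x [t0 E].
  by rewrite mulrCA -E subrr expr0z mulr1 a1 expr1z.
have := ordeq_uniq H2 (ordeq_unif p 1).
rewrite addr0 => e; suff em : m = 1 by rewrite em in Hm.
nia.
Qed.

Lemma auto_ordeq al al' p (n : int) f : auto al al' -> ordeq (al p) n f -> ordeq p n (f \o al).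
Proof.
move=> A [a a0 fa]; have [_ _ a3 _] := A.
have H : ordeq p (0 + 1 * n) (fun x => (f (al x) * unif (al p) (al x) ^ (- n)) * unif (al p) (al x) ^ n).
  apply: ordeqM (ordeq_expz n (auto_unif p A)).
  by apply/ordeq0E; exists a => //; apply: (a3 _ _ _ fa).
move: H; rewrite add0r mul1r; move/ordeq_ae; apply.
apply: cofin_sub (cofin_and (cofin_auto A (unif_ne0 (al p)))
    (cofin_auto A (unifD (al p) (- n) n))) _ => x [t0 E].
by rewrite -mulrA -E addrC subrr expr0z mulr1.
Qed.

Lemma auto_rat al al' f : auto al al' -> rat f -> rat (f \o al).
Proof.
move=> A rf; have [_ _ a3 _] := A.
have [x Hx] := cofin_ex (cofin_auto A (hv_generic rf)).
exact: hv_rat (a3 _ _ _ Hx).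
Qed.

Lemma auto_ordge al al' p (n : int) f : auto al al' -> ordge (al p) n f -> ordge p n (f \o al).
Proof.
move=> A fn; have rf := ordge_rat fn.
have [f0|f0] := pselect (ae0 f).
  by apply: ae0_ordge; [exact: auto_rat A rf|exact: (cofin_auto A f0)].
have [k Hk] := ordeq_ex (al p) rf f0.
exact: ordge_le (ordge_eq_le fn Hk) (ordeq_ge (auto_ordeq A Hk)).
Qed.

Lemma pole_nonconst p (n : int) f : ordeq p n f -> (n < 0)%R -> nonconst f.
Proof.
move=> fn n0 c H.
have : ordge p 0 f by apply/ordge0E; exists c; apply: hv_ae (hv_const p c) _; apply: cofin_sub H _ => x ->.
by move=> /ordge_eq_le/(_ fn); lia.
Qed.

Lemma indep_nonconst n (w : 'I_n -> X -> K) : indep w -> (forall i, rat (w i)) -> (1 < n)%N ->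
  exists i, nonconst (w i).
Proof.
move=> iw rw n1; apply: contrapT => H.
have {}H i : exists c, cofin (fun x => w i x = c).
  by apply: contrapT => Hi; apply: H; exists i => c Hc; apply: Hi; exists c.
have wL i : LL [::] (w i).
  move=> p; have [c Hc] := H i; apply/ordge0E; exists c.
  by apply: hv_ae (hv_const p c) _; apply: cofin_sub Hc _ => x ->.
by have := LL_indep_le iw wL; rewrite leqNgt n1.
Qed.

Lemma LL_nil_const f : LL [::] f -> exists c, cofin (fun x => f x = c).
Proof.
move=> fL; apply: liouville (LL_rat fL) _ => p; exact/ordge0E/(fL p).
Qed.

(* Removing one copy of p from the divisor costs one linear condition. *)
Lemma LL_cons_lead p D f : LL (p :: D) f ->
  hv p (fun x => f x * unif p x ^ (count_mem p D).+1%:Z) 0 -> LL D f.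
Proof.
move=> fL f0 q; have := fL q; rewrite /= .
have [eq|ne] := eqVneq p q; last by rewrite add0n.
move=> _; rewrite -eq; have [e He] := hv_ordge1 f0; exists e; apply: hv_ae He _.
apply: cofin_sub (unifD p (count_mem p D).+1%:Z (- 1)) _ => x E.
by rewrite -mulrA -E; congr (_ * _ ^ _); lia.
Qed.

Lemma LL_one_more p D f g : LL (p :: D) f -> LL (p :: D) g ->
  ordeq p (- (count_mem p D).+1%:Z) g -> exists e, LL D (fun x => f x - e * g x).
Proof.
move=> fL gL [b b0 gb]; have := fL p; rewrite /= eqxx add1n => -[a fa].
rewrite !opprK in fa gb; exists (a / b).
apply: LL_cons_lead.
  move=> q; exact: ordge_lin (fL q) (gL q).
apply: hv_ext (hv_sub fa (hv_mul (hv_const p (a / b)) gb)) _ _ => [x|]; first by ring.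
by rewrite mulfVK // subrr.
Qed.

Variable gn : nat.
Hypothesis RR : riemann_ineq X gn.

Lemma count_nseq1 p q n : count_mem q (nseq n p) = if p == q then n else 0%N.
Proof. by rewrite count_nseq /=; case: eqP => _; rewrite ?mul1n ?mul0n. Qed.

(** psi o al has the same pole bound, so a multiple of psi can be subtracted to lower the pole. By
    the minimality of j + 1 the rest is constant, and it vanishes at the fixed point q. *)
Lemma eigen_least p q j psi : p != q -> (forall f, LL (nseq j p) f -> exists c, cofin (fun x => f x = c)) ->
  LL (nseq j.+1 p) psi -> ordeq p (- j.+1%:Z) psi -> hv q psi 0 ->
  forall al al', auto al al' -> al p = p -> al q = q ->
    exists e, cofin (fun x => psi (al x) = e * psi x).
Proof.
move=> pq minj pL oj hq al al' A alp alq.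
have aL : LL (nseq j.+1 p) (psi \o al).
  move=> x; apply: (auto_ordge A); have := pL (al x).
  rewrite !count_nseq1; have [<-|xp] := eqVneq p x; first by rewrite alp eqxx.
  have -> // : (p == al x) = false.
  have [a1 _ _ _] := A; apply/negP => /eqP e; move: xp.
  by rewrite -(a1 p) alp e a1 eqxx.
have [e /minj[k Hk]] : exists e, LL (nseq j p) (fun x => psi (al x) - e * psi x).
  by apply: (@LL_one_more p (nseq j p) _ _ aL pL); rewrite count_nseq1 eqxx.
exists e.
have k0 : k = 0.
  have H : hv q (fun x => psi (al x) - e * psi x) (0 - e * 0).
    have [_ _ a3 _] := A; apply: hv_sub (hv_mul (hv_const q e) hq).
    by apply: (a3 psi); rewrite alq.
  by have := hv_uniq (hv_ae H Hk) (hv_const q k); rewrite mulr0 subr0.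
by apply: cofin_sub Hk _ => x /eqP; rewrite k0 subr_eq0 => /eqP.
Qed.

(* A function whose only pole is p, of least order, is an eigenvector of the
   automorphisms fixing p and q. *)
Lemma least_pole p q : p != q -> exists (j : nat) (psi : X -> K),
  [/\ (0 < j)%N, ordeq p (- j%:Z) psi, hv q psi 0,
      forall x, x != p -> reg x psi &
      forall al al', auto al al' -> al p = p -> al q = q ->
        exists e, cofin (fun x => psi (al x) = e * psi x)].
Proof.
move=> pq.
pose P j := `[< exists2 psi, LL (nseq j p) psi & nonconst psi >].
have exP : exists j, P j.
  (* Riemann's inequality gives L((gn + 1) p) dimension at least 2. *)
  exists gn.+1; apply/asboolP; have [w iw wL] := RR (nseq gn.+1 p).
  have [|i ni] := indep_nonconst iw (fun i => LL_rat (wL i)).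
    by rewrite size_nseq; lia.
  by exists (w i).
case: (ex_minnP exP) => -[|j] /asboolP[psi pL np] min.
  by have [c Hc] := LL_nil_const pL; case: (np c).
have minj f : LL (nseq j p) f -> exists c, cofin (fun x => f x = c).
  move=> fL; apply: contrapT => H; have := min j; rewrite ltnn => /(_ _)/negP[] //.
  by apply/asboolP; exists f => // c Hc; apply: H; exists c.
have cj : count_mem p (nseq j p) = j by rewrite count_nseq1 eqxx.
have oj : ordeq p (- j.+1%:Z) psi.
  have := pL p; rewrite count_nseq1 eqxx => -[a Ha]; exists a => //; apply/eqP => a0.
  have [|c Hc] := minj psi; last exact: (np c).
  apply: LL_cons_lead (pL) _; rewrite cj; rewrite a0 opprK in Ha; exact: Ha.
have regx x : x != p -> reg x psi.
  move=> xp; apply/ordge0E; have := pL x; rewrite count_nseq1 eq_sym (negbTE xp).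
  by rewrite oppr0.
have [c hc] := regx q ltac:(by rewrite eq_sym).
have oj' : ordeq p (- j.+1%:Z) (fun x => psi x - c).
  apply: ordeq_addge oj _; apply: (@ordge_le _ _ _ _ 0); first by lia.
  by apply/ordge0E; exists (- c); apply: hv_const.
have pL' : LL (nseq j.+1 p) (fun x => psi x - c).
  move=> x; rewrite count_nseq1; case: eqP => [<-|/eqP xp]; first exact: ordeq_ge.
  rewrite oppr0; have [|a ha] := regx x; first by rewrite eq_sym.
  by apply/ordge0E; exists (a - c); apply: hv_sub ha (hv_const x c).
have hq : hv q (fun x => psi x - c) 0 by rewrite -(subrr c); apply: hv_sub hc (hv_const q c).
exists j.+1, (fun x => psi x - c); split=> //.
  by move=> x /regx[a ha]; exists (a - c); apply: hv_sub ha (hv_const x c).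
exact: eigen_least pq minj pL' oj' hq.
Qed.

Lemma eigen_unit al al' q g e : auto al al' -> al q = q -> ordeq q 0 g ->
  cofin (fun x => g (al x) = e * g x) -> e = 1.
Proof.
move=> A aq /ordeq0E[a a0 ga] H; have [_ _ a3 _] := A.
have ga' : hv q (g \o al) a by apply: a3; rewrite aq.
have := hv_uniq (hv_ae ga' H) (hv_mul (hv_const q e) ga) => E.
by apply: (mulIf a0); rewrite -E mul1r.
Qed.

Lemma ordeq_pos q g : rat g -> ~ ae0 g -> hv q g 0 -> exists2 k : nat, (0 < k)%N & ordeq q k%:Z g.
Proof.
move=> rg g0 h0; have [n Hn] := ordeq_ex q rg g0.
have := ordge_eq_le (hv_ordge1 h0) Hn => n1.
by exists `|n|%N; [lia|rewrite gez0_abs //; lia].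
Qed.

(** The level sets of Psi are finite and confine the image of a point under all members of G, which
    is what the pigeonhole in [not_isotrivial] needs. *)
Definition rigid_fun (G : (X -> X) -> Prop) := exists (Psi : X -> K),
  [/\ rat Psi, nonconst Psi & forall al, G al -> cofin (fun x => Psi (al x) = Psi x)].

Lemma rigid_pow (G : (X -> X) -> Prop) p j psi N : (0 < j)%N -> (0 < N)%N -> ordeq p (- j%:Z) psi ->
  (forall al, G al -> exists2 e, cofin (fun x => psi (al x) = e * psi x) & e ^+ N = 1) ->
  rigid_fun G.
Proof.
move=> j0 N0 op H; exists (fun x => psi x ^+ N); split.
- by apply: rat_exp; apply: ordeq_rat op.
- by apply: pole_nonconst (ordeq_exp N op) _; nia.
- move=> al /H[e He eN]; apply: cofin_sub He _ => x ->.
  by rewrite exprMn eN mul1r.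
Qed.

(** psi has its only pole at p1 and vanishes at p2 to order k; phi has its only pole, of order j2,
    at p2 and vanishes at p3 to order n. Their eigenvalues are e and e'. A function that is a unit
    at a fixed point has eigenvalue 1, so e = 1 if psi is nonzero at p3. If psi vanishes there to
    order m, the units psi^j2 phi^k at p2 and psi^n phi^-m at p3 give e^j2 e'^k = 1 and e^n = e'^m,
    whence e^(j2 m + n k) = 1. *)
Lemma rigid_three p1 p2 p3 : p1 != p2 -> p1 != p3 -> p2 != p3 ->
  rigid_fun (fun al => (exists al', auto al al') /\ [/\ al p1 = p1, al p2 = p2 & al p3 = p3]).
Proof.
move=> n12 n13 n23.
have [j1 [psi [j10 o1 h1 r1 E1]]] := least_pole n12.
have [j2 [phi [j20 o2 h2 r2 E2]]] := least_pole n23.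
have rp := ordeq_rat o1; have p0 := ordeq_not0 o1.
have rphi := ordeq_rat o2; have phi0 := ordeq_not0 o2.
have [c hc] : reg p3 psi by apply: r1; rewrite eq_sym.
have [k k0 ok] := ordeq_pos rp p0 h1.
have [n n0 on] := ordeq_pos rphi phi0 h2.
have [c0|c0] := eqVneq c 0; last first.
  apply: (@rigid_pow _ p1 j1 psi 1) => // al [[al' A] [a1 a2 a3]].
  have [e He] := E1 _ _ A a1 a2; exists e => //; rewrite expr1.
  by apply: eigen_unit A a3 _ He; apply/ordeq0E; exists c.
rewrite c0 in hc; have [m m0 om] := ordeq_pos rp p0 hc.
apply: (@rigid_pow _ p1 j1 psi (j2 * m + n * k)) => //; first by nia.
move=> al [[al' A] [a1 a2 a3]].
have [e He] := E1 _ _ A a1 a2; exists e => //.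
have [e' He'] := E2 _ _ A a2 a3.
have R2 : e ^+ j2 * e' ^+ k = 1.
  apply: (eigen_unit (g := fun x => psi x ^+ j2 * phi x ^+ k) A a2).
    have := ordeqM (ordeq_exp j2 ok) (ordeq_exp k o2).
    by rewrite (_ : _ + _ = 0) //; lia.
  apply: cofin_sub (cofin_and He He') _ => x [-> ->].
  by rewrite !exprMn; ring.
have R3 : e ^+ n * e'^-1 ^+ m = 1.
  apply: (eigen_unit (g := fun x => psi x ^+ n * (phi x)^-1 ^+ m) A a3).
    have := ordeqM (ordeq_exp n om) (ordeq_exp m (ordeqV on)).
    by rewrite (_ : _ + _ = 0) //; lia.
  apply: cofin_sub (cofin_and He He') _ => x [-> ->].
  by rewrite invfM !exprMn; ring.
have e0 : e' != 0.
  by apply/eqP => e0; move: R3; rewrite e0 invr0 expr0n eqn0Ngt m0 mulr0 => /eqP; rewrite eq_sym oner_eq0.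
have R4 : e ^+ n = e' ^+ m.
  by rewrite -[RHS]mul1r -R3 -mulrA -exprMn mulVf // expr1n mulr1.
by rewrite exprD !exprM R4 -!exprM [(m * k)%N]mulnC !exprM -exprMn R2 expr1n.
Qed.

End Rigidity.

Section Isotrivial.
Variables (K : numClosedFieldType) (X : abs_curve K) (gn : nat).
Implicit Types (p q : X) (f g h : X -> K) (a b c e l m : K) (D : seq X).
Hypothesis RR : riemann_ineq X gn.

Definition free_from f h := forall b c, ~ cofin (fun x => h x = b * f x + c).

(** If all of L(D), of dimension at least 3, were affine in f, one condition at a point of D would
    remove the multiples of f and leave two independent constants. *)
Lemma free_from_ex D f : (gn + 1 < size D)%N -> poles D f ->
  exists2 h, LL D h & free_from f h.
Proof.
move=> dD fD; have [w iw wD] := RR D.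
apply: contrapT => H.
have {}H i : exists b c, cofin (fun x => w i x = b * f x + c).
  apply: contrapT => Hi; apply: H; exists (w i) => // b c Hc.
  by apply: Hi; exists b, c.
pose S g := exists b c, cofin (fun x => g x = b * f x + c).
have Scl : lin_closed S.
  move=> g h e [b [c H1]] [b' [c' H2]]; exists (b - e * b'), (c - e * c').
  by apply: cofin_sub (cofin_and H1 H2) _ => x [-> ->]; ring.
have [p pD] : exists p, p \in D by case: (D) dD => // p s _; exists p; rewrite mem_head.
have [w' [iw' Sw' w'D]] := indep_codim [:: p] Scl iw H wD.
have cD : (0 < count_mem p D)%N by rewrite -has_count has_pred1.
have w'c i : exists c, cofin (fun x => w' i x = c).
  have [b [c Hc]] := Sw' i; exists c.
  suff b0 : b = 0 by apply: cofin_sub Hc _ => x ->; rewrite b0 mul0r add0r.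
  apply/eqP/negPn/negP => b0.
  have o : ordeq p (- (count_mem p D)%:Z) (w' i).
    apply: ordeq_ae (ordeq_addge (ordeqZ b0 (fD p pD)) (g := fun=> c) _) _.
      apply: (@ordge_le _ _ _ _ 0); first by lia.
      by apply/ordge0E; exists c; apply: hv_const.
    by apply: cofin_sub Hc _ => x.
  by have := ordge_eq_le (w'D i p) o; rewrite /= eqxx; lia.
have [||i ni] := indep_nonconst iw'.
- by move=> i; apply: ordge_rat (w'D i p).
- by rewrite /=; lia.
by have [c] := w'c i; apply: ni.
Qed.

(** The covers are built from h point by point, so its junk values outside D have to be replaced
    first. *)
Lemma true_values D h : LL D h ->
  exists2 h', cofin (fun x => h x = h' x) & forall p, p \notin D -> hv p h' (h' p).
Proof.
move=> hD.
have /choice[v Hv] : forall p, exists v, p \notin D -> hv p h v.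
  move=> p; have [pD|pD] := boolP (p \in D); first by exists 0.
  by have := hD p; rewrite (count_memPn pD) => /ordge0E[v hv]; exists v.
have e : cofin (fun x => h x = v x).
  apply: cofin_sub (cofin_and (hv_generic (LL_rat hD)) (cofin_notin D)) _ => x [hx xD].
  exact: hv_uniq hx (Hv x xD).
by exists v => // p pD; apply: hv_ae (Hv p pD) e.
Qed.

Lemma LL_ae D f g : LL D f -> cofin (fun x => f x = g x) -> LL D g.
Proof. by move=> fD e p; apply: ordge_ae (fD p) e. Qed.

Section DoublePoint.
Variables (p1 p2 : X) (f : X -> K).
Hypotheses (n12 : p1 != p2) (o1 : ordeq p1 (- 2) f) (o2 : ordeq p2 (- 1) f).

Lemma order_ratio p k j f0 f1 : ordeq p k f0 -> ordeq p j f1 -> forall (n m : nat),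
  k * n + j * m = 0 -> exists2 a, a != 0 & hv p (fun x => f0 x ^+ n * f1 x ^+ m) a.
Proof.
move=> A B n m E; apply/ordeq0E; rewrite -E.
exact: ordeqM (ordeq_exp n A) (ordeq_exp m B).
Qed.

Definition fixing_pencil (D : seq X) f h (al : X -> X) :=
  [/\ exists al', auto al al', forall p, p \in D -> al p = p &
      exists l m a b, a != 0 /\
        cofin (fun x => pencil f h l (al x) = a * pencil f h m x + b)].

(** Let e be the eigenvalue of h and a the factor between the two members. The leading coefficient
    of f / h^2 at p1 is the same for all members, which gives a = e^2; that of f^k h at p2 gives a^k
    e = 1. Hence e^(2 k + 1) = 1. *)
Lemma rigid_one_pole h k : (0 < k)%N -> ordeq p1 (- 1) h -> ordeq p2 k%:Z h ->
  (forall al al', auto al al' -> al p1 = p1 -> al p2 = p2 ->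
     exists e, cofin (fun x => h (al x) = e * h x)) ->
  rigid_fun (fixing_pencil [:: p1; p1; p2] f h).
Proof.
move=> k0 h1 h2 Eh.
apply: (@rigid_pow _ _ _ p1 1 h (2 * k).+1) => // al [[al' A] aD [l [m [a [b [a0 H]]]]]].
have a1 : al p1 = p1 by apply: aD; rewrite !inE eqxx.
have a2 : al p2 = p2 by apply: aD; rewrite !inE eqxx !orbT.
have [e He] := Eh _ _ A a1 a2; exists e => //.
have [_ _ a3 _] := A.
have e0 : e != 0.
  apply/eqP => e0; have h0 : ae0 (h \o al) by apply: cofin_sub He _ => x; rewrite e0 mul0r.
  have oh : ordeq p1 (- 1) (h \o al) by apply: (auto_ordeq A); rewrite a1.
  exact: ordeq_not0 oh h0.
have P1 l0 : ordeq p1 (- 2) (pencil f h l0).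
  apply: ordeq_addge o1 _; exact: ordgeZ (ordeq_ge h1).
have [w w0 Hw] := order_ratio (p := p1) o1 (ordeqV h1) (n := 1) (m := 2) ltac:(lia).
have hinv : hv p1 (fun x => (h x)^-1) 0.
  by apply: ordge1_hv; apply: ordeq_ge; apply: ordeqV h1.
have Hwl l0 : hv p1 (fun x => pencil f h l0 x ^+ 1 * (h x)^-1 ^+ 2) w.
  have h0 := not_ae0 (ordeq_rat h1) (ordeq_not0 h1).
  apply: hv_ae (hv_eqv (hv_add Hw (hv_mul (hv_const p1 l0) hinv)) _) _; first by ring.
  apply: cofin_sub h0 _ => x hx; rewrite /pencil; field; exact: hx.
have ea : a = e ^+ 2.
  have A1 : hv p1 ((fun x => pencil f h l x ^+ 1 * (h x)^-1 ^+ 2) \o al) w by apply: a3; rewrite a1.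
  have A2 : hv p1 (fun x => (e ^+ 2)^-1 * (a * (pencil f h m x ^+ 1 * (h x)^-1 ^+ 2) + b * (h x)^-1 ^+ 2))
      ((e ^+ 2)^-1 * (a * w + b * 0 ^+ 2)).
    apply: hv_mul (hv_const _ _) (hv_add (hv_mul (hv_const _ _) (Hwl m)) (hv_mul (hv_const _ _) (hv_exp 2 hinv))).
  have E : w = (e ^+ 2)^-1 * (a * w + b * 0 ^+ 2).
    apply: hv_uniq A1 (hv_ae A2 _).
    apply: cofin_sub (cofin_and H He) _ => x [Hx Hx'] /=; rewrite Hx Hx' !expr1.
    have -> : (e * h x)^-1 ^+ 2 = (e ^+ 2)^-1 * (h x)^-1 ^+ 2.
      by rewrite !exprVn exprMn invfM.
    by ring.
  apply: (mulIf w0); rewrite [in RHS]E; field; exact: e0.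
have P2 l0 : hv p2 (fun x => l0 * h x ^+ k.+1) 0.
  have : hv p2 h 0 by apply: ordge1_hv; apply: ordge_le (ordeq_ge h2); lia.
  by move=> /(hv_exp k.+1)/(hv_mul (hv_const p2 l0)); rewrite expr0n mulr0.
have [v v0 Hv] := order_ratio (p := p2) o2 h2 (n := k) (m := 1) ltac:(lia).
have fh0 (c : K) : ordge p2 (- 1) (fun x => f x + c) by apply: ordgeD (ordeq_ge o2) _;
  apply: (@ordge_le _ _ _ _ 0); [lia|apply/ordge0E; exists c; apply: hv_const].
(* Adding l0 h + b0, regular at p2, does not affect the leading term: the difference of k-th powers
   factors through it and has a pole of order at most k - 1, against a zero of h of order k. *)
have P2l l0 b0 : hv p2 (fun x => (pencil f h l0 x + b0) ^+ k * h x ^+ 1) v.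
  have : ordge p2 1 (fun x => (pencil f h l0 x + b0) ^+ k * h x ^+ 1 - f x ^+ k * h x ^+ 1).
    have G : ordge p2 1 (fun x => (l0 * h x + b0) *
        (\sum_(i < k) (pencil f h l0 x + b0) ^+ (k.-1 - i) * f x ^+ i) * h x ^+ 1).
      have -> : (1 : int) = 0 + (- 1) * k.-1%:Z + k%:Z * 1%N by lia.
      apply: ordgeM (ordge_exp 1 (ordeq_ge h2)); apply: ordgeM.
        apply: ordgeD; last by apply/ordge0E; exists b0; apply: hv_const.
        by apply: ordgeZ; apply: ordge_le (ordeq_ge h2).
      apply: ordge_sum => i.
      have -> : (- 1) * k.-1%:Z = (- 1) * (k.-1 - i)%N%:Z + (- 1) * i%:Z :> int.
        by have := ltn_ord i; lia.
      apply: ordgeM; apply: ordge_exp; last exact: ordeq_ge.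
      under [X in ordge _ _ X]eq_fun do rewrite /pencil -addrA.
      apply: ordgeD (ordeq_ge o2) _; apply: (@ordge_le _ _ _ _ 0) => //.
      apply: ordgeD; last by apply/ordge0E; exists b0; apply: hv_const.
      by apply: ordgeZ; apply: ordge_le (ordeq_ge h2).
    apply: ordge_ae G _; apply: cofin_all => x.
    rewrite -mulrBl; congr (_ * _).
    by rewrite subrXX; congr (_ * _); rewrite /pencil; ring.
  move=> /ordge1_hv G; apply: hv_ext (hv_add Hv G) _ _ => [x|]; ring.
have eak : e * a ^+ k = 1.
  have A1 : hv p2 ((fun x => (pencil f h l x + 0) ^+ k * h x ^+ 1) \o al) v by apply: a3; rewrite a2.
  have A2 := hv_mul (hv_const p2 (e * a ^+ k)) (P2l m (b / a)).
  apply: (mulIf v0); rewrite mul1r; apply: hv_uniq (hv_ae A2 _) A1.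
  apply: cofin_sub (cofin_and H He) _ => x [Hx Hx'] /=; rewrite Hx Hx' addr0 !expr1.
  have -> : a * pencil f h m x + b = a * (pencil f h m x + b / a) by field; exact: a0.
  by rewrite exprMn; ring.
by rewrite exprS exprM -ea.
Qed.

(** With h o al = u h + c, let psi have its only pole at p1, of order j, a zero of order k at p2,
    and eigenvalue e. The units psi / h^j at p1 and psi h^k at p2 give e = u^j and e u^k = 1, so
    e^(j + k) = 1. *)
Lemma rigid_two_poles h : ordeq p1 (- 1) h -> ordeq p2 (- 1) h ->
  (forall al al', auto al al' -> al p1 = p1 -> al p2 = p2 ->
     exists e c, cofin (fun x => h (al x) = e * h x + c)) ->
  rigid_fun (fixing_pencil [:: p1; p1; p2] f h).
Proof.
move=> h1 h2 Eh; have [j [psi [j0 s1 s2 _ Es]]] := least_pole RR n12.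
have [k k0 ok] := ordeq_pos (ordeq_rat s1) (ordeq_not0 s1) s2.
apply: (@rigid_pow _ _ _ p1 j psi (j + k)) => //; first by rewrite addn_gt0 j0.
move=> al [[al' A] aD _].
have a1 : al p1 = p1 by apply: aD; rewrite !inE eqxx.
have a2 : al p2 = p2 by apply: aD; rewrite !inE eqxx !orbT.
have [e He] := Es _ _ A a1 a2; exists e => //.
have [u [c Hc]] := Eh _ _ A a1 a2.
have [_ _ a3 _] := A.
have Hh : cofin (fun x => h x != 0) := not_ae0 (ordeq_rat h1) (ordeq_not0 h1).
have ratio p : al p = p -> ordeq p (- 1) h -> hv p (fun x => h (al x) / h x) u.
  move=> ap hp.
  have hinv : hv p (fun x => (h x)^-1) 0 by apply: ordge1_hv; apply: ordeq_ge; apply: ordeqV hp.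
  apply: hv_ae (hv_eqv (hv_add (hv_const p u) (hv_mul (hv_const p c) hinv)) _) _.
    by rewrite mulr0 addr0.
  apply: cofin_sub (cofin_and Hc Hh) _ => x [-> hx]; field; exact: hx.
have Hha : cofin (fun x => h (al x) != 0) := cofin_auto A Hh.
have [w w0 Hw] := order_ratio (p := p1) s1 (ordeqV h1) (n := 1) (m := j) ltac:(lia).
have E1 : e = u ^+ j.
  have A1 : hv p1 ((fun x => psi x ^+ 1 * (h x)^-1 ^+ j) \o al) w by apply: a3; rewrite a1.
  have A2 := hv_mul A1 (hv_exp j (ratio _ a1 h1)).
  have A3 := hv_mul (hv_const p1 e) Hw.
  apply: (mulIf w0); rewrite [RHS]mulrC; apply: hv_uniq A3 (hv_ae A2 _).
  apply: cofin_sub (cofin_and He (cofin_and Hh Hha)) _ => x [Ex [hx hax]] /=.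
  rewrite Ex !expr1 -!mulrA -exprMn; congr (_ * (_ * _ ^+ _)); field.
  by rewrite hx hax.
have [v v0 Hv] := order_ratio (p := p2) ok h2 (n := 1) (m := k) ltac:(lia).
have E2 : e * u ^+ k = 1.
  have A1 : hv p2 ((fun x => psi x ^+ 1 * h x ^+ k) \o al) v by apply: a3; rewrite a2.
  have A2 := hv_mul (hv_mul (hv_const p2 e) (hv_exp k (ratio _ a2 h2))) Hv.
  apply: (mulIf v0); rewrite mul1r; apply: hv_uniq A2 (hv_ae A1 _).
  apply: cofin_sub (cofin_and He Hh) _ => x [Ex hx] /=.
  rewrite Ex !expr1 exprMn exprVn; field; by rewrite expf_neq0.
rewrite {1}E1 -exprM mulnC exprM exprD -E1 E2 expr1n.
by [].
Qed.

End DoublePoint.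
End Isotrivial.

Section GoodPencil.
Variables (K : numClosedFieldType) (X : abs_curve K) (gn : nat).
Implicit Types (p q : X) (f g h : X -> K) (a b c e l m : K) (D : seq X).
Hypothesis RR : riemann_ineq X gn.

Lemma LL_perm D E f : perm_eq D E -> LL D f -> LL E f.
Proof. by move=> /permP pDE; apply: LL_sub => p; rewrite pDE. Qed.

Lemma LL_add_const D f c : LL D f -> LL D (fun x => f x + c).
Proof.
move=> fD p; apply: ordgeD (fD p) _; apply: (@ordge_le _ _ _ _ 0); first by lia.
by apply/ordge0E; exists c; apply: hv_const.
Qed.

Lemma nonconst_add_const f c : nonconst f -> nonconst (fun x => f x + c).
Proof.
move=> nf b H; apply: (nf (b - c)); apply: cofin_sub H _ => x <-; ring.
Qed.

Lemma nonconst_not0 f : nonconst f -> ~ ae0 f.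
Proof. by move=> nf; apply: nf. Qed.

Lemma fibre_divisor D F c : D != [::] -> poles D F -> (forall p, p \notin D -> reg p F) ->
  exists Z, [/\ size Z = size D, forall p, p \in D -> p \notin Z &
    forall p, p \notin D -> ordeq p (count_mem p Z) (fun x => F x - c)].
Proof.
move=> Dne FD Fr.
have cD p : p \in D -> (0 < count_mem p D)%N by rewrite -has_count has_pred1.
have oD p : p \in D -> ordeq p (- (count_mem p D)%:Z) (fun x => F x - c).
  move=> pD; apply: ordeq_addge (FD p pD) _; apply: (@ordge_le _ _ _ _ 0).
    by have := cD p pD; lia.
  by apply/ordge0E; exists (- c); apply: hv_const.
have [q qD] : exists q, q \in D by case: (D) Dne => // q s _; exists q; rewrite mem_head.
have rF := ordeq_rat (oD q qD); have F0 := ordeq_not0 (oD q qD).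
have [Z [E H]] := zeros_poles rF F0.
have ED p : count_mem p E = count_mem p D /\ (p \in D -> count_mem p Z = 0%N).
  have [pD|pD] := boolP (p \in D).
    have := ordeq_uniq (oD p pD) (H p).1; have := (H p).2; have := cD p pD; lia.
  rewrite (count_memPn pD); split=> //.
  have [a ha] := Fr p pD.
  have : ordge p 0 (fun x => F x - c).
    by apply/ordge0E; exists (a - c); apply: hv_sub ha (hv_const p c).
  by move=> /ordge_eq_le/(_ (H p).1); have := (H p).2; lia.
exists Z; split.
- rewrite (deg_zeros_poles RR rF F0 (fun p => (H p).1)).
  by apply/perm_size/allP => p _ /=; rewrite (ED p).1.
- by move=> p pD; apply/count_memPn; apply: (ED p).2.
- by move=> p pD; have := (H p).1; rewrite (ED p).1 (count_memPn pD) subr0.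
Qed.

(** * Degree 3: the polar divisor 2 p1 + p2 on a curve of genus at most 1 *)

Section TriplePole.
Variables (p1 p2 : X) (f : X -> K).
Hypotheses (n12 : p1 != p2) (g1 : (gn <= 1)%N) (fD : poles [:: p1; p1; p2] f).

Let o1 : ordeq p1 (- 2) f.
Proof.
have := fD (p := p1); rewrite mem_head => /(_ isT) /=.
by rewrite eqxx eq_sym (negbTE n12).
Qed.

Let o2 : ordeq p2 (- 1) f.
Proof.
have := fD (p := p2); rewrite !inE eqxx !orbT => /(_ isT) /=.
by rewrite eqxx (negbTE n12).
Qed.

Lemma one_pole_lead p g : LL [:: p] g -> nonconst g -> ordeq p (- 1) g.
Proof.
move=> gL ng; have := gL p; rewrite /= eqxx => -[a Ha]; exists a => //.
apply/eqP => a0; rewrite a0 opprK in Ha.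
by have [c Hc] := LL_nil_const (LL_cons_lead gL Ha); case: (ng c).
Qed.

(** h - h(p1) has one simple pole, hence one simple zero, which is p1; its inverse has its only pole
    there. *)
Lemma one_pole_inverse h c : LL [:: p2] h -> nonconst h -> hv p1 h c ->
  exists2 y, LL [:: p1] y & nonconst y.
Proof.
move=> hL nh hc; have oh := one_pole_lead hL nh.
pose g x := h x - c.
have gL : LL [:: p2] g by exact: LL_add_const.
have ng : nonconst g by exact: nonconst_add_const.
have og := one_pole_lead gL ng.
have rg := LL_rat gL; have g0 := nonconst_not0 ng.
have [Z [E H]] := zeros_poles rg g0.
have E2 p : count_mem p E = (p2 == p).
  have := gL p; rewrite /= addn0; have [<-|ne] := eqVneq p2 p.
    by have := ordeq_uniq og (H p2).1; have := (H p2).2; lia.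
  by rewrite oppr0 => /ordge_eq_le/(_ (H p).1); have := (H p).2; lia.
have sZ : size Z = 1%N.
  rewrite (deg_zeros_poles RR rg g0 (fun p => (H p).1)) -[RHS]/(size [:: p2]).
  by apply/perm_size/allP => p _ /=; rewrite E2 addn0.
have p1Z : p1 \in Z.
  have : hv p1 g 0 by rewrite -(subrr c); apply: hv_sub hc (hv_const p1 c).
  move=> /hv_ordge1/ordge_eq_le/(_ (H p1).1).
  by rewrite -has_pred1 has_count; lia.
have {sZ p1Z} eZ : Z = [:: p1].
  by case: (Z) sZ p1Z => [|z []] //= _; rewrite inE => /eqP->.
have yL : LL [:: p1] (fun x => (g x)^-1).
  move=> p; have := ordeq_ge (ordeqV (H p).1); rewrite eZ; apply: ordge_le; lia.
exists (fun x => (g x)^-1) => // k Hk.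
have : ordeq p1 (- 1) (fun x => (g x)^-1).
  have := ordeqV (H p1).1; rewrite eZ /= eqxx E2 eq_sym (negbTE n12).
  by [].
by move=> /pole_nonconst H'; exact: (H' isT k Hk).
Qed.

(** If some function has a single simple pole at p1, it serves as h, shifted to vanish at p2.
    Otherwise a nonconstant h in L(p1 + p2) has poles at both points, and h o al is affine in h
    because the part left after removing the pole at p2 has at most a simple pole at p1. The double
    pole of f at p1 keeps h independent of f and 1. *)
Lemma triple_pencil : exists h, [/\ LL [:: p1; p1; p2] h, free_from f h &
  rigid_fun (fixing_pencil [:: p1; p1; p2] f h)].
Proof.
have free h : LL [:: p1; p2] h -> nonconst h -> free_from f h.
  move=> hL nh b c H; have [b0|b0] := eqVneq b 0.
    by apply: (nh c); apply: cofin_sub H _ => x ->; rewrite b0 mul0r add0r.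
  have o : ordeq p1 (- 2) h.
    apply: ordeq_ae (ordeq_addge (ordeqZ b0 o1) (g := fun=> c) _) _.
      apply: (@ordge_le _ _ _ _ 0) => //.
      by apply/ordge0E; exists c; apply: hv_const.
    by apply: cofin_sub H _ => x.
  by have := ordge_eq_le (hL p1) o; rewrite /= eqxx eq_sym (negbTE n12).
have sub12 h : LL [:: p1; p2] h -> LL [:: p1; p1; p2] h.
  by apply: LL_sub => p /=; lia.
have [[y yL ny]|none] := pselect (exists2 y, LL [:: p1] y & nonconst y).
  have [c yc] : reg p2 y.
    by apply/ordge0E; have := yL p2; rewrite /= (negbTE n12).
  pose h x := y x - c.
  have hL : LL [:: p1] h by exact: LL_add_const.
  have nh : nonconst h by exact: nonconst_add_const.
  have h0 : hv p2 h 0 by rewrite -(subrr c); apply: hv_sub yc (hv_const p2 c).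
  have oh := one_pole_lead hL nh.
  have hL2 : LL [:: p1; p2] h by apply: LL_sub hL => p /=; lia.
  exists h; split; [exact: sub12|exact: free|].
  have [k k0 ok] := ordeq_pos (LL_rat hL) (nonconst_not0 nh) h0.
  apply: (rigid_one_pole n12 o1 o2 k0 oh ok).
  exact: (@eigen_least K X p1 p2 0 h n12 (@LL_nil_const K X) hL oh h0).
have [w iw wD] := RR [:: p1; p1; p2].
have [w' [iw' _ w'L]] := indep_codim (S := fun=> True) [:: p1] (fun _ _ _ _ _ => I) iw (fun=> I) wD.
have {}w'L i : LL [:: p1; p2] (w' i).
  by move=> p; have := w'L i p; apply: ordge_le => /=; lia.
have [||i ni] := indep_nonconst iw'.
- by move=> i; apply: LL_rat (w'L i).
- by rewrite /=; lia.
set h := w' i in ni; have hL : LL [:: p1; p2] h := w'L i.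
have hL' : LL [:: p2; p1] h by apply: LL_perm hL; rewrite (perm_catC [:: p1] [:: p2]).
have oh1 : ordeq p1 (- 1) h.
  have := hL p1; rewrite /= eqxx eq_sym (negbTE n12) => -[a Ha]; exists a => //.
  apply/eqP => a0; rewrite a0 opprK in Ha.
  have hL2 : LL [:: p2] h by apply: (LL_cons_lead hL); rewrite /= eq_sym (negbTE n12).
  have [c hc] : reg p1 h.
    by apply/ordge0E; have := hL2 p1; rewrite /= eq_sym (negbTE n12).
  by apply: none; exact: one_pole_inverse hL2 ni hc.
have oh2 : ordeq p2 (- 1) h.
  have := hL p2; rewrite /= eqxx (negbTE n12) => -[a Ha]; exists a => //.
  apply/eqP => a0; rewrite a0 opprK in Ha.
  apply: none; exists h => //; apply: (LL_cons_lead hL').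
  by rewrite /= (negbTE n12).
exists h; split; [exact: sub12|exact: free|].
apply: (rigid_two_poles RR f n12 oh1 oh2) => al al' A a1 a2.
have aL : LL [:: p2; p1] (h \o al).
  move=> p; apply: (auto_ordge A); have := hL' (al p).
  have [a1' _ _ _] := A; have inj := can_inj a1'.
  by rewrite /= -{1}a2 -{1}a1 !(inj_eq inj).
have [e eL] : exists e, LL [:: p1] (fun x => h (al x) - e * h x).
  by apply: (LL_one_more aL hL'); rewrite /= (negbTE n12).
have [c Hc] : exists c, cofin (fun x => h (al x) - e * h x = c).
  apply: contrapT => H; apply: none; exists (fun x => h (al x) - e * h x) => // c Hc.
  by apply: H; exists c.
by exists e, c; apply: cofin_sub Hc _ => x <-; ring.
Qed.

End TriplePole.

Definition isotrivial_pair (F G : X -> K) := exists al al' a b,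
  [/\ auto al al', a != 0 & cofin (fun x => F (al x) = a * G x + b)].

Theorem not_isotrivial D f h (L : K -> Prop) : D != [::] ->
  LL D f -> (forall p, p \notin D -> hv p f (f p)) -> nonconst f ->
  LL D h -> (forall p, p \notin D -> hv p h (h p)) -> free_from f h ->
  rigid_fun (fixing_pencil D f h) ->
  infinitely_many L -> (forall l, L l -> poles D (pencil f h l)) ->
  ~ (forall l m, L l -> L m -> isotrivial_pair (pencil f h l) (pencil f h m)).
Proof.
move=> Dne fD fv nf hD hv_ fh [Psi [rPsi nPsi HPsi]] iL LP iso.
pose P := pencil f h.
have cD p : p \in D -> (0 < count_mem p D)%N by rewrite -has_count has_pred1.
have Pv l p : p \notin D -> hv p (P l) (P l p).
  by move=> pD; apply: hv_add (fv p pD) (hv_mul (hv_const p l) (hv_ p pD)).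
have Paff l a b p : L l -> a != 0 -> p \in D ->
    ordeq p (- (count_mem p D)%:Z) (fun x => a * P l x + b).
  move=> Ll a0 pD; apply: ordeq_addge (ordeqZ a0 (LP l Ll p pD)) _.
  apply: (@ordge_le _ _ _ _ 0); first by have := cD p pD; lia.
  by apply/ordge0E; exists b; apply: hv_const.
(* D is the set of poles of every member of the pencil, so al preserves it. *)
have alD l m al al' a b x : L l -> L m -> auto al al' -> a != 0 ->
    cofin (fun x => P l (al x) = a * P m x + b) -> (al x \in D) = (x \in D).
  move=> Ll Lm A a0 H; have [_ _ a3 _] := A.
  apply/idP/idP => xD; apply/negPn/negP => nxD.
    have o := ordeq_ae (auto_ordeq A (LP l Ll _ xD)) H.
    have : ordge x 0 (fun x => a * P m x + b).
      apply/ordge0E; exists (a * P m x + b).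
      exact: hv_add (hv_mul (hv_const _ _) (Pv m x nxD)) (hv_const _ _).
    by move=> /ordge_eq_le/(_ o); have := cD _ xD; lia.
  have o := Paff m a b x Lm a0 xD.
  have : ordge x 0 (fun x => a * P m x + b).
    by apply/ordge0E; exists (P l (al x)); apply: hv_ae (a3 _ _ _ (Pv l _ nxD)) H.
  by move=> /ordge_eq_le/(_ o); have := cD _ xD; lia.
pose rel l m al := exists al' a b, [/\ L l, L m, auto al al', a != 0 &
  cofin (fun x => P l (al x) = a * P m x + b)].
have relD l m al x : rel l m al -> (al x \in D) = (x \in D).
  by move=> [al' [a [b [Ll Lm A a0 H]]]]; apply: alD Ll Lm A a0 H.
have rel_div l1 l2 m al1 al2 : rel l1 m al1 -> rel l2 m al2 ->
    exists2 be, rel l2 l1 be & forall x, be (al1 x) = al2 x.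
  move=> [al1' [a1 [b1 [L1 Lm A1 a10 H1]]]] [al2' [a2 [b2 [L2 _ A2 a20 H2]]]].
  exists (al2 \o al1'); last by move=> x; have [k _ _ _] := A1; rewrite /= k.
  exists (al1 \o al2'), (a2 / a1), (b2 - a2 / a1 * b1); split=> //.
  - exact: auto_comp A2 (auto_sym A1).
  - by rewrite mulf_neq0 ?invr_eq0.
  apply: cofin_sub (cofin_and (cofin_auto (auto_sym A1) H1) (cofin_auto (auto_sym A1) H2)) _ => x [e1 e2] /=.
  have [_ k _ _] := A1; rewrite k in e1; rewrite e2 e1; field; exact: a10.
have [m _ Lm] := iL [::].
have iso' l : L l -> exists al, rel l m al.
  by move=> Ll; have [al [al' [a [b [A a0 H]]]]] := iso l m Ll Lm; exists al, al', a, b.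
have [||ys Hys] := @pigeonhole_map _ _ D (fun=> D) (fun l al => rel l m al).
- by move=> s; have [l ls Ll] := iL s; exists l => //; apply: iso'.
- by move=> l al R x xD; rewrite (relD _ _ _ _ R).
have [l1 _ [al1 R1 Y1]] := Hys [::].
have L1 : L l1 by have [? [? [? []]]] := R1.
(* Infinitely many al agree on D; composing them with the inverse of one of them gives automorphisms
   that fix D pointwise. *)
pose G l be := rel l l1 be /\ forall p, p \in D -> be p = p.
have iG : infinitely_many (fun l => exists be, G l be).
  move=> s; have [l ls [al R Y]] := Hys s; exists l => //.
  have [be Rbe Ebe] := rel_div _ _ _ _ _ R1 R; exists be; split=> // p pD.
  have [al1' [a1 [b1 [_ _ A1 _ _]]]] := R1; have [_ k _ _] := A1.
  have p'D : al1' p \in D by rewrite -(relD _ _ _ _ R1) k.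
  by rewrite -{1}(k p) Ebe Y // -Y1 // k.
have [E HE] := hv_generic rPsi.
have zer c : exists Z : seq X, forall y, y \notin Z -> Psi y != c.
  by have [Z HZ] := rat_value rPsi (nPsi c); exists Z.
have /choice[Z HZ] := zer.
(* One point more than deg D, so that a function of L(D) vanishing at the images of all of them is
   zero. *)
have [xs [uxs sxs Hxs]] := cofin_uniq_seq (size D).+1 (@pts_infinite K X)
  (cofin_and (hv_generic rPsi) (cofin_notin D)).
(* By invariance [be x] stays in the level set of Psi through x, except where Psi may differ from
   its true value, that is in E. *)
have [|zs Hzs] := @pigeonhole_map _ _ xs (fun x => E ++ Z (Psi x)) G iG.
  move=> l be [R fD'] x xxs; rewrite mem_cat; apply/orP.
  have [|bE] := boolP (be x \in E); [by left|right].
  have [al' [a [b [Ll _ A a0 H]]]] := R; have [_ _ a3 _] := A.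
  have inv : cofin (fun x => Psi (be x) = Psi x).
    by apply: HPsi; split; [exists al'|exact: fD'|exists l, l1, a, b].
  have e := hv_uniq (hv_ae (a3 _ _ _ (HE _ bE)) inv) (Hxs x xxs).1.
  by apply/negPn/negP => /HZ; rewrite e eqxx.
have [l2 _ [be2 [R2 D2] Y2]] := Hzs [::].
have [l3 l32 [be3 [R3 D3] Y3]] := Hzs [:: l2].
(* be2 and be3 agree on xs, so ga fixes the images of xs under be2; at these fixed points the
   relation between the members l3 and l2 becomes F = 0. *)
have [ga R Ega] := rel_div _ _ _ _ _ R2 R3.
have [ga' [a [b [L3 L2 A a0 H]]]] := R; have [_ _ a3 _] := A.
pose F x := (1 - a) * f x + (l3 - a * l2) * h x - b.
have FE x : F x = P l3 x - (a * P l2 x + b) by rewrite /F /P /pencil; ring.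
have be2_inj : injective be2.
  by have [be2' [_ [_ [_ _ A2 _ _]]]] := R2; have [k _ _ _] := A2; apply: can_inj k.
have FL : LL D F.
  apply: (@LL_add_const D (fun x => (1 - a) * f x + (l3 - a * l2) * h x) (- b)) => q.
  exact: ordgeD (ordgeZ _ (fD q)) (ordgeZ _ (hD q)).
have F0 : ae0 F.
  apply: (@LL_zeros K X gn D (map be2 xs)) => //; last by rewrite size_map sxs.
  move=> p; rewrite count_uniq_mem ?map_inj_in_uniq //; last by move=> ? ? _ _; apply: be2_inj.
  have [pm|pm] := boolP (p \in map be2 xs); last first.
    by rewrite sub0r; apply: FL.
  have [x xxs ep] := mapP pm.
  have pD : p \notin D by rewrite ep (relD _ _ _ _ R2); case: (Hxs x xxs).
  have gp : ga p = p by rewrite ep Ega Y3 // Y2.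
  have H1 : hv p (P l3 \o ga) (P l3 p) by apply: a3; rewrite gp; apply: Pv.
  have H2 := hv_ae H1 H.
  have := hv_sub (Pv l3 p pD) H2; rewrite subrr => /hv_ordge1.
  rewrite (count_memPn pD) subr0; move/ordge_ae; apply; apply: cofin_all => x'; by rewrite FE.
(* F = 0 would express h through f and 1 unless l3 = a l2; then a = 1, f being nonconstant, and l2 =
   l3. *)
have [e|ne] := eqVneq (l3 - a * l2) 0.
  have [e1|ne1] := eqVneq (1 - a) 0.
    have a1 : a = 1 by apply/eqP; rewrite eq_sym -subr_eq0 e1.
    by move: l32; rewrite inE -subr_eq0 -[l2]mul1r -a1 e eqxx.
  apply: (nf (b / (1 - a))); apply: cofin_sub F0 _ => x; rewrite /F e mul0r addr0 => /eqP.
  by rewrite subr_eq0 => /eqP <-; field.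
apply: (fh (- (1 - a) / (l3 - a * l2)) (b / (l3 - a * l2))).
apply: cofin_sub F0 _ => x Fx; apply: (mulfI ne); apply/eqP; rewrite -subr_eq0 -[X in _ == X]Fx /F.
by apply/eqP; field.
Qed.

(** [rigid_three] needs three distinct points in D. If s has a single point, then d = 3 and gn <= 1,
    and h comes from [triple_pencil] instead of [free_from_ex]. *)
Theorem good_pencil p1 (s : seq X) f : finitely_generated X ->
  uniq (p1 :: s) -> s != [::] -> (gn + 1 < size (p1 :: p1 :: s))%N ->
  poles (p1 :: p1 :: s) f -> (forall p, p \notin (p1 :: p1 :: s) -> hv p f (f p)) ->
  no_triple (p1 :: p1 :: s) f -> sep_ram (p1 :: p1 :: s) f ->
  exists h (B : seq K), [/\ LL (p1 :: p1 :: s) h, forall p, p \notin (p1 :: p1 :: s) -> hv p h (h p), 0 \notin B,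
    forall l, l \notin B -> [/\ poles (p1 :: p1 :: s) (pencil f h l), no_triple (p1 :: p1 :: s) (pencil f h l) &
      sep_ram (p1 :: p1 :: s) (pencil f h l)] &
    forall L : K -> Prop, infinitely_many L -> (forall l, L l -> l \notin B) ->
      ~ (forall l m, L l -> L m -> isotrivial_pair (pencil f h l) (pencil f h m))].
Proof.
move=> FG us s0 gD fD fv f3 fsep; set D := p1 :: p1 :: s.
have Dne : D != [::] by [].
have nf : nonconst f := poles_nonconst Dne fD.
have [h0 [h0D h0f h0R]] : exists h, [/\ LL D h, free_from f h & rigid_fun (fixing_pencil D f h)].
  rewrite /D; case: s us s0 gD fD {D fv f3 fsep Dne} => [//|p2 [|p3 s]] us _ gD fD.
    have n12 : p1 != p2 by move: us; rewrite /= inE andbT.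
    have g1 : (gn <= 1)%N by move: gD => /=; lia.
    exact: (triple_pencil n12 g1 fD).
  have [h hD hf] := free_from_ex RR gD fD; exists h; split=> //.
  move: us; rewrite /= !inE !negb_or => /and3P[/and3P[n12 n13 _] /andP[n23 _] _].
  have [Psi [rP nP HP]] := rigid_three RR n12 n13 n23.
  exists Psi; split=> // al [A aD _]; apply: HP; split=> //.
  by split; apply: aD; rewrite !inE eqxx ?orbT.
have [h e hv_] := true_values h0D.
have hD : LL D h := LL_ae h0D e.
have hf : free_from f h.
  move=> b c H; apply: (h0f b c); apply: cofin_sub (cofin_and H e) _ => x [<- ->] //.
have hR : rigid_fun (fixing_pencil D f h).
  have [Psi [rP nP HP]] := h0R; exists Psi; split=> // al [[al' A] aD [l [m [a [b [a0 H]]]]]].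
  apply: HP; split=> //; first by exists al'.
  exists l, m, a, b; split=> //; apply: cofin_sub (cofin_and H (cofin_and e (cofin_auto A e))) _.
  by move=> x [Hx [ex eax]]; rewrite /pencil ex eax.
have fD' : LL D f.
  move=> p; have [pD|pD] := boolP (p \in D); first exact/ordeq_ge/fD.
  by rewrite (count_memPn pD); apply/ordge0E; exists (f p); apply: fv.
have [kap dh] := deriv_ex (LL_rat fD') nf (LL_rat hD).
have [B [B0 HB]] := pencil_simple FG Dne fD fv hv_ hD hf f3 fsep dh.
exists h, B; split=> // L iL LB.
apply: not_isotrivial Dne fD' fv nf hD hv_ hf hR iL _ => l /LB/HB[].
by [].
Qed.

(** With a second function h of L(D), dh/df has a pole by [moving_ex], and its poles are
    ramification points of f outside D. This replaces the Riemann-Hurwitz count. *)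
Theorem ramification_ex D f : finitely_generated X -> D != [::] -> (gn + 1 < size D)%N ->
  poles D f -> (forall p, p \notin D -> hv p f (f p)) -> no_triple D f ->
  exists2 p, p \notin D & ramif f p.
Proof.
move=> FG Dne gD fD fv f3.
have nf : nonconst f := poles_nonconst Dne fD.
have [h0 h0D h0f] := free_from_ex RR gD fD.
have [h e hv_] := true_values h0D.
have hf : free_from f h.
  move=> b c H; apply: (h0f b c); apply: cofin_sub (cofin_and H e) _ => x [<- ->] //.
have hD : LL D h := LL_ae h0D e.
have rf : rat f by have [p pD] : exists p, p \in D;
  [by case: (D) Dne => // p s _; exists p; rewrite mem_head|exact: ordeq_rat (fD p pD)].
have [kap dh] := deriv_ex rf nf (LL_rat hD).
have [p [pD [b' _ [jf _]]]] := moving_ex FG Dne fD fv hv_ hD hf f3 dh.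
by exists p => //; apply/(ramif_jet jf).
Qed.

End GoodPencil.

(** * Rational functions on a projective curve *)

Lemma mpoly_ring_ind (R : comNzRingType) (n : nat) (A : {mpoly R[n]} -> Prop) :
  (forall c, A c%:MP) -> (forall i, A 'X_i) ->
  (forall Q Q', A Q -> A Q' -> A (Q + Q')) -> (forall Q Q', A Q -> A Q' -> A (Q * Q')) ->
  forall Q, A Q.
Proof.
move=> AC AX AD AM; elim/mpolyind => [|c m Q _ _ AQ]; first by rewrite -mpolyC0.
apply: (AD) (AQ); rewrite -mul_mpolyC; apply: (AM) => //.
rewrite mpolyXE_id; apply: (big_ind A) => [||i _]; [by rewrite -mpolyC1|exact: AM|].
elim: (m i) => [|k IH]; first by rewrite expr0 -mpolyC1.
by rewrite exprS; apply: AM.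
Qed.

(** * A weak Nullstellensatz *)

Section IdealPoint.
Variables (K : closedFieldType) (N : nat).
Implicit Types (I : {mpoly K[N]} -> Prop) (Q R : {mpoly K[N]}).

Definition is_ideal I :=
  [/\ I 0, forall Q R, I Q -> I R -> I (Q + R) & forall Q R, I Q -> I (R * Q)].

(* The quotient by I has dimension less than c. *)
Definition codim_lt I c := forall Q : 'I_c -> {mpoly K[N]},
  exists2 l : 'I_c -> K, (exists i, l i != 0) & I (\sum_i l i *: Q i).

Lemma ideal_adjoin I R : is_ideal I -> is_ideal (fun Q => exists S, I (Q + S * R)).
Proof.
move=> [i0 iD iM]; split.
- by exists 0; rewrite mul0r addr0.
- move=> Q Q' [S HS] [S' HS']; exists (S + S').
  by rewrite mulrDl addrACA; apply: iD.
- by move=> Q Q' [S HS]; exists (Q' * S); rewrite -mulrA -mulrDr; apply: iM.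
Qed.

Definition peval i (p : {poly K}) : {mpoly K[N]} := (map_poly (@mpolyC N K) p).['X_i].

Lemma pevalM i p q : peval i (p * q) = peval i p * peval i q.
Proof. by rewrite /peval rmorphM hornerM. Qed.

Lemma peval_lin i a : peval i ('X - a%:P) = 'X_i - a%:MP.
Proof. by rewrite /peval rmorphB /= map_polyX map_polyC hornerXsubC. Qed.

Lemma peval_poly i c (e : nat -> K) :
  peval i (\poly_(k < c) e k) = \sum_(k < c) e k *: 'X_i ^+ k.
Proof.
rewrite /peval poly_def rmorph_sum horner_sum; apply: eq_bigr => k _.
by rewrite /= map_polyZ hornerZ map_polyXn hornerXn mul_mpolyC.
Qed.

(** Split off a root a of p, p = q (X - a). If adjoining X_i - a to I gave the unit ideal, q(X_i)
    would already lie in I, and q has smaller degree. *)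
Lemma ideal_root I i p : is_ideal I -> ~ I 1 -> p != 0 -> I (peval i p) ->
  exists a : K, ~ exists S, I (1 + S * ('X_i - a%:MP)).
Proof.
move=> [i0 iD iM] n1; move: {2}(size p) (leqnn (size p)) => n.
elim: n p => [|n IH] p; first by rewrite leqn0 size_poly_eq0 => ->.
move=> sp p0 Ip; have [/closed_rootP[a /factor_theorem[q eq]]|s1] := boolP (size p != 1%N); last first.
  move: s1; rewrite negbK => /size_poly1P[c c0 pc]; case: n1.
  have := iM _ (c^-1)%:MP Ip; rewrite pc /peval map_polyC hornerC -mpolyCM mulVf //.
have [[S HS]|nS] := pselect (exists S, I (1 + S * ('X_i - a%:MP))); last by exists a.
have q0 : q != 0 by apply: contra p0 => /eqP q0; rewrite eq q0 mul0r.
apply: (IH q) => //.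
  by move: sp; rewrite eq size_Mmonic ?monicXsubC // size_XsubC addn2.
have -> : peval i q = peval i q * (1 + S * ('X_i - a%:MP)) + (- S) * peval i p.
  by rewrite eq pevalM peval_lin; ring.
by apply: iD; apply: iM.
Qed.

(* Weak Nullstellensatz for ideals of finite codimension. *)
Theorem ideal_point I c : is_ideal I -> ~ I 1 -> codim_lt I c ->
  exists xi : 'I_N -> K, forall Q, I Q -> Q.@[xi] = 0.
Proof.
elim: c I => [|c IH] I iI n1 Ic.
  by have [l [[]]] := Ic (fun=> 0).
have [i0 iD iM] := iI.
have rt i : exists a : K, ~ exists S, I (1 + S * ('X_i - a%:MP)).
  have [l [j lj] Hl] := Ic (fun k => 'X_i ^+ k).
  pose p := \poly_(k < c.+1) (if insub k is Some k' then l k' else 0).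
  have p0 : p != 0.
    apply: contra lj => /eqP/(congr1 (fun q : {poly K} => q`_j)).
    by rewrite coef_poly ltn_ord valK coef0 => ->.
  apply: ideal_root iI n1 p0 _; rewrite peval_poly; move: Hl; congr I.
  by apply: eq_bigr => k _; rewrite valK.
have /choice[a Ha] := rt.
(* If all X_i - a_i lie in I, then a is the point sought. Otherwise adjoining a missing one keeps
   the ideal proper and lowers its codimension. *)
have [[i Hi]|all] := pselect (exists i, ~ I ('X_i - (a i)%:MP)); last first.
  have Ia i : I ('X_i - (a i)%:MP) by apply: contrapT => H; apply: all; exists i.
  have key Q : I (Q - (Q.@[a])%:MP).
    elim/mpoly_ring_ind: Q => [e|i|Q Q' HQ HQ'|Q Q' HQ HQ'].
    - by rewrite mevalC subrr.
    - by rewrite mevalXU.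
    - by rewrite mevalD mpolyCD opprD addrACA; apply: iD.
    - rewrite mevalM mpolyCM.
      have -> : Q * Q' - (Q.@[a])%:MP * (Q'.@[a])%:MP =
          Q' * (Q - (Q.@[a])%:MP) + (Q.@[a])%:MP * (Q' - (Q'.@[a])%:MP) by ring.
      by apply: iD; apply: iM.
  exists a => Q IQ; apply/eqP/negPn/negP => Qa; apply: n1.
  have IQa : I (Q.@[a])%:MP.
    have -> : (Q.@[a])%:MP = Q + (- 1) * (Q - (Q.@[a])%:MP) by ring.
    by apply: iD => //; apply: iM; apply: key.
  by have := iM _ ((Q.@[a])^-1)%:MP IQa; rewrite -mpolyCM mulVf.
have [xi Hxi] : exists xi : 'I_N -> K, forall Q, (exists S, I (Q + S * ('X_i - (a i)%:MP))) -> Q.@[xi] = 0.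
  apply: IH (ideal_adjoin _ iI) (Ha i) _ => Q.
  have [l [j lj] Hl] := Ic (fun k => if unlift ord0 k is Some k' then Q k' else 'X_i - (a i)%:MP).
  move: Hl; rewrite big_ord_recl unlift_none => Hl.
  have {}Hl : I (\sum_k l (lift ord0 k) *: Q k + (l ord0)%:MP * ('X_i - (a i)%:MP)).
    move: Hl; rewrite addrC mul_mpolyC; congr (I (_ + _)); apply: eq_bigr => k _.
    by have -> : unlift ord0 (lift ord0 k) = Some k by rewrite liftK.
  exists (fun k => l (lift ord0 k)); last by exists (l ord0)%:MP.
  apply: contrapT => nl.
  have lz k : l (lift ord0 k) = 0.
    by apply/eqP/negPn/negP => lk; apply: nl; exists k.
  have l0 : l ord0 != 0.
    by move: lj; case: (unliftP ord0 j) => [j' ->|-> //]; rewrite lz eqxx.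
  apply: Hi; have := iM _ ((l ord0)^-1)%:MP Hl.
  rewrite big1 ?add0r; last by move=> k _; rewrite lz scale0r.
  by rewrite mulrA -mpolyCM mulVf // mpolyC1 mul1r.
by exists xi => Q IQ; apply: Hxi; exists 0; rewrite mul0r addr0.
Qed.

End IdealPoint.

(** * Forms on a connected curve: orders, zero count, Liouville and Riemann *)

Section Forms.
Variables (K : numClosedFieldType) (N : nat) (P : eqType) (x : P -> 'I_N.+1 -> K).
Implicit Types (p q y : P) (F G H : P -> K) (k m n : nat).

Definition fm k F := exists2 Q : {mpoly K[N.+1]}, Q \is k.-homog & forall y, F y = Q.@[x y].

Lemma fm_ext k F G : fm k F -> F =1 G -> fm k G.
Proof. by case=> Q hQ FQ FG; exists Q => // y; rewrite -FG. Qed.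

Lemma fm_add k F G : fm k F -> fm k G -> fm k (fun y => F y + G y).
Proof.
move=> [Q hQ FQ] [R hR GR]; exists (Q + R); first exact: dhomogD.
by move=> y; rewrite mevalD FQ GR.
Qed.

Lemma fm_mul k m F G : fm k F -> fm m G -> fm (k + m) (fun y => F y * G y).
Proof.
move=> [Q hQ FQ] [R hR GR]; exists (Q * R); first exact: dhomogM.
by move=> y; rewrite mevalM FQ GR.
Qed.

Lemma fm0 k : fm k (fun=> 0).
Proof. by exists 0; [exact: dhomog0|move=> y; rewrite meval0]. Qed.

Lemma fm_const c : fm 0 (fun=> c).
Proof.
exists (c *: 1); first by apply: dhomogZ; apply: dhomog1.
by move=> y; rewrite mevalZ meval1 mulr1.
Qed.

Lemma fm_scale c k F : fm k F -> fm k (fun y => c * F y).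
Proof. by move=> hF; apply: fm_mul (fm_const c) hF. Qed.

Lemma fm_sub k F G : fm k F -> fm k G -> fm k (fun y => F y - G y).
Proof.
move=> hF hG; apply: fm_ext (fm_add hF (fm_scale (-1) hG)) _ => y.
by rewrite mulN1r.
Qed.

Lemma fm_exp k n F : fm k F -> fm (n * k) (fun y => F y ^+ n).
Proof.
move=> hF; elim: n => [|n IH]; first exact: fm_const.
by rewrite mulSn; apply: fm_ext (fm_mul hF IH) _ => y; rewrite exprS.
Qed.

Lemma fm_coord i : fm 1 (fun y => x y i).
Proof.
exists 'X_i; first by rewrite dhomogX /= mdeg1.
by move=> y; rewrite mevalXU.
Qed.

Lemma fm_coordX i n : fm n (fun y => x y i ^+ n).
Proof. by have := fm_exp n (fm_coord i); rewrite muln1. Qed.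

Lemma fm_sum (I : Type) (r : seq I) k (F : I -> P -> K) :
  (forall i, fm k (F i)) -> fm k (fun y => \sum_(i <- r) F i y).
Proof.
move=> hF; elim: r => [|i r IH].
  by apply: fm_ext (fm0 k) _ => y; rewrite big_nil.
by apply: fm_ext (fm_add (hF i) IH) _ => y; rewrite big_cons.
Qed.

Lemma fm_eqdeg k m F : fm k F -> k = m -> fm m F.
Proof. by move=> hF <-. Qed.

Definition nbhd p (Q : P -> Prop) := exists k c,
  [/\ fm k c, c p != 0 & forall y, c y != 0 -> Q y].

Lemma nbhd_and p Q R : nbhd p Q -> nbhd p R -> nbhd p (fun y => Q y /\ R y).
Proof.
move=> [k [c [hc c0 cQ]]] [m [d [hd d0 dR]]]; exists (k + m)%N, (fun y => c y * d y).
split; [exact: fm_mul|by rewrite mulf_neq0|].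
by move=> y; rewrite mulf_eq0 negb_or => /andP[/cQ ? /dR].
Qed.

Lemma nbhd_sub p (Q R : P -> Prop) : nbhd p Q -> (forall y, Q y -> R y) -> nbhd p R.
Proof. by move=> [k [c [hc c0 cQ]]] QR; exists k, c; split=> // y /cQ/QR. Qed.

Lemma nbhd_form p k c : fm k c -> c p != 0 -> nbhd p (fun y => c y != 0).
Proof. by move=> hc c0; exists k, c. Qed.

Lemma nbhd_forall (I : finType) p (Q : I -> P -> Prop) :
  (forall i, nbhd p (Q i)) -> nbhd p (fun y => forall i, Q i y).
Proof.
move=> H; suff : nbhd p (fun y => forall i, i \in enum I -> Q i y).
  by move/nbhd_sub; apply => y Hy i; apply: Hy; rewrite mem_enum.
elim: (enum I) => [|i s IH].
  by exists 0%N, (fun=> 1); split; [exact: fm_const|exact: oner_neq0|].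
apply: nbhd_sub (nbhd_and (H i) IH) _ => y [A B] j; rewrite inE => /orP[/eqP->|/B] //.
Qed.

Hypothesis x_ne0 : forall p, exists i, x p i != 0.
Hypothesis x_inj : forall p q, (forall i j, x p i * x q j = x p j * x q i) -> p = q.

Lemma lin_separate p q : p != q -> exists2 L, fm 1 L & L p = 0 /\ L q != 0.
Proof.
move=> pq.
have [i [j ij]] : exists i j, x p i * x q j != x p j * x q i.
  apply: contrapT => H; move/eqP: pq; apply; apply: x_inj => i j.
  by apply/eqP/negPn/negP => ne; apply: H; exists i, j.
exists (fun y => x p i * x y j - x p j * x y i).
  by apply: fm_sub; apply: fm_scale; apply: fm_coord.
by split; [rewrite mulrC subrr|rewrite subr_eq0].
Qed.

Lemma avoid_points p (s : seq P) : p \notin s -> exists k c,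
  [/\ fm k c, c p != 0 & forall q, q \in s -> c q = 0].
Proof.
elim: s => [|q s IH] /=.
  by move=> _; exists 0%N, (fun=> 1); split; [exact: fm_const|exact: oner_neq0|].
rewrite inE negb_or => /andP[pq /IH[k [c [hc c0 cs]]]].
have [|L hL [Lq Lp]] := @lin_separate q p; first by rewrite eq_sym.
exists (k + 1)%N, (fun y => c y * L y); split; [exact: fm_mul|by rewrite mulf_neq0|].
by move=> q'; rewrite inE => /orP[/eqP->|/cs ->]; rewrite ?Lq ?mulr0 ?mul0r.
Qed.

(* The form a vanishes to first order at p. *)
Definition unif_form p (ka : nat) (a b : P -> K) :=
  [/\ fm ka a, fm ka b, a p = 0, b p != 0 &
   forall k G, fm k G -> G p = 0 -> exists j c j' H,
     [/\ fm j c, c p != 0, fm j' H, (j + k = j' + ka)%N & forall y, G y * c y = H y * a y]].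

Variables (ka : P -> nat) (a b : P -> P -> K).
Hypothesis hunif : forall p, unif_form p (ka p) (a p) (b p).
Hypothesis noniso : forall p Q, nbhd p Q -> exists2 y, y != p & Q y.

Let ha p : fm (ka p) (a p). Proof. by case: (hunif p). Qed.
Let a0 p : a p p = 0. Proof. by case: (hunif p). Qed.

(** Divisibility of G by the n-th power of a in the local ring at p, kept within forms: the factor
    c, nonzero at p, localises, and the degree equation makes both sides homogeneous of one degree.
    [Hc] is the condition on the cofactor. *)
Definition vrel p n k G (Hc : (P -> K) -> Prop) := exists j c j' H,
  [/\ fm j c, c p != 0, fm j' H /\ Hc H, (j + k = j' + n * ka p)%N &
      forall y, G y * c y = H y * a p y ^+ n].
Definition vge p n k G := vrel p n k G (fun=> True).
Definition veq p n k G := vrel p n k G (fun H => H p != 0).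

Lemma veq_vge p n k G : veq p n k G -> vge p n k G.
Proof. by move=> [j [c [j' [H [h1 h2 [h3 _] h4 h5]]]]]; exists j, c, j', H. Qed.

Lemma vge0 p k G : fm k G -> vge p 0 k G.
Proof.
move=> hG; exists 0%N, (fun=> 1), k, G; split; rewrite ?mul0n ?addn0 ?expr0 //; [exact: fm_const|exact: oner_neq0].
Qed.

Lemma veq0 p k G : fm k G -> G p != 0 -> veq p 0 k G.
Proof.
move=> hG G0; exists 0%N, (fun=> 1), k, G; split; rewrite ?mul0n ?addn0 ?expr0 //; [exact: fm_const|exact: oner_neq0].
Qed.

Lemma vge1 p k G : fm k G -> G p = 0 -> vge p 1 k G.
Proof.
move=> hG G0; have [_ _ _ _ /(_ k G hG G0)] := hunif p.
move=> [j [c [j' [H [h1 h2 h3 h4 h5]]]]]; exists j, c, j', H.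
by rewrite mul1n; split.
Qed.

Lemma vge_step p n k G : vge p n k G -> veq p n k G \/ vge p n.+1 k G.
Proof.
move=> [j [c [j' [H [hc c0 [hH _] e E]]]]].
have [H0|H0] := eqVneq (H p) 0; last by left; exists j, c, j', H.
right; have [_ _ _ _ /(_ _ _ hH H0)] := hunif p.
move=> [i [d [i' [H' [hd d0 hH' e' E']]]]].
exists (j + i)%N, (fun y => c y * d y), i', H'; split=> //.
- exact: fm_mul.
- by rewrite mulf_neq0.
- by rewrite mulSn; lia.
- by move=> y; rewrite mulrA E mulrAC E' exprS; ring.
Qed.

(** Infinite order cannot yet be excluded for nonzero forms, since the curve is only known to be
    connected; [order_dichotomy] does so later. *)
Lemma order_alt p k G : fm k G -> (exists n, veq p n k G) \/ (forall n, vge p n k G).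
Proof.
move=> hG; have [|nex] := pselect (exists n, veq p n k G); first by left.
right; elim=> [|n IH]; first exact: vge0.
by case: (vge_step IH) => // Hn; case: nex; exists n.
Qed.

(** The linear forms that cut out the point p vanish at p, so near p they are multiples of a. *)
Lemma a_punctured p : nbhd p (fun y => a p y = 0 -> y = p).
Proof.
have [l pl] := x_ne0 p.
pose L i y := x y i * x p l - x p i * x y l.
have hL i : fm 1 (L i).
  apply: fm_sub; last exact/fm_scale/fm_coord.
  by apply: fm_ext (fm_scale (x p l) (fm_coord i)) _ => y; rewrite mulrC.
have H i : nbhd p (fun y => a p y = 0 -> L i y = 0).
  have [_ _ _ _ /(_ _ _ (hL i))] := hunif p.
  rewrite /L mulrC subrr => /(_ erefl)[j [c [j' [G [hc c0 _ _ E]]]]].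
  exists j, c; split=> // y cy ay; apply: (mulIf cy).
  by rewrite [LHS]E ay mulr0 mul0r.
have := nbhd_and (nbhd_forall H) (nbhd_form (fm_coord l) pl).
move/nbhd_sub; apply => y [Hy yl] ay; apply: x_inj => i j.
have e i' : x y i' = x p i' * x y l / x p l.
  by apply: (mulIf pl); rewrite divfK //; apply/eqP; rewrite -subr_eq0; apply/eqP; apply: Hy.
rewrite (e i) (e j); field; exact: pl.
Qed.

Lemma a_dense p (Q : P -> Prop) : nbhd p Q -> exists y, [/\ y != p, a p y != 0 & Q y].
Proof.
move=> pQ; have [y yp [Qy H]] := noniso (nbhd_and pQ (a_punctured p)).
exists y; split=> //; apply: contra yp => /eqP /H -> //.
Qed.

(** If m > n, the two expressions of G give a form that is nonzero at p and is killed by the n-th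
    power of a; but a is nonzero at points in every neighbourhood of p. *)
Lemma veq_vge_le p n m k G : veq p n k G -> vge p m k G -> (m <= n)%N.
Proof.
move=> [j [c [j' [H [hc c0 [hH H0] e E]]]]] [i [d [i' [H' [hd d0 [hH' _] e' E']]]]].
rewrite leqNgt; apply/negP => nm.
pose E0 y := H y * d y - H' y * c y * a p y ^+ (m - n).
have hE0 : fm (j' + i) E0.
  apply: fm_sub; first exact: fm_mul.
  have := fm_mul (fm_mul hH' hc) (fm_exp (m - n) (ha p)).
  by move/fm_eqdeg; apply; rewrite mulnBl; have : (n * ka p <= m * ka p)%N; [rewrite leq_mul2r (ltnW nm) orbT|lia].
have E0p : E0 p != 0.
  by rewrite /E0 a0 expr0n subn_eq0 leqNgt nm mulr0 subr0 mulf_neq0.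
have [y [yp ay]] := a_dense (nbhd_form hE0 E0p).
have an : a p y ^+ n != 0 by rewrite expf_neq0.
apply/negP; rewrite negbK -(mulIr_eq0 _ (mulIf an)) /E0 mulrBl; apply/eqP.
transitivity (H y * a p y ^+ n * d y - H' y * (a p y ^+ (m - n) * a p y ^+ n) * c y); first by ring.
by rewrite -E -exprD subnK ?(ltnW nm) // -E'; ring.
Qed.

Lemma veq_uniq p n m k G : veq p n k G -> veq p m k G -> n = m.
Proof.
move=> A B; apply/eqP; rewrite eqn_leq.
by rewrite (veq_vge_le A (veq_vge B)) (veq_vge_le B (veq_vge A)).
Qed.

Lemma vge_le p n m k G : (m <= n)%N -> vge p n k G -> vge p m k G.
Proof.
move=> mn [j [c [j' [H [hc c0 [hH _] e E]]]]].
exists j, c, (j' + (n - m) * ka p)%N, (fun y => H y * a p y ^+ (n - m)); split=> //.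
- by split=> //; apply: fm_mul hH (fm_exp _ (ha p)).
- by rewrite e mulnBl; have : (m * ka p <= n * ka p)%N; [rewrite leq_mul2r mn orbT|lia].
- by move=> y; rewrite E -mulrA -exprD subnK.
Qed.

Lemma vgeM p n m k k' G G' : vge p n k G -> vge p m k' G' ->
  vge p (n + m) (k + k') (fun y => G y * G' y).
Proof.
move=> [j [c [j' [H [hc c0 [hH _] e E]]]]] [i [d [i' [H' [hd d0 [hH' _] e' E']]]]].
exists (j + i)%N, (fun y => c y * d y), (j' + i')%N, (fun y => H y * H' y); split.
- exact: fm_mul.
- by rewrite mulf_neq0.
- by split=> //; apply: fm_mul.
- by rewrite mulnDl; lia.
- by move=> y; rewrite mulrACA E E' exprD mulrACA.
Qed.

Lemma veqM p n m k k' G G' : veq p n k G -> veq p m k' G' ->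
  veq p (n + m) (k + k') (fun y => G y * G' y).
Proof.
move=> [j [c [j' [H [hc c0 [hH H0] e E]]]]] [i [d [i' [H' [hd d0 [hH' H'0] e' E']]]]].
exists (j + i)%N, (fun y => c y * d y), (j' + i')%N, (fun y => H y * H' y); split.
- exact: fm_mul.
- by rewrite mulf_neq0.
- by split; [exact: fm_mul|rewrite mulf_neq0].
- by rewrite mulnDl; lia.
- by move=> y; rewrite mulrACA E E' exprD mulrACA.
Qed.

Lemma vgeD p n k G G' : vge p n k G -> vge p n k G' -> vge p n k (fun y => G y + G' y).
Proof.
move=> [j [c [j' [H [hc c0 [hH _] e E]]]]] [i [d [i' [H' [hd d0 [hH' _] e' E']]]]].
exists (j + i)%N, (fun y => c y * d y), (j' + i)%N, (fun y => H y * d y + H' y * c y); split.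
- exact: fm_mul.
- by rewrite mulf_neq0.
- split=> //; apply: fm_add; first exact: fm_mul.
  by apply: (fm_eqdeg (fm_mul hH' hc)); lia.
- by lia.
- move=> y; rewrite mulrDl mulrA E [c y * d y]mulrC mulrA E'; ring.
Qed.

Lemma vgeZ p n k c G : vge p n k G -> vge p n k (fun y => c * G y).
Proof.
move=> [j [d [j' [H [hc c0 [hH _] e E]]]]]; exists j, d, j', (fun y => c * H y); split=> //.
  by split=> //; apply: fm_scale.
by move=> y; rewrite -mulrA E mulrA.
Qed.


Lemma veq_a p : veq p 1 (ka p) (a p).
Proof.
exists 0%N, (fun=> 1), 0%N, (fun=> 1); split.
- exact: fm_const.
- exact: oner_neq0.
- by split; [exact: fm_const|exact: oner_neq0].
- by rewrite mul1n.
- by move=> y; rewrite mulrC.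
Qed.

Lemma veq_punctured p n k G : veq p n k G -> nbhd p (fun y => y != p -> G y != 0).
Proof.
move=> [j [c [j' [H [hc c0 [hH H0] e E]]]]].
apply: nbhd_sub (nbhd_and (a_punctured p) (nbhd_form hH H0)) _ => y [A B] yp.
have ay : a p y != 0 by apply: contra yp => /eqP/A ->.
apply/eqP => Gy; have /eqP := E y; rewrite Gy mul0r eq_sym mulf_eq0.
by rewrite (negbTE B) expf_eq0 (negbTE ay) andbF.
Qed.

Lemma vge1_eq0 p k G : vge p 1 k G -> G p = 0.
Proof.
move=> [j [c [j' [H [hc c0 _ e E]]]]]; have := E p.
rewrite a0 expr1 mulr0 => /eqP.
by rewrite mulf_eq0 (negbTE c0) orbF => /eqP.
Qed.

Definition zfun (Z : seq P) k G := forall q, vge q (count_mem q Z) k G.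

(* Forms of large degree separate the jets along Z. *)
Lemma jets_independent (Z : seq P) : exists m0, forall m, (m0 <= m)%N ->
  exists w : 'I_(size Z) -> P -> K, (forall i, fm m (w i)) /\
    forall c : 'I_(size Z) -> K, zfun Z m (fun y => \sum_i c i * w i y) -> forall i, c i = 0.
Proof.
elim: Z => [|p Z [m0 IH]].
  by exists 0%N => m _; exists (fun _ _ => 0); split=> [[] //|c _ []].
(* W vanishes along Z and to no higher order at p, so it detects exactly the condition that p adds
   to Z. *)
have [k [W [hW WZ Wp]]] : exists k W, [/\ fm k W, zfun Z k W & veq p (count_mem p Z) k W].
  elim: Z {m0 IH} => [|q Z [k [W [hW WZ Wp]]]].
    exists 0%N, (fun=> 1); split; first exact: fm_const.
      by move=> q; apply: vge0; apply: fm_const.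
    by apply: veq0; [exact: fm_const|exact: oner_neq0].
  have [eq|ne] := eqVneq q p.
    exists (ka p + k)%N, (fun y => a p y * W y); split; first exact: fm_mul.
      move=> q' /=; have [<-|nq] := eqVneq q q'; last first.
        by apply: vgeM (WZ q'); apply: vge0.
      by apply: vgeM (WZ q); rewrite eq; apply/veq_vge/veq_a.
    by rewrite /= eq eqxx; apply: veqM Wp; apply: veq_a.
  have [L hL [Lq Lp]] := lin_separate ne.
  exists (1 + k)%N, (fun y => L y * W y); split; first exact: fm_mul.
    move=> q' /=; have [<-|nq] := eqVneq q q'; last by apply: vgeM (WZ q'); apply: vge0.
    by apply: vgeM (WZ q); apply: vge1.
  by rewrite /= (negbTE ne); apply: veqM Wp; apply: veq0.
have [l pl] := x_ne0 p.
exists (maxn m0 k) => m; rewrite geq_max => /andP[/IH[w [hw iw]] km].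
pose W' y := W y * x y l ^+ (m - k).
have hW' : fm m W'.
  by apply: fm_eqdeg (fm_mul hW (fm_exp (m - k) (fm_coord l))) _; lia.
have W'Z : zfun Z m W'.
  move=> q; have := vgeM (WZ q) (vge0 q (fm_exp (m - k) (fm_coord l))).
  by rewrite addn0 (_ : k + (m - k) * 1 = m)%N //; lia.
have W'p : veq p (count_mem p Z) m W'.
  have xl : x p l ^+ (m - k) != 0 by rewrite expf_neq0.
  have := veqM Wp (veq0 (fm_exp (m - k) (fm_coord l)) xl).
  by rewrite addn0 (_ : k + (m - k) * 1 = m)%N //; lia.
exists (fun i => if unlift ord0 i is Some j then w j else W'); split.
  by move=> i; case: unliftP.
move=> c Hc.
have E y : \sum_i c i * (if unlift ord0 i is Some j then w j else W') y =
    c ord0 * W' y + \sum_i c (lift ord0 i) * w i y.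
  rewrite big_ord_recl unlift_none; congr (_ + _); apply: eq_bigr => i _.
  by have -> : unlift ord0 (lift ord0 i) = Some i by rewrite liftK.
move: Hc; rewrite (funext E) => Hc.
have cw i : c (lift ord0 i) = 0.
  apply: (iw (fun i => c (lift ord0 i))) => q.
  have := vgeD (vge_le (leq_addl (p == q) _) (Hc q)) (vgeZ (- c ord0) (W'Z q)).
  congr vge; apply/funext => y; ring.
have c0 : c ord0 = 0.
  apply/eqP/negPn/negP => c0; have := vgeZ (c ord0)^-1 (Hc p).
  rewrite /= eqxx => H.
  suff : vge p (1 + count_mem p Z) m W' by move=> /(veq_vge_le W'p); lia.
  move: H; congr vge; apply/funext => y.
  by rewrite big1 => [|i _]; [rewrite addr0 mulKf|rewrite cw mul0r].
by move=> i; case: (unliftP ord0 i) => [j ->|->].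
Qed.

Definition form_basis k h := exists s : 'I_h -> P -> K, [/\ forall i, fm k (s i),
  forall c : 'I_h -> K, (forall y, \sum_i c i * s i y = 0) -> forall i, c i = 0 &
  forall F, fm k F -> exists c : 'I_h -> K, forall y, F y = \sum_i c i * s i y].

Variables (D0 k0 g : nat) (pt0 : P).
Hypothesis hilb : forall k, (k0 <= k)%N ->
  exists2 h, form_basis k h & (h + g = D0 * k + 1)%N.

Definition zeros_of (S : (P -> K) -> Prop) p := forall F, S F -> F p = 0.

Hypothesis conn : forall S1 S2 : (P -> K) -> Prop,
  (forall F, S1 F -> exists k, fm k F) -> (forall F, S2 F -> exists k, fm k F) ->
  (forall p, zeros_of S1 p \/ zeros_of S2 p) ->
  (forall p, ~ (zeros_of S1 p /\ zeros_of S2 p)) ->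
  (forall p, zeros_of S1 p) \/ (forall p, zeros_of S2 p).

Definition indep_on (U : P -> Prop) m n := exists w : 'I_n -> P -> K,
  (forall i, fm m (w i)) /\
  forall c : 'I_n -> K, (forall y, U y -> \sum_i c i * w i y = 0) -> forall i, c i = 0.

Lemma indep_on_le U m n : (k0 <= m)%N -> indep_on U m n -> (n <= D0 * m + 1)%N.
Proof.
move=> km [w [hw iw]]; have [h [s [hs ibs bs]] e] := hilb km.
suff : (n <= h)%N by lia.
have /choice[M HM] := fun i => bs _ (hw i).
rewrite leqNgt; apply/negP => hn.
pose A := \matrix_(i, j) M i j.
have : kermx A != 0.
  rewrite -mxrank_eq0 mxrank_ker subn_eq0 -ltnNge.
  exact: leq_ltn_trans (rank_leq_col A) hn.
case/rowV0Pn => v /sub_kermxP vA v0.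
case/eqP: v0; apply/rowP => i; rewrite mxE.
apply: (iw (fun i => v 0 i)) => y _.
transitivity (\sum_j (v *m A) 0 j * s j y).
  rewrite (eq_bigr (fun i => \sum_j v 0 i * M i j * s j y)); last first.
    by move=> i' _; rewrite HM mulr_sumr; apply: eq_bigr => j _; rewrite mulrA.
  rewrite exchange_big; apply: eq_bigr => j _; rewrite mxE mulr_suml.
  by apply: eq_bigr => i' _; rewrite mxE.
by rewrite vA big1 // => j _; rewrite mxE mul0r.
Qed.

(** Each multiplication by G keeps an independent family independent and makes room for e more
    forms, independent modulo G. After r rounds the Hilbert polynomial gives r e <= D0 (M + r k) +
    1, hence e <= D0 k. *)
Lemma growth (U : P -> Prop) k G e m0 : fm k G ->
  (forall m H, fm m H -> (forall y, U y -> G y * H y = 0) -> forall y, U y -> H y = 0) ->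
  (forall m, (m0 <= m)%N -> exists w : 'I_e -> P -> K, (forall i, fm (m + k) (w i)) /\
    forall (c : 'I_e -> K) H, fm m H -> (forall y, U y -> \sum_i c i * w i y = G y * H y) ->
    forall i, c i = 0) ->
  (e <= D0 * k)%N.
Proof.
move=> hG nz jets; pose M := maxn m0 k0.
have step m n : (m0 <= m)%N -> indep_on U m n -> indep_on U (m + k) (n + e).
  move=> m0m [w [hw iw]]; have [w' [hw' iw']] := jets m m0m.
  exists (fun i => match split i with inl j => (fun y => G y * w j y) | inr j => w' j end).
  split; first by move=> i; case: split => j //; rewrite addnC; apply: fm_mul.
  move=> c Hc.
  have E y : U y -> G y * (\sum_i c (lshift e i) * w i y) + \sum_i c (rshift n i) * w' i y = 0.
    move=> Uy; rewrite -[RHS](Hc y Uy) big_split_ord /=; congr (_ + _).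
      rewrite mulr_sumr; apply: eq_bigr => i _.
      by rewrite (unsplitK (inl i : 'I_n + 'I_e)%type) mulrCA.
    by apply: eq_bigr => i _; rewrite (unsplitK (inr i : 'I_n + 'I_e)%type).
  pose H y := - \sum_i c (lshift e i) * w i y.
  have hH : fm m H.
    apply: fm_ext (fm_scale (-1) (fm_sum _ (fun i => fm_scale (c (lshift e i)) (hw i)))) _ => y.
    by rewrite mulN1r.
  have c2 : forall i, c (rshift n i) = 0.
    apply: (iw' _ H hH) => y Uy; apply/eqP; rewrite -subr_eq0 /H mulrN opprK addrC.
    by apply/eqP; apply: E.
  have c1 : forall i, c (lshift e i) = 0.
    apply: iw => y Uy; apply: (nz m (fun y => \sum_i c (lshift e i) * w i y)) Uy => [|y' Uy'].
      by apply: fm_sum => i; apply: fm_scale.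
    by rewrite -[RHS](E y' Uy') [X in _ + X]big1 ?addr0 // => i _; rewrite c2 mul0r.
  by move=> i; rewrite -(splitK i); case: (split i) => j /=.
have it r : indep_on U (M + r * k) (r * e).
  elim: r => [|r IH]; first by exists (fun _ _ => 0); split=> [[] //|c _ []].
  rewrite !mulSn [(k + _)%N]addnC addnA [(e + _)%N]addnC; apply: step IH.
  by rewrite /M; lia.
(* If e > D0 k, the inequality for r rounds gives r <= D0 M + 1. *)
have := indep_on_le _ (it (D0 * M + 2)%N) => /(_ ltac:(rewrite /M; lia)) H.
rewrite leqNgt; apply/negP => lt.
have : ((D0 * M + 2) * (D0 * k).+1 <= (D0 * M + 2) * e)%N by rewrite leq_mul2l lt orbT.
by nia.
Qed.

Definition finite_order k G p := exists n, veq p n k G.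

Lemma finite_order_nbhd k G p : fm k G -> finite_order k G p ->
  nbhd p (fun y => finite_order k G y /\ (y != p -> G y != 0)).
Proof.
move=> hG fp; have [n Hn] := fp; apply: nbhd_sub (veq_punctured Hn) _ => y Hy; split=> //.
have [->|yp] := eqVneq y p; first by [].
by exists 0%N; apply: veq0 => //; apply: Hy.
Qed.

Lemma finite_order_nonzerodiv k G : fm k G -> forall m H, fm m H ->
  (forall y, finite_order k G y -> G y * H y = 0) -> forall y, finite_order k G y -> H y = 0.
Proof.
move=> hG m H hH GH y fy; apply/eqP/negPn/negP => Hy.
have [z zy [Hz [fz Gz]]] := noniso (nbhd_and (nbhd_form hH Hy) (finite_order_nbhd hG fy)).
have /eqP := GH z fz; rewrite mulf_eq0 (negbTE Hz) orbF; exact/negP/Gz.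
Qed.

(* At a point of infinite order in the closure of the points of finite order,
   the jets of any length would be independent modulo G. *)
Lemma finite_order_closed k G p : fm k G -> ~ finite_order k G p ->
  nbhd p (fun y => ~ finite_order k G y).
Proof.
move=> hG np; apply: contrapT => ncl.
have vG n : vge p n k G by case: (order_alt p hG).
pose e := (D0 * k).+1.
have [m0 Hm0] := jets_independent (nseq e p).
suff : (e <= D0 * k)%N by rewrite ltnn.
apply: (growth (U := finite_order k G) (m0 := m0) hG) (finite_order_nonzerodiv hG) _ => m m0m.
have [|w [hw iw]] := Hm0 (m + k)%N; first by lia.
have iw' (c : 'I_(size (nseq e p)) -> K) H : fm m H ->
    (forall y, finite_order k G y -> \sum_i c i * w i y = G y * H y) -> forall i, c i = 0.
  move=> hH E; apply: iw => q.
  have hE : fm (m + k) (fun y => \sum_i c i * w i y - G y * H y).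
    apply: fm_sub; first by apply: fm_sum => i; apply: fm_scale.
    by rewrite addnC; apply: fm_mul.
  have [qp|nqp] := eqVneq p q; last first.
    rewrite count_nseq /= (negbTE nqp) mul0n; apply: vge0.
    by apply: fm_sum => i; apply: fm_scale.
  subst q; rewrite count_nseq /= eqxx mul1n.
  have vGH : vge p e (m + k) (fun y => G y * H y).
    by have := vgeM (vG e) (vge0 p hH); rewrite addn0 addnC.
  have [[n Hn]|Hinf] := order_alt p hE; last first.
    have := vgeD (Hinf e) vGH; congr vge; apply/funext => y; ring.
  exfalso; apply: ncl; apply: nbhd_sub (veq_punctured Hn) _ => y Hy fy.
  have [yp|yp] := eqVneq y p; first by rewrite yp in fy.
  by have := Hy yp; rewrite (E y fy) subrr eqxx.
move: w hw iw' {iw}; rewrite size_nseq => w hw iw'; by exists w.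
Qed.

(** The points of finite order and those of infinite order both form open sets, by
    [finite_order_nbhd] and [finite_order_closed], so connectedness leaves one of them empty. This
    is how connectedness turns into irreducibility, in the form of [fm_domain]. *)
Lemma order_dichotomy k G : fm k G ->
  (forall p, finite_order k G p) \/ (forall p, G p = 0).
Proof.
move=> hG; pose fo := finite_order k G.
pose S1 (c : P -> K) := (exists k', fm k' c) /\ forall y, c y != 0 -> fo y.
pose S2 (c : P -> K) := (exists k', fm k' c) /\ forall y, fo y -> c y = 0.
have Z1 p : zeros_of S1 p <-> ~ fo p.
  split=> [H fp|np F [hF HF]]; last by apply/eqP/negPn/negP => /HF.
  have [k' [c [hc c0 Hc]]] := finite_order_nbhd hG fp.
  by move: c0; rewrite (H c) ?eqxx //; split; [exists k'|move=> y /Hc[]].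
have Z2 p : zeros_of S2 p <-> fo p.
  split=> [H|fp F [hF HF]]; last exact: HF.
  apply: contrapT => np; have [k' [c [hc c0 Hc]]] := finite_order_closed hG np.
  move: c0; rewrite (H c) ?eqxx //; split; first by exists k'.
  by move=> y fy; apply/eqP/negPn/negP => /Hc.
case: (@conn S1 S2) => [F []|F []|p|p [/Z1 A /Z2 B]|H|H].
- by [].
- by [].
- by case: (pselect (fo p)) => [/Z2|/Z1]; [right|left].
- by case: (A B).
- right=> p; have /Z1 np := H p; case: (order_alt p hG) => // /(_ 1%N).
  exact: vge1_eq0.
- by left=> p; apply/Z2.
Qed.

Definition nonzero G := exists p : P, G p != 0.

Lemma order_ex k G p : fm k G -> nonzero G -> exists n, veq p n k G.
Proof.
move=> hG [q Gq]; case: (order_dichotomy hG) => [/(_ p) //|/(_ q) e].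
by rewrite e eqxx in Gq.
Qed.

Lemma fm_domain k m G H : fm k G -> fm m H -> nonzero G -> (forall y, G y * H y = 0) ->
  forall y, H y = 0.
Proof.
move=> hG hH nG E y; apply: (finite_order_nonzerodiv hG hH); [by move=> y' _|exact: order_ex].
Qed.

(** Multiples of G vanish along Z, so forms with independent jets along Z are independent modulo G,
    and [growth] bounds their number. *)
Lemma bezout k G Z : fm k G -> nonzero G -> zfun Z k G -> (size Z <= D0 * k)%N.
Proof.
move=> hG nG GZ; have [m0 Hm0] := jets_independent Z.
apply: (growth (U := fun=> True) (m0 := m0) hG).
  by move=> m H hH E y _; apply: (fm_domain hG hH nG) => y'; apply: E.
move=> m m0m; have [|w [hw iw]] := Hm0 (m + k)%N; first by lia.
exists w; split=> // c H hH E; apply: iw => q.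
rewrite (_ : (fun y => _) = (fun y => G y * H y)); last by apply/funext => y; apply: E.
by have := vgeM (GZ q) (vge0 q hH); rewrite addn0 addnC.
Qed.

Lemma points_infinite (l : seq P) : exists p, p \notin l.
Proof.
have [|k [c [hc c0 cl]]] := @avoid_points pt0 [seq q <- l | q != pt0].
  by rewrite mem_filter eqxx.
have [y yp cy] := noniso (nbhd_form hc c0); exists y; apply: contra cy => yl.
by rewrite cl // mem_filter yp.
Qed.

Lemma fm_cofin k G : fm k G -> nonzero G -> cofin (fun y => G y != 0).
Proof.
move=> hG nG; apply: contrapT => ncf.
have H n : exists Z : seq P, [/\ uniq Z, size Z = n & forall q, q \in Z -> G q = 0].
  elim: n => [|n [Z [uZ sZ HZ]]]; first by exists [::].
  have [q qZ Gq] : exists2 q, q \notin Z & G q = 0.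
    apply: contrapT => Hq; apply: ncf; exists Z => y yZ; apply/negP => /eqP Gy.
    by apply: Hq; exists y.
  exists (q :: Z); split; rewrite /= ?qZ ?sZ //.
  by move=> q'; rewrite inE => /orP[/eqP->|/HZ].
have [Z [uZ sZ HZ]] := H (D0 * k).+1.
suff : (size Z <= D0 * k)%N by rewrite sZ ltnn.
apply: (bezout hG nG) => q; rewrite count_uniq_mem //.
have [qZ|_] := boolP (q \in Z); last exact: vge0.
by apply: vge1 => //; apply: HZ.
Qed.

Lemma fm_cofin_eq0 k G : fm k G -> cofin (fun y => G y = 0) -> forall y, G y = 0.
Proof.
move=> hG [l Hl] y; apply/eqP/negPn/negP => Gy.
have [m Hm] := fm_cofin hG (ex_intro _ y Gy).
have [p] := points_infinite (l ++ m); rewrite mem_cat negb_or => /andP[/Hl e /Hm].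
by rewrite e eqxx.
Qed.

Lemma nonzeroM k m G H : fm k G -> fm m H -> nonzero G -> nonzero H -> nonzero (fun y => G y * H y).
Proof.
move=> hG hH nG [q Hq]; apply: contrapT => H0.
move: Hq; rewrite (fm_domain hG hH nG _) ?eqxx // => y.
by apply/eqP/negPn/negP => e; apply: H0; exists y.
Qed.

Definition frat (f : P -> K) := exists k s t,
  [/\ fm k s, fm k t, nonzero t & cofin (fun y => f y * t y = s y)].
Definition fhv p (f : P -> K) (v : K) := exists k s t,
  [/\ fm k s, fm k t, t p != 0, s p = v * t p & cofin (fun y => f y * t y = s y)].

Lemma fhv_frat p f v : fhv p f v -> frat f.
Proof. by move=> [k [s [t [hs ht t0 _ e]]]]; exists k, s, t; split=> //; exists p. Qed.

Lemma frat_inv f : frat f -> frat (fun y => (f y)^-1).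
Proof.
move=> [k [s [t [hs ht nt e]]]]; have tc := fm_cofin ht nt.
have [ns|s0] := pselect (nonzero s).
  exists k, t, s; split=> //; apply: cofin_sub (cofin_and e (cofin_and tc (fm_cofin hs ns))) _.
  move=> y [<- [t0 s0]]; rewrite mulrA mulVf ?mul1r //.
  by apply: contra s0 => /eqP ->; rewrite mul0r.
exists k, (fun=> 0), t; split=> //; first exact: fm0.
apply: cofin_sub (cofin_and e tc) _ => y [ey t0].
have /eqP : f y * t y = 0 by rewrite ey; apply/eqP/negPn/negP => sy; apply: s0; exists y.
by rewrite mulf_eq0 (negbTE t0) orbF => /eqP ->; rewrite invr0 mul0r.
Qed.

Lemma frat_zero f : frat f -> cofin (fun y => f y = 0) \/ cofin (fun y => f y != 0).
Proof.
move=> [k [s [t [hs ht nt e]]]]; have tc := fm_cofin ht nt.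
have [ns|s0] := pselect (nonzero s); [right|left].
  apply: cofin_sub (cofin_and e (fm_cofin hs ns)) _ => y [<-].
  by rewrite mulf_eq0 negb_or => /andP[].
apply: cofin_sub (cofin_and e tc) _ => y [ey t0].
have /eqP : f y * t y = 0 by rewrite ey; apply/eqP/negPn/negP => sy; apply: s0; exists y.
by rewrite mulf_eq0 (negbTE t0) orbF => /eqP.
Qed.

Lemma frat_add f f' : frat f -> frat f' -> frat (fun y => f y + f' y).
Proof.
move=> [k [s [t [hs ht nt e]]]] [k' [s' [t' [hs' ht' nt' e']]]].
exists (k + k')%N, (fun y => s y * t' y + s' y * t y), (fun y => t y * t' y); split.
- by apply: fm_add; [exact: fm_mul|rewrite addnC; apply: fm_mul].
- exact: fm_mul.
- exact: nonzeroM ht ht' nt nt'.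
- by apply: cofin_sub (cofin_and e e') _ => y [<- <-]; ring.
Qed.

Lemma frat_mul f f' : frat f -> frat f' -> frat (fun y => f y * f' y).
Proof.
move=> [k [s [t [hs ht nt e]]]] [k' [s' [t' [hs' ht' nt' e']]]].
exists (k + k')%N, (fun y => s y * s' y), (fun y => t y * t' y); split.
- exact: fm_mul.
- exact: fm_mul.
- exact: nonzeroM ht ht' nt nt'.
- by apply: cofin_sub (cofin_and e e') _ => y [<- <-]; ring.
Qed.

Lemma fhv_const p c : fhv p (fun=> c) c.
Proof.
exists 0%N, (fun=> c), (fun=> 1); split; try exact: fm_const.
- exact: oner_neq0.
- by rewrite mulr1.
- by apply: cofin_all => y; rewrite mulr1.
Qed.

Lemma fhv_add p f f' v v' : fhv p f v -> fhv p f' v' -> fhv p (fun y => f y + f' y) (v + v').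
Proof.
move=> [k [s [t [hs ht nt ev e]]]] [k' [s' [t' [hs' ht' nt' ev' e']]]].
exists (k + k')%N, (fun y => s y * t' y + s' y * t y), (fun y => t y * t' y); split.
- by apply: fm_add; [exact: fm_mul|rewrite addnC; apply: fm_mul].
- exact: fm_mul.
- by rewrite mulf_neq0.
- by rewrite ev ev'; ring.
- by apply: cofin_sub (cofin_and e e') _ => y [<- <-]; ring.
Qed.

Lemma fhv_mul p f f' v v' : fhv p f v -> fhv p f' v' -> fhv p (fun y => f y * f' y) (v * v').
Proof.
move=> [k [s [t [hs ht nt ev e]]]] [k' [s' [t' [hs' ht' nt' ev' e']]]].
exists (k + k')%N, (fun y => s y * s' y), (fun y => t y * t' y); split.
- exact: fm_mul.
- exact: fm_mul.
- by rewrite mulf_neq0.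
- by rewrite ev ev'; ring.
- by apply: cofin_sub (cofin_and e e') _ => y [<- <-]; ring.
Qed.

Lemma fhv_inv p f v : fhv p f v -> v != 0 -> fhv p (fun y => (f y)^-1) v^-1.
Proof.
move=> [k [s [t [hs ht nt ev e]]]] v0; exists k, t, s; split=> //.
- by rewrite ev mulf_neq0.
- by rewrite ev mulKf.
have sp : nonzero s by exists p; rewrite ev mulf_neq0.
apply: cofin_sub (cofin_and e (fm_cofin hs sp)) _ => y [<-] s0.
rewrite mulKf //; apply: contra s0 => /eqP ->; by rewrite mul0r.
Qed.

Lemma frat_ae f f' : frat f -> cofin (fun y => f y = f' y) -> frat f'.
Proof.
move=> [k [s [t [hs ht nt e]]]] E; exists k, s, t; split=> //.
by apply: cofin_sub (cofin_and e E) _ => y [<- ->].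
Qed.

Lemma fhv_ae p f f' v : fhv p f v -> cofin (fun y => f y = f' y) -> fhv p f' v.
Proof.
move=> [k [s [t [hs ht nt ev e]]]] E; exists k, s, t; split=> //.
by apply: cofin_sub (cofin_and e E) _ => y [<- ->].
Qed.

Lemma frac_eq f k k' s t s' t' : fm k s -> fm k t -> fm k' s' -> fm k' t' ->
  cofin (fun y => f y * t y = s y) -> cofin (fun y => f y * t' y = s' y) ->
  forall y, s y * t' y = s' y * t y.
Proof.
move=> hs ht hs' ht' e e' y; apply/eqP; rewrite -subr_eq0; apply/eqP.
apply: (@fm_cofin_eq0 (k + k') (fun y => s y * t' y - s' y * t y)).
  by apply: fm_sub; [exact: fm_mul|rewrite addnC; apply: fm_mul].
by apply: cofin_sub (cofin_and e e') _ => z [<- <-]; ring.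
Qed.

Lemma fhv_uniq p f v v' : fhv p f v -> fhv p f v' -> v = v'.
Proof.
move=> [k [s [t [hs ht t0 ev e]]]] [k' [s' [t' [hs' ht' t0' ev' e']]]].
have := frac_eq hs ht hs' ht' e e' p; rewrite ev ev' => E.
by apply: (mulIf t0); apply: (mulIf t0'); rewrite E; ring.
Qed.

Lemma fhv_generic f : frat f -> cofin (fun y => fhv y f (f y)).
Proof.
move=> [k [s [t [hs ht nt e]]]].
by apply: cofin_sub (cofin_and e (fm_cofin ht nt)) _ => y [ey ty]; exists k, s, t; split.
Qed.

Definition funif p y := a p y / b p y.

Let b_cofin p : cofin (fun y => b p y != 0).
Proof. by have [_ hb _ b0 _] := hunif p; apply: (fm_cofin hb); exists p. Qed.

Lemma fhv_unif p : fhv p (funif p) 0.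
Proof.
have [h1 hb ap b0 _] := hunif p; exists (ka p), (a p), (b p); split=> //.
  by rewrite ap mul0r.
by apply: cofin_sub (b_cofin p) _ => y by0; rewrite /funif mulfVK.
Qed.

Lemma a_nonzero p : nonzero (a p).
Proof.
have [|y [_ ay _]] := @a_dense p (fun=> True); last by exists y.
by exists 0%N, (fun=> 1); split=> //; [exact: fm_const|exact: oner_neq0].
Qed.

Lemma funif_ne0 p : cofin (fun y => funif p y != 0).
Proof.
apply: cofin_sub (cofin_and (fm_cofin (ha p) (a_nonzero p)) (b_cofin p)) _ => y [ay by0].
by rewrite mulf_neq0 // invr_eq0.
Qed.

Lemma ford_frac p f k s t n1 n2 : fm k s -> fm k t -> nonzero t ->
  cofin (fun y => f y * t y = s y) -> veq p n1 k s -> veq p n2 k t ->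
  exists v, v != 0 /\ fhv p (fun y => f y * funif p y ^ (- (n1%:Z - n2%:Z))) v.
Proof.
move=> hs ht nt e [j [c [j' [H [hc c0 [hH H0] d E]]]]] [i [c' [i' [H' [hc' c0' [hH' H0'] d' E']]]]].
have [_ hb _ b0 _] := hunif p.
pose S y := H y * c' y * b p y ^+ n1.
pose T y := H' y * c y * b p y ^+ n2.
have S0 : S p != 0 by rewrite !mulf_neq0 // expf_neq0.
have T0 : T p != 0 by rewrite !mulf_neq0 // expf_neq0.
exists (S p / T p); split; first by rewrite mulf_neq0 // invr_eq0.
exists (j' + i + n1 * ka p)%N, S, T; split=> //.
- by apply: fm_mul (fm_mul hH hc') (fm_exp _ hb).
- by apply: fm_eqdeg (fm_mul (fm_mul hH' hc) (fm_exp _ hb)) _; lia.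
- by rewrite mulfVK.
have C1 := cofin_and e (cofin_and (fm_cofin (ha p) (a_nonzero p)) (b_cofin p)).
have C2 := cofin_and (fm_cofin ht nt) (cofin_and (fm_cofin hc (ex_intro _ p c0)) (fm_cofin hc' (ex_intro _ p c0'))).
apply: cofin_sub (cofin_and C1 C2) _ => y [[ey [ay by0]] [ty [cy cy']]].
have tE : t y = H' y * a p y ^+ n2 / c' y by rewrite -E' mulfK.
have fE : f y = H y * a p y ^+ n1 / c y / t y by rewrite -E mulfK // -ey mulfK.
have H'y : H' y != 0 by apply: contra ty => /eqP h; rewrite tE h !mul0r.
rewrite fE tE opprB expfzDr; last by rewrite mulf_neq0 // invr_eq0.
rewrite -invr_expz -!exprnP /S /T /funif !expr_div_n; field.
by rewrite cy H'y cy' !expf_neq0.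
Qed.

Lemma ford_exists p f : frat f -> ~ cofin (fun y => f y = 0) ->
  exists (n : int) v, v != 0 /\ fhv p (fun y => f y * funif p y ^ (- n)) v.
Proof.
move=> [k [s [t [hs ht nt e]]]] f0.
have ns : nonzero s.
  apply: contrapT => s0; apply: f0; apply: cofin_sub (cofin_and e (fm_cofin ht nt)) _ => y [ey t0].
  have /eqP : f y * t y = 0 by rewrite ey; apply/eqP/negPn/negP => sy; apply: s0; exists y.
  by rewrite mulf_eq0 (negbTE t0) orbF => /eqP.
have [n1 H1] := order_ex p hs ns; have [n2 H2] := order_ex p ht nt.
by have [v Hv] := ford_frac hs ht nt e H1 H2; exists (n1%:Z - n2%:Z), v.
Qed.

Hypothesis closed_pts : forall xi : 'I_N.+1 -> K, (exists i, xi i != 0) ->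
  (forall k Q, Q \is k.-homog -> (forall y, Q.@[x y] = 0) -> Q.@[xi] = 0) ->
  exists y c, forall i, xi i = c * x y i.

Section Liouville.
Variables (z : P -> K).
Hypothesis hz : forall p, fhv p z (z p).

(** The homogeneous ideal of denominators of z. The aim is that it contains all forms of large
    degree, so that z acts on them. *)
Definition denom k t := fm k t /\ exists2 s, fm k s & forall y, z y * t y = s y.

Lemma denom_ex p : exists k t, denom k t /\ t p != 0.
Proof.
have [k [s [t [hs ht t0 ev e]]]] := hz p; exists k, t; split=> //; split=> //.
exists s => // y; have [k' [s' [t' [hs' ht' t0' ev' e']]]] := hz y.
apply: (mulIf t0'); have := frac_eq hs ht hs' ht' e e' y; rewrite ev' => ->; ring.
Qed.

Lemma denom_add k t t' : denom k t -> denom k t' -> denom k (fun y => t y + t' y).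
Proof.
move=> [ht [s hs E]] [ht' [s' hs' E']]; split; first exact: fm_add.
by exists (fun y => s y + s' y) => [|y]; [exact: fm_add|rewrite mulrDr E E'].
Qed.

Lemma denom_mul k m t w : denom k t -> fm m w -> denom (k + m) (fun y => t y * w y).
Proof.
move=> [ht [s hs E]] hw; split; first exact: fm_mul.
by exists (fun y => s y * w y) => [|y]; [exact: fm_mul|rewrite mulrA E].
Qed.

Lemma denom_ext k t t' : denom k t -> t =1 t' -> denom k t'.
Proof. by move=> h /funext <-. Qed.

Lemma denom0 k : denom k (fun=> 0).
Proof.
split; first exact: fm0.
by exists (fun=> 0) => [|y]; [exact: fm0|rewrite mulr0].
Qed.

Section Chart.
Variable i : 'I_N.+1.

Definition aff y j := x y j / x y i.

Lemma homogenize Q : exists n0, forall n, (n0 <= n)%N -> exists2 F, fm n F &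
  forall y, x y i != 0 -> F y = x y i ^+ n * Q.@[aff y].
Proof.
elim/mpoly_ring_ind: Q => [c|j|Q Q' [n Hn] [n' Hn']|Q Q' [n Hn] [n' Hn']].
- exists 0%N => n _; exists (fun y => c * x y i ^+ n).
    exact/fm_scale/fm_coordX.
  by move=> y _; rewrite mevalC mulrC.
- exists 1%N => -[//|n] _; exists (fun y => x y j * x y i ^+ n).
    exact: fm_mul (fm_coord j) (fm_coordX i n).
  by move=> y xy; rewrite mevalXU exprS /aff; field.
- exists (maxn n n') => m; rewrite geq_max => /andP[/Hn[F hF EF] /Hn'[F' hF' EF']].
  exists (fun y => F y + F' y); first exact: fm_add.
  by move=> y xy; rewrite mevalD mulrDr EF // EF'.
- exists (n + n')%N => m nm; have [|F hF EF] := Hn (m - n')%N; first by lia.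
  have [|F' hF' EF'] := Hn' n'; first by [].
  exists (fun y => F y * F' y); first by apply: fm_eqdeg (fm_mul hF hF') _; lia.
  move=> y xy; rewrite mevalM EF // EF' // mulrACA -exprD; congr (_ ^+ _ * _); lia.
Qed.

(** The dehomogenized denominators, an ideal to which the affine [ideal_point] applies. *)
Definition denom_ideal Q := exists n t, denom n t /\
  forall y, x y i != 0 -> t y = x y i ^+ n * Q.@[aff y].

Lemma denom_idealP : is_ideal denom_ideal.
Proof.
split.
- exists 0%N, (fun=> 0); split; first exact: denom0.
  by move=> y _; rewrite meval0 mulr0.
- move=> Q R [n [t [dt E]]] [n' [t' [dt' E']]].
  exists (n + n')%N, (fun y => t y * x y i ^+ n' + t' y * x y i ^+ n); split.
    apply: denom_add; first exact: denom_mul dt (fm_coordX i n').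
    by rewrite addnC; apply: denom_mul dt' (fm_coordX i n).
  by move=> y xy; rewrite E // E' // mevalD exprD; ring.
- move=> Q R [n [t [dt E]]]; have [m /(_ m (leqnn m))[F hF EF]] := homogenize R.
  exists (n + m)%N, (fun y => t y * F y); split; first exact: denom_mul.
  by move=> y xy; rewrite E // EF // mevalM exprD; ring.
Qed.

(** For a single denominator G, polynomials independent modulo all denominators are independent
    modulo the multiples of G, whose codimension [growth] bounds. *)
Lemma denom_ideal_codim : exists c, codim_lt denom_ideal c.
Proof.
have [k [G [dG Gp]]] := denom_ex pt0; have [hG _] := dG.
exists (D0 * k).+1 => Q; apply: contrapT => H.
have {}H (l : 'I_(D0 * k).+1 -> K) : denom_ideal (\sum_j l j *: Q j) -> forall j, l j = 0.
  move=> Hl j; apply/eqP/negPn/negP => lj; apply: H; exists l => //; by exists j.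
suff : ((D0 * k).+1 <= D0 * k)%N by rewrite ltnn.
have /choice[n0 Hn0] := fun j => homogenize (Q j).
apply: (growth (U := fun=> True) (m0 := \max_j n0 j) hG).
  by move=> m H' hH' E y _; apply: (fm_domain hG hH' (ex_intro _ pt0 Gp : nonzero G)) => y'; apply: E.
move=> m nm.
have /choice[w Hw] : forall j, exists F, fm (m + k) F /\
    forall y, x y i != 0 -> F y = x y i ^+ (m + k) * (Q j).@[aff y].
  move=> j; have [|F hF EF] := Hn0 j (m + k)%N; last by exists F.
  by have : (n0 j <= \max_j n0 j)%N := leq_bigmax j; lia.
exists w; split; first by move=> j; case: (Hw j).
move=> l H' hH' E; apply: H; exists (k + m)%N, (fun y => G y * H' y); split.
  exact: denom_mul.
move=> y xy; rewrite -E // raddf_sum mulr_sumr; apply: eq_bigr => j _.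
by have [_ ->] := Hw j; rewrite //= mevalZ addnC; ring.
Qed.

(** Otherwise the ideal of denominators is proper and has a common zero. That zero lies on the
    curve, because the equations of the curve belong to the ideal; but at every point of the curve
    some denominator is nonzero. *)
Lemma coord_denom : exists n, denom n (fun y => x y i ^+ n).
Proof.
apply: contrapT => nd; have [c Ic] := denom_ideal_codim.
have nzi : nonzero (fun y => x y i).
  apply: contrapT => zi; apply: nd; exists 1%N; apply: denom_ext (denom0 1) _ => y.
  by rewrite expr1; apply/esym/eqP/negPn/negP => xy; apply: zi; exists y.
have n1 : ~ denom_ideal 1.
  move=> [n [t [dt E]]]; have [ht _] := dt; apply: nd; exists n; apply: denom_ext dt _ => y.
  apply/eqP; rewrite -subr_eq0; apply/eqP.
  apply: (@fm_cofin_eq0 n (fun y => t y - x y i ^+ n)).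
    exact: fm_sub ht (fm_coordX i n).
  apply: cofin_sub (fm_cofin (fm_coord i) nzi) _ => y' xy.
  by rewrite E // meval1 mulr1 subrr.
have [xi Hxi] := ideal_point denom_idealP n1 Ic.
have xi1 : xi i = 1.
  apply/eqP; rewrite -subr_eq0; apply/eqP.
  have := Hxi ('X_i - 1); rewrite mevalB mevalXU meval1; apply.
  exists 0%N, (fun=> 0); split; first exact: denom0.
  by move=> y xy; rewrite mevalB mevalXU meval1 /aff divff // subrr mulr0.
have hom k Q y : Q \is k.-homog -> x y i != 0 -> Q.@[x y] = x y i ^+ k * Q.@[aff y].
  move=> hQ xy; rewrite !mevalE mulr_sumr; apply: eq_big_seq => m mQ.
  rewrite mulrCA; congr (_ * _); rewrite -(dhomog_mf hQ mQ) /= mdegE -prodrXr -big_split /=.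
  by apply: eq_bigr => j _; rewrite -exprMn /aff mulrC mulfVK.
have [||y [c0 Ey]] := closed_pts (xi := xi).
- by exists i; rewrite xi1 oner_neq0.
- move=> k Q hQ QP; apply: Hxi; exists k, (fun=> 0); split; first exact: denom0.
  by move=> y xy; rewrite -hom // QP.
have [k [t [dt ty]]] := denom_ex y; have [[T hT ET] _] := dt.
have : T.@[xi] = 0.
  by apply: Hxi; exists k, t; split=> // y' xy; rewrite ET -hom.
have xy0 : x y i != 0.
  by apply/eqP => e; have := Ey i; rewrite e mulr0 xi1 => /eqP; rewrite oner_eq0.
have c0E : c0 = (x y i)^-1 by apply: (mulIf xy0); rewrite -Ey xi1 mulVf.
have -> : T.@[xi] = T.@[aff y] by apply: meval_eq => j; rewrite Ey c0E mulrC.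
move=> e; move: ty; rewrite ET (hom _ _ _ hT xy0) e mulr0 eqxx //.
Qed.

End Chart.

Lemma fm_monomial (m : 'I_N.+1 -> nat) : fm (\sum_j m j) (fun y => \prod_j x y j ^+ m j).
Proof.
elim: (index_enum _) => [|j r IH].
  by rewrite big_nil; apply: fm_ext (fm_const 1) _ => y; rewrite big_nil.
rewrite big_cons; apply: fm_ext (fm_mul (fm_coordX j (m j)) IH) _ => y.
by rewrite big_cons.
Qed.

(** A monomial of degree at least (N + 1) E has some exponent as large as E, hence is divisible by a
    power of a coordinate that is a denominator. *)
Lemma all_denom : exists n0, forall n, (n0 <= n)%N -> forall F, fm n F -> denom n F.
Proof.
have /choice[e He] := coord_denom.
pose E := \max_i e i; exists (N.+1 * E)%N => n nE F [Q hQ EQ].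
apply: denom_ext (fun y => esym (EQ y)).
have Hm (m : 'X_{1..N.+1}) : mdeg m = n -> denom n (fun y => \prod_j x y j ^+ m j).
  rewrite mdegE => dm; have [i Hi] : exists i, (e i <= m i)%N.
    apply: contrapT => H.
    have lt j : (m j < E)%N.
      apply: leq_trans (leq_bigmax j); rewrite ltnNge; apply/negP => le.
      by apply: H; exists j.
    have : (\sum_j m j < \sum_(j < N.+1) E)%N.
      apply: (@leq_trans (\sum_(j < N.+1) (m j + 1))).
        by rewrite big_split sum_nat_const card_ord /=; lia.
      by apply: leq_sum => j _; rewrite addn1.
    by rewrite sum_nat_const card_ord dm; lia.
  pose m' j := if j == i then (m i - e i)%N else m j.
  have dm' : (e i + \sum_j m' j)%N = n.
    rewrite -dm (bigD1 i) //= [RHS](bigD1 i) //= /m' eqxx addnA subnKC //; congr (_ + _)%N.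
    by apply: eq_bigr => j /negbTE ->.
  rewrite -dm'; apply: denom_ext (denom_mul (He i) (fm_monomial m')) _ => y.
  rewrite (bigD1 i) //= [RHS](bigD1 i) //= /m' eqxx mulrA -exprD subnKC //; congr (_ * _).
  by apply: eq_bigr => j /negbTE ->.
apply: (@denom_ext _ (fun y => \sum_(m <- msupp Q) Q@_m * \prod_j x y j ^+ m j)); last first.
  by move=> y; rewrite mevalE.
have := dhomog_mf hQ; elim: (msupp Q) => [|m r IH] Hr.
  by apply: denom_ext (denom0 n) _ => y; rewrite big_nil.
apply: (@denom_ext _ (fun y => Q@_m * \prod_j x y j ^+ m j +
    \sum_(m <- r) Q@_m * \prod_j x y j ^+ m j)); last by move=> y; rewrite big_cons.
apply: denom_add; last by apply: IH => m' m'r; apply: Hr; rewrite inE m'r orbT.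
have := denom_mul (Hm m (Hr m (mem_head _ _))) (fm_const Q@_m); rewrite addn0.
by move/denom_ext; apply => y; rewrite mulrC.
Qed.

(* Multiplication by z preserves the finite-dimensional space of forms of large
   degree, so z only takes the eigenvalues of this endomorphism. *)
Lemma fliouville : exists c, cofin (fun y => z y = c).
Proof.
have [n0 Hn0] := all_denom; pose n := maxn n0 k0.
have [|h [s [hs ibs bs]] _] := hilb (k := n); first by rewrite /n; lia.
have /choice[A HA] : forall i, exists c : 'I_h -> K, forall y, z y * s i y = \sum_j c j * s j y.
  move=> i; have [|_ [t ht E]] := Hn0 n _ (s i) (hs i); first by rewrite /n; lia.
  by have [c Hc] := bs _ ht; exists c => y; rewrite E Hc.
pose M := \matrix_(j, i) A i j.
have rt y : root (char_poly M) (z y).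
  rewrite -eigenvalue_root_char; apply/eigenvalueP; exists (\row_j s j y).
    apply/rowP => i; rewrite !mxE HA; apply: eq_bigr => j _.
    by rewrite !mxE mulrC.
  apply/eqP => /rowP v0; have [l xl] := x_ne0 y.
  have [c Hc] := bs _ (fm_coordX l n); have := Hc y.
  rewrite big1 => [/eqP|j _]; first by rewrite expf_eq0 (negbTE xl) andbF.
  by have := v0 j; rewrite !mxE => ->; rewrite mulr0.
have P0 : char_poly M != 0 by rewrite monic_neq0 // char_poly_monic.
have [rs ers] := closed_field_poly_normal (char_poly M).
have zrs y : z y \in rs.
  have := rt y; rewrite ers rootZ ?lead_coef_eq0 // root_prod_XsubC.
  by [].
apply: contrapT => nc.
have H c : cofin (fun y => z y != c).
  have rz : frat (fun y => z y - c).
    apply: frat_ae (frat_add (fhv_frat (hz pt0)) (fhv_frat (fhv_const pt0 (- c)))) _.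
    exact: cofin_all.
  case: (frat_zero rz) => [E|E].
    by case: nc; exists c; apply: cofin_sub E _ => y /eqP; rewrite subr_eq0 => /eqP.
  by apply: cofin_sub E _ => y; rewrite subr_eq0.
have {}H : cofin (fun y => z y \notin rs).
  elim: (rs) => [|c r IH]; first exact: cofin_all.
  by apply: cofin_sub (cofin_and (H c) IH) _ => y [A1 A2]; rewrite inE negb_or A1.
have [l Hl] := H; have [p /Hl] := points_infinite l.
by rewrite zrs.
Qed.

End Liouville.

Lemma fm_liouville f : frat f -> (forall p, exists v, fhv p f v) ->
  exists c, cofin (fun y => f y = c).
Proof.
move=> rf /choice[z Hz].
have e : cofin (fun y => f y = z y).
  by apply: cofin_sub (fhv_generic rf) _ => y hy; apply: fhv_uniq hy (Hz y).
have [|c Hc] := @fliouville z; first by move=> p; apply: fhv_ae (Hz p) e.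
by exists c; apply: cofin_sub (cofin_and e Hc) _ => y [->].
Qed.

Definition form_curve : abs_curve K :=
  AbsCurve points_infinite frat_inv frat_zero fhv_frat frat_add frat_mul fhv_const fhv_add
    fhv_mul fhv_inv frat_ae fhv_ae fhv_uniq fhv_generic fhv_unif funif_ne0 ford_exists fm_liouville.

Lemma order_frac p (f : form_curve -> K) k s t n1 n2 : fm k s -> fm k t -> nonzero t ->
  cofin (fun y => f y * t y = s y) -> veq p n1 k s -> veq p n2 k t ->
  ordeq (X := form_curve) p (n1%:Z - n2%:Z) f.
Proof.
move=> hs ht nt e H1 H2; have [v [v0 Hv]] := ford_frac hs ht nt e H1 H2.
by exists v.
Qed.

Lemma indep_sub (X : abs_curve K) n m (w : 'I_m -> X -> K) (nm : (n <= m)%N) : indep w ->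
  indep (fun i : 'I_n => w (widen_ord nm i)).
Proof.
move=> iw c Hc i.
pose c' (j : 'I_m) := if insub (val j) is Some i' then c i' else 0.
have := iw c' _ (widen_ord nm i); rewrite /c' /= valK; apply.
apply: cofin_sub Hc _ => y Hy; rewrite -[RHS]Hy.
rewrite (bigID (fun j : 'I_m => (j < n)%N)) /= [X in _ + X]big1 ?addr0; last first.
  by move=> j nj; rewrite insubN ?mul0r.
rewrite (reindex_omap (widen_ord nm) (fun j : 'I_m => insub (val j))) /=; last first.
  by move=> j jn; rewrite insubT /=; congr Some; apply: val_inj.
apply: eq_big => [j|j _]; first by rewrite valK ltn_ord eqxx.
by rewrite valK.
Qed.

Lemma degree_pos : (0 < D0)%N.
Proof.
have [q] := points_infinite [:: pt0]; rewrite inE => nq.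
have [L hL [Lq Lp]] := lin_separate nq.
have := @bezout 1 L [:: q] hL (ex_intro _ pt0 Lp); rewrite muln1; apply => p /=.
by rewrite addn0; have [<-|_] := eqVneq q p; [apply: vge1|apply: vge0].
Qed.

(* The residual divisor E of D in the zeros of a form G has degree at most
   D0 k - deg D, and the forms of degree k vanishing on E give L(D) after division by G. *)
Theorem form_curve_riemann : riemann_ineq form_curve g.
Proof.
(* Large enough for the Hilbert polynomial to be valid and for a nonzero form of degree k to vanish
   along D. *)
move=> D; pose k := (k0 + size D + g + 1)%N.
have [|h [s [hs ibs _]] eh] := hilb (k := k); first by rewrite /k; lia.
have hD : (size D < h)%N.
  have : (k <= D0 * k)%N by rewrite leq_pmull // degree_pos.
  by rewrite /k in eh *; lia.
have [l xl] := x_ne0 pt0; pose L y := x y l ^+ k.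
have hL : fm k L := fm_coordX l k.
have nL : nonzero L by exists pt0; rewrite expf_neq0.
have /choice[oL HoL] := fun p => order_ex p hL nL.
have L0 := fm_cofin hL nL.
pose w (i : 'I_h) : form_curve -> K := fun y => s i y / L y.
have iw : indep w.
  move=> c Hc; apply: ibs => y; apply: (@fm_cofin_eq0 k (fun y => \sum_i c i * s i y)).
    by apply: fm_sum => i; apply: fm_scale.
  apply: cofin_sub (cofin_and Hc L0) _ => y' [E L'].
  apply: (mulIf (x := (L y')^-1)); rewrite ?invr_eq0 // mul0r -[RHS]E mulr_suml.
  by apply: eq_bigr => i _; rewrite /w mulrA.
pose S (f : form_curve -> K) := exists2 F, fm k F & f = (fun y => F y / L y).
have Scl : lin_closed S.
  move=> f f' e [F hF ->] [F' hF' ->]; exists (fun y => F y - e * F' y).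
    exact/fm_sub/fm_scale.
  by apply/funext => y; ring.
have Sw i : S (w i) by exists (s i).
have SordE (F : P -> K) p n : fm k F -> veq p n k F ->
    ordeq (X := form_curve) p (n%:Z - (oL p)%:Z) (fun y => F y / L y).
  move=> hF Fn; apply: order_frac hF hL nL _ Fn (HoL p).
  by apply: cofin_sub L0 _ => y L'; rewrite divfK.
have Sord f : S f -> ordge_fun (X := form_curve) (fun p => - (oL p)%:Z) f.
  move=> [F hF ->] p; have [nF|zF] := pselect (nonzero F).
    have [n Hn] := order_ex p hF nF.
    by apply: ordge_le (ordeq_ge (SordE F p n hF Hn)); lia.
  apply: ae0_ordge.
    exists k, F, L; split=> //; apply: cofin_sub L0 _ => y L'; by rewrite divfK.
  apply: cofin_all => y; have -> : F y = 0 by apply/eqP/negPn/negP => Fy; apply: zF; exists y.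
  by rewrite mul0r.
have [w1 [iw1 Sw1 ow1]] := indep_codim D Scl iw Sw (fun i => Sord _ (Sw i)).
have hD0 : (0 < h - size D)%N by rewrite subn_gt0.
pose i1 := Ordinal hD0.
have [G hG eG] := Sw1 i1.
have nG : nonzero G.
  apply: contrapT => zG.
  have : (1 : K) = 0.
    have := iw1 (fun i => (i == i1)%:R) _ i1; rewrite eqxx; apply.
    apply: cofin_all => y; rewrite big1 // => i _.
    have [->|_] := eqVneq i i1; last by rewrite mul0r.
    rewrite eG; have -> : G y = 0 by apply/eqP/negPn/negP => Gy; apply: zG; exists y.
    by rewrite mul0r mulr0.
  by move/eqP; rewrite oner_eq0.
have /choice[oG HoG] := fun p => order_ex p hG nG.
have DoG p : (count_mem p D <= oG p)%N.
  have := ow1 i1 p; rewrite eG => /ordge_eq_le/(_ (SordE G p _ hG (HoG p))).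
  by rewrite addrC lerD2r.
have G0 := fm_cofin hG nG.
have [|Z HZ] := @finsupp_seq K form_curve oG.
  by apply: cofin_sub G0 _ => y Gy; apply: veq_uniq (HoG y) _; apply: veq0.
have [|E HE] := @finsupp_seq K form_curve (fun p => oG p - count_mem p D)%N.
  by apply: cofin_sub G0 _ => y Gy; have -> : oG y = 0%N by apply: veq_uniq (HoG y) _; apply: veq0.
have sZ : (size Z <= D0 * k)%N.
  by apply: (bezout hG nG) => p; rewrite HZ; apply: veq_vge.
have sE : (size D + size E = size Z)%N.
  rewrite -size_cat; apply/perm_size/allP => p _ /=.
  by rewrite count_cat HZ HE subnKC.
have [w2 [iw2 Sw2 ow2]] := indep_codim E Scl iw Sw (fun i => Sord _ (Sw i)).
pose q : form_curve -> K := fun y => L y / G y.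
have oq p : ordeq (X := form_curve) p ((oL p)%:Z - (oG p)%:Z) q.
  by apply: order_frac hL hG nG _ (HoL p) (HoG p); apply: cofin_sub G0 _ => y Gy; rewrite divfK.
(* h - deg E = D0 k + 1 - g - (deg Z - deg D), and deg Z <= D0 k. *)
have nm : ((size D).+1 - g <= h - size E)%N by lia.
have iw3 := indep_mul (ordeq_rat (oq pt0)) (ordeq_not0 (oq pt0)) (fun i => ordge_rat (ow2 i pt0)) iw2.
exists (fun i y => w2 (widen_ord nm i) y * q y); first exact: (indep_sub (nm := nm) iw3).
move=> i p; have := ordgeM (ow2 (widen_ord nm i) p) (ordeq_ge (oq p)).
apply: ordge_le; rewrite /= HE -subzn //; lia.
Qed.

(** Dividing numerator and denominator by x_i^k turns a quotient of forms of degree k into a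
    quotient of polynomials in the affine coordinates, with denominator nonzero at p. *)
Lemma aff_generates p i : x p i != 0 ->
  generates (X := form_curve) p (fun j y => aff i y j).
Proof.
move=> xi; split.
  move=> j; exists (x p j / x p i), 1%N, (fun y => x y j), (fun y => x y i).
  split; [exact: fm_coord|exact: fm_coord|by []|by rewrite divfK|].
  by apply: cofin_sub (fm_cofin (fm_coord i) (ex_intro _ p xi)) _ => y yi; rewrite /aff divfK.
move=> A AC Ay AD AM AV Aae f [v [k [s [t [hs ht t0 ev e]]]]].
have xi0 := fm_cofin (fm_coord i) (ex_intro _ p xi).
have AQ (Q : {mpoly K[N.+1]}) : A (fun y => Q.@[aff i y]).
  elim/mpoly_ring_ind: Q => [c|j|Q Q' HQ HQ'|Q Q' HQ HQ'].
  - by apply: Aae (AC c) _; apply: cofin_all => y; rewrite mevalC.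
  - by apply: Aae (Ay j) _; apply: cofin_all => y; rewrite mevalXU.
  - by apply: Aae (AD _ _ HQ HQ') _; apply: cofin_all => y; rewrite mevalD.
  - by apply: Aae (AM _ _ HQ HQ') _; apply: cofin_all => y; rewrite mevalM.
have hom k' Q y : Q \is k'.-homog -> x y i != 0 -> Q.@[x y] = x y i ^+ k' * Q.@[aff i y].
  move=> hQ xy; rewrite !mevalE mulr_sumr; apply: eq_big_seq => m mQ.
  rewrite mulrCA; congr (_ * _); rewrite -(dhomog_mf hQ mQ) /= mdegE -prodrXr -big_split /=.
  by apply: eq_bigr => j _; rewrite -exprMn /aff mulrC mulfVK.
have [S hS ES] := hs; have [T hT ET] := ht.
have xk y : x y i != 0 -> x y i ^+ k != 0 by move=> ?; rewrite expf_neq0.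
have T0 : T.@[aff i p] != 0.
  by apply: contra t0 => /eqP T0; rewrite ET (hom _ _ _ hT xi) T0 mulr0.
have hvT : hv (a0 := form_curve) p (fun y => T.@[aff i y]) T.@[aff i p].
  exists k, t, (fun y => x y i ^+ k); split=> //; [exact: fm_coordX|exact: xk| |].
    by rewrite ET (hom _ _ _ hT xi) mulrC.
  by apply: cofin_sub xi0 _ => y yi; rewrite ET (hom _ _ _ hT yi) mulrC.
apply: Aae (AM _ _ (AQ S) (AV _ _ (AQ T) hvT T0)) _.
apply: cofin_sub (cofin_and xi0 (cofin_and e (fm_cofin ht (ex_intro _ p t0)))) _ => y [yi [ey ty]].
have T'0 : T.@[aff i y] != 0.
  by apply: contra ty => /eqP T'0; rewrite ET (hom _ _ _ hT yi) T'0 mulr0.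
apply: (mulIf ty); rewrite ey ET ES (hom _ _ _ hT yi) (hom _ _ _ hS yi).
by field.
Qed.

Theorem form_curve_fg : finitely_generated form_curve.
Proof.
split.
  by move=> p; have [i xi] := x_ne0 p; exists 'I_N.+1, (fun j y => aff i y j); apply: aff_generates.
have [i xi] := x_ne0 pt0; exists 'I_N.+1, (fun j y => aff i y j).
have xi0 := fm_cofin (fm_coord i) (ex_intro _ pt0 xi).
split.
- by move=> j; have [/(_ j)[v /hv_rat]] := aff_generates xi.
- by apply: cofin_sub xi0 _ => p; apply: aff_generates.
have [l Hl] := xi0; exists l => y y' /Hl yi /Hl y'i E; apply: x_inj => j j'.
have e j0 : x y j0 * x y' i = x y' j0 * x y i.
  by have := E j0; rewrite /aff => /eqP; rewrite eqr_div // => /eqP.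
apply: (mulIf yi); apply: (mulIf y'i).
transitivity ((x y j * x y' i) * (x y' j' * x y i)); first by ring.
by rewrite (e j) -(e j'); ring.
Qed.

End Forms.

(** * Forms, morphisms and isomorphisms *)

(** Common interface of [proj] and [biproj], so that regular functions and morphisms are treated at
    once for curves and for families. *)
Record graded (K : fieldType) (T : ambient K) (dadd : deg T -> deg T -> deg T) (deg0 : deg T) :
    Prop := Graded {
  daddA : associative dadd;
  dadd0 : left_id deg0 dadd;
  form_const : forall c : K, @form K T deg0 (fun=> c);
  form_zero : forall d, @form K T d (fun=> 0);
  form_add : forall d f g, @form K T d f -> @form K T d g -> form d (fun x => f x + g x);
  form_mul : forall d e f g, @form K T d f -> @form K T e g -> form (dadd d e) (fun x => f x * g x)
}.

Section Graded.
Variables (K : fieldType) (T : ambient K) (dadd : deg T -> deg T -> deg T) (deg0 : deg T).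
Hypothesis G : graded dadd deg0.
Implicit Types (X Y : T -> Prop) (p : T) (f g : T -> K) (d e : deg T).
Notation form := (@form K T).

Lemma form_ext d f g : form d f -> f =1 g -> form d g.
Proof. by move=> H /funext <-. Qed.

Lemma form_scale c d f : form d f -> form d (fun x => c * f x).
Proof. by move=> hf; have := form_mul G (form_const G c) hf; rewrite (dadd0 G). Qed.

Lemma form_sub d f g : form d f -> form d g -> form d (fun x => f x - g x).
Proof.
move=> hf hg; apply: form_ext (form_add G hf (form_scale (-1) hg)) _ => x.
by rewrite mulN1r.
Qed.

Lemma form_lin a b d f g : form d f -> form d g -> form d (fun x => a * f x + b * g x).
Proof. by move=> hf hg; apply: (form_add G); apply: form_scale. Qed.

Lemma nearE X p (Q : T -> Prop) : near X p Q <->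
  exists d c, [/\ form d c, c p != 0 & forall y, X y -> c y != 0 -> Q y].
Proof.
split=> [[U [[S hS US] Up UQ]]|[d [c [hc c0 cQ]]]].
  have [c Sc c0] : exists2 c, S c & c p != 0.
    apply: contrapT => H; apply: ((US p).2 _ Up) => f Sf.
    by apply/eqP/negPn/negP => f0; apply: H; exists f.
  have [d hc] := hS _ Sc; exists d, c; split=> // y Xy cy; apply: UQ => //.
  by apply: contrapT => /US /(_ _ Sc) E; rewrite E eqxx in cy.
exists (fun y => c y != 0); split=> //; exists (eq c); first by move=> _ <-; exists d.
by move=> y; split=> [H _ <-|/(_ _ erefl) ->]; [apply/eqP/negPn/negP|rewrite eqxx].
Qed.

Lemma near_sub X p (Q R : T -> Prop) :
  near X p Q -> (forall y, X y -> Q y -> R y) -> near X p R.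
Proof. by move=> [U [oU Up UQ]] QR; exists U; split=> // y Xy Uy; apply: QR (UQ _ _ _). Qed.

Lemma near_all X p (Q : T -> Prop) : (forall y, X y -> Q y) -> near X p Q.
Proof.
move=> H; apply/nearE; exists deg0, (fun=> 1).
by split; [exact: (form_const G)|exact: oner_neq0|move=> y /H].
Qed.

Lemma near_and X p (Q R : T -> Prop) :
  near X p Q -> near X p R -> near X p (fun y => Q y /\ R y).
Proof.
move=> /nearE[d [c [hc c0 cQ]]] /nearE[e [b [hb b0 bR]]]; apply/nearE.
exists (dadd d e), (fun y => c y * b y); split; [exact: (form_mul G)|by rewrite mulf_neq0|].
by move=> y Xy; rewrite mulf_eq0 negb_or => /andP[/cQ ? /bR]; split; auto.
Qed.

Lemma near_at X p (Q : T -> Prop) : X p -> near X p Q -> Q p.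
Proof. by move=> Xp [U [_ Up UQ]]; apply: UQ. Qed.

Lemma near_form X p d c : form d c -> c p != 0 -> near X p (fun y => c y != 0).
Proof. by move=> hc c0; apply/nearE; exists d, c. Qed.

Lemma regular_ratio X p d s t : form d s -> form d t -> t p != 0 ->
  regular_at X p (fun y => s y / t y).
Proof.
move=> hs ht t0; exists d, s, t; split=> //.
by apply: near_sub (near_form X ht t0) _ => y _ ?.
Qed.

Lemma regular_const X p c : regular_at X p (fun=> c).
Proof.
exists deg0, (fun=> c), (fun=> 1); split; try exact: (form_const G).
by apply: near_all => y _; rewrite divr1 oner_neq0.
Qed.

Lemma regular_add X p f g : regular_at X p f -> regular_at X p g ->
  regular_at X p (fun x => f x + g x).
Proof.
move=> [d [s [t [hs ht n]]]] [e [s' [t' [hs' ht' n']]]].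
exists (dadd d e), (fun y => s y * t' y + t y * s' y), (fun y => t y * t' y); split.
- by apply: (form_add G); apply: (form_mul G).
- exact: (form_mul G).
apply: near_sub (near_and n n') _ => y _ [[t0 ->] [t0' ->]]; split; first by rewrite mulf_neq0.
by field; rewrite ?t0 ?t0'.
Qed.

Lemma regular_mul X p f g : regular_at X p f -> regular_at X p g ->
  regular_at X p (fun x => f x * g x).
Proof.
move=> [d [s [t [hs ht n]]]] [e [s' [t' [hs' ht' n']]]].
exists (dadd d e), (fun y => s y * s' y), (fun y => t y * t' y); split; try exact: (form_mul G).
apply: near_sub (near_and n n') _ => y _ [[t0 ->] [t0' ->]]; split; first by rewrite mulf_neq0.
by field; rewrite ?t0 ?t0'.
Qed.

Lemma regular_near X p f g : regular_at X p f -> near X p (fun y => f y = g y) ->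
  regular_at X p g.
Proof.
move=> [d [s [t [hs ht n]]]] e; exists d, s, t; split=> //.
by apply: near_sub (near_and n e) _ => y _ [[? ->] <-].
Qed.

Lemma regular_neq0 X p f : X p -> regular_at X p f -> f p != 0 -> near X p (fun y => f y != 0).
Proof.
move=> Xp [d [s [t [hs ht n]]]] fp; have [t0 fE] := near_at Xp n.
have s0 : s p != 0 by apply: contraNN fp; rewrite fE => /eqP ->; rewrite mul0r.
apply: near_sub (near_and n (near_form X hs s0)) _ => y _ [[ty ->] sy].
by rewrite mulf_neq0 // invr_eq0.
Qed.

Lemma regular_inv X p f : X p -> regular_at X p f -> f p != 0 ->
  regular_at X p (fun x => (f x)^-1).
Proof.
move=> Xp [d [s [t [hs ht n]]]] fp; have [t0 fE] := near_at Xp n.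
have s0 : s p != 0 by apply: contraNN fp; rewrite fE => /eqP ->; rewrite mul0r.
exists d, t, s; split=> //.
by apply: near_sub (near_and n (near_form X hs s0)) _ => y _ [[ty ->] sy]; rewrite invf_div.
Qed.

Definition dmul n d := iter n (dadd d) deg0.

Lemma dmulD m n d : dmul (m + n) d = dadd (dmul m d) (dmul n d).
Proof.
elim: m => [|m IH]; first by rewrite (dadd0 G).
by rewrite addSn; change (dadd d (dmul (m + n) d) = dadd (dadd d (dmul m d)) (dmul n d));
   rewrite IH (daddA G).
Qed.

Lemma form_exp n d f : form d f -> form (dmul n d) (fun x => f x ^+ n).
Proof.
move=> hf; elim: n => [|n IH]; first exact: (form_const G).
by apply: form_ext (form_mul G hf IH) _ => y; rewrite exprS.
Qed.

Lemma form_comp m (s : 'I_m -> T -> K) d k (Q : {mpoly K[m]}) :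
  (forall i, form d (s i)) -> Q \is k.-homog -> form (dmul k d) (fun y => Q.@[fun i => s i y]).
Proof.
move=> hs hQ.
have mon (mm : 'X_{1..m}) (r : seq 'I_m) :
    form (dmul (\sum_(i <- r) mm i) d) (fun y => \prod_(i <- r) s i y ^+ mm i).
  elim: r => [|i r IH].
    by rewrite big_nil; apply: form_ext (form_const G 1) _ => y; rewrite big_nil.
  rewrite big_cons dmulD; apply: form_ext (form_mul G (form_exp (mm i) (hs i)) IH) _ => y.
  by rewrite big_cons.
have sums (r : seq 'X_{1..m}) (c : 'X_{1..m} -> K) : (forall mm, mm \in r -> mdeg mm = k) ->
    form (dmul k d) (fun y => \sum_(mm <- r) c mm * \prod_i s i y ^+ mm i).
  elim: r => [|mm r IH] H.
    by under eq_fun do rewrite big_nil; apply: (form_zero G).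
  have dm := H mm (mem_head _ _).
  apply: form_ext (form_add G (form_scale (c mm) _) (IH _)) _ => [||y]; last by rewrite big_cons.
    by rewrite -dm mdegE; apply: mon.
  by move=> x xr; apply: H; rewrite inE xr orbT.
apply: form_ext (sums (msupp Q) (fun mm => Q@_mm) _) _ => [mm|y]; last by rewrite mevalE.
by move/dhomogP: hQ => /(_ mm).
Qed.
End Graded.

Lemma homog_scale (K : fieldType) n k (Q : {mpoly K[n]}) c u : Q \is k.-homog ->
  Q.@[fun i => c * u i] = c ^+ k * Q.@[u].
Proof.
move=> hQ; rewrite !mevalE big_distrr /=; apply: eq_big_seq => m mQ.
rewrite mulrCA; congr (_ * _); rewrite -(dhomog_mf hQ mQ) /= mdegE -prodrXr -big_split /=.
by apply: eq_bigr => i _; rewrite exprMn.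
Qed.

Lemma dhomogC (K : nzRingType) n (c : K) : (c%:MP : {mpoly K[n]}) \is 0.-homog.
Proof. by rewrite -[c%:MP]mulr1 mul_mpolyC dhomogZ ?dhomog1. Qed.

Section Points.
Variables (K : fieldType) (n : nat).
Implicit Types (x y : proj K n) (u : 'I_n.+1 -> K).

Lemma row_neq0 u : (\row_i u i != 0) <-> exists i, u i != 0.
Proof.
split=> [H|[i ui]]; last by apply: contraNN ui => /eqP/rowP/(_ i); rewrite !mxE => ->.
apply: contrapT => H'; move/eqP: H; apply; apply/rowP => i; rewrite !mxE.
by apply/eqP/negPn/negP => ui; apply: H'; exists i.
Qed.

Lemma val_coords x : val x = <[\row_i coords x i]>%VS.
Proof.
have dx : \dim (val x) = 1%N by apply/eqP; apply: (valP x).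
have -> : \row_i coords x i = vpick (val x) by apply/rowP => i; rewrite mxE.
apply/eqP; rewrite eq_sym eqEdim -memvE memv_pick /= dim_vline vpick0 -dimv_eq0.
by move: dx; case: (\dim _) => [|[]].
Qed.

Lemma coords_neq0 x : exists i, coords x i != 0.
Proof.
apply/row_neq0/eqP => E; have := valP x; have := val_coords x.
by rewrite E => -> /eqP; rewrite dim_vline eqxx.
Qed.

Lemma line_coords x u : val x = <[\row_i u i]>%VS ->
  exists2 c, c != 0 & forall i, coords x i = c * u i.
Proof.
move=> xu; have : (\row_i coords x i) \in <[\row_i u i]>%VS.
  by rewrite -xu val_coords memv_line.
case/vlineP=> c /rowP E; exists c => [|i]; last by have := E i; rewrite !mxE.
have [j] := coords_neq0 x; have := E j; rewrite !mxE => ->.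
by apply: contraNN => /eqP ->; rewrite mul0r.
Qed.

Lemma coords_line x u c : (forall i, coords x i = c * u i) -> val x = <[\row_i u i]>%VS.
Proof.
move=> E; have c0 : c != 0.
  have [j] := coords_neq0 x; rewrite E.
  by apply: contraNN => /eqP ->; rewrite mul0r.
rewrite val_coords (_ : (\row_i coords x i) = c *: (\row_i u i)); last first.
  by apply/rowP => i; rewrite !mxE.
apply/eqP; rewrite eqEsubv -!memvE; apply/andP; split; first by rewrite memvZ ?memv_line.
by rewrite -[X in X \in _](scalerK c0) memvZ ?memv_line.
Qed.

Lemma point_eq_coords x y c : (forall i, coords x i = c * coords y i) -> x = y.
Proof. by move=> /coords_line E; apply: val_inj; rewrite E -val_coords. Qed.

Lemma point_eq_cross x y :
  (forall i j, coords x i * coords y j = coords x j * coords y i) -> x = y.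
Proof.
move=> E; have [j yj] := coords_neq0 y.
apply: (@point_eq_coords _ _ (coords x j / coords y j)) => i.
by rewrite mulrAC -E mulfK.
Qed.

Lemma point_ex u : (exists i, u i != 0) ->
  exists x, exists2 c, c != 0 & forall i, coords x i = c * u i.
Proof.
move=> /row_neq0 u0.
have d1 : \dim <[\row_i u i]>%VS == 1%N by rewrite dim_vline u0.
pose x : point K n := exist (fun L : {vspace 'rV[K]_n.+1} => \dim L == 1%N) _ d1.
by exists x; apply: line_coords.
Qed.

Lemma proj_graded : @graded K (proj K n) addn 0%N.
Proof.
split; [exact: addnA|exact: add0n| | | |].
- by move=> c; exists c%:MP => [|x]; rewrite ?mevalC ?dhomogC.
- by move=> d; exists 0 => [|x]; rewrite ?meval0 ?dhomog0.
- move=> d f g [P hP fP] [Q hQ gQ]; exists (P + Q); first exact: dhomogD.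
  by move=> x; rewrite mevalD fP gQ.
- move=> d e f g [P hP fP] [Q hQ gQ]; exists (P * Q); first exact: dhomogM.
  by move=> x; rewrite mevalM fP gQ.
Qed.

Lemma form_coord i : @form K (proj K n) 1%N (fun x => coords x i).
Proof. by exists 'X_i => [|x]; rewrite ?dhomogX /= ?mdeg1 // mevalXU. Qed.

Lemma form_expL k f : @form K (proj K n) 1%N f -> @form K (proj K n) k (fun y => f y ^+ k).
Proof.
move=> hf; elim: k => [|k IH]; first exact: (form_const proj_graded).
by apply: form_ext (form_mul proj_graded hf IH) _ => y; rewrite exprS.
Qed.

Lemma point_closed x : zclosed (fun y : proj K n => y = x).
Proof.
exists (fun f => exists i j, f = fun y : proj K n => coords x i * coords y j - coords x j * coords y i).
  move=> f [i [j ->]]; exists 1%N; apply: (form_sub proj_graded);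
    exact: (form_scale proj_graded _ (form_coord _)).
move=> y; split=> [-> f [i [j ->]]|H]; first by rewrite mulrC subrr.
apply/esym/point_eq_cross => i j; apply/eqP; rewrite -subr_eq0; apply/eqP.
by have := H _ (ex_intro _ i (ex_intro _ j erefl)).
Qed.

End Points.

Section Biproj.
Variables (K : fieldType) (n N : nat).
Notation B := (biproj K n N).

Lemma biproj_graded : @graded K B (fun d e => (d.1 + e.1, d.2 + e.2)%N) (0, 0)%N.
Proof.
split.
- by move=> [a b] [c d] [e f] /=; rewrite !addnA.
- by move=> [a b].
- move=> c; exists (c%:MP)%:MP => [|x] /=; last by rewrite /specialize map_mpolyC mevalC /= mevalC.
  split=> [|m]; first exact: dhomogC.
  by rewrite mcoeffC; case: eqP => _; rewrite ?mulr1 ?mulr0 ?dhomog0 ?dhomogC.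
- move=> d; exists 0 => [|x]; last by rewrite /specialize rmorph0 meval0.
  by split=> [|m]; rewrite ?mcoeff0 ?dhomog0.
- move=> d f g [P [hP cP] fP] [Q [hQ cQ] gQ]; exists (P + Q) => [|x].
    by split=> [|m]; rewrite ?mcoeffD; apply: dhomogD.
  by rewrite /specialize rmorphD mevalD fP gQ.
- move=> d e f g [P [hP cP] fP] [Q [hQ cQ] gQ]; exists (P * Q) => [|x].
    split=> [|m]; first exact: dhomogM.
    by rewrite mcoeffM; apply: rpred_sum => k _; apply: dhomogM.
  by rewrite /specialize rmorphM mevalM fP gQ.
Qed.

Lemma form_fst d f : @form K (proj K n) d f -> @form K B (d, 0)%N (fun z => f z.1).
Proof.
move=> [p hp fp]; exists p%:MP => [|x] /=; last by rewrite /specialize map_mpolyC mevalC /= fp.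
split=> [|m]; first exact: dhomogC.
by rewrite mcoeffC; case: eqP => _; rewrite ?mulr1 ?mulr0 ?dhomog0.
Qed.

Lemma specialize_const p b : specialize (map_mpoly (@mpolyC n.+1 K) p) b = p :> {mpoly K[N.+1]}.
Proof. by apply/mpolyP => m; rewrite /specialize !mcoeff_map_mpoly /= mevalC. Qed.

Lemma bihomog_const e (p : {mpoly K[N.+1]}) : p \is e.-homog ->
  bihomog 0 e (map_mpoly (@mpolyC n.+1 K) p).
Proof.
move=> hp; split=> [|m]; last first.
  by rewrite mcoeff_map_mpoly; apply: dhomogC.
apply/dhomogP => m; rewrite mcoeff_msupp mcoeff_map_mpoly => H.
apply: (dhomog_mf hp); rewrite mcoeff_msupp.
by apply: contraNN H => /eqP -> /=; rewrite mpolyC0.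
Qed.

Lemma form_snd d f : @form K (proj K N) d f -> @form K B (0, d)%N (fun z => f z.2).
Proof.
move=> [p hp fp]; exists (map_mpoly (@mpolyC n.+1 K) p); first exact: bihomog_const.
by move=> x; rewrite specialize_const fp.
Qed.
End Biproj.

Section Morphisms.
Variables (K : fieldType) (T : ambient K) (dadd : deg T -> deg T -> deg T) (deg0 : deg T).
Hypothesis G : graded dadd deg0.
Variables (m : nat).
Implicit Types (X : T -> Prop) (Y : proj K m -> Prop) (f : T -> proj K m) (p : T).

Lemma morphism_local X Y f p : morphism X Y f -> X p -> exists d (s : 'I_m.+1 -> T -> K),
  (forall i, form d (s i)) /\
  near X p (fun y => exists2 c, c != 0 & forall i, coords (f y) i = c * s i y).
Proof.
move=> [_ H] /H[d [s [hs ns]]]; exists d, s; split=> //.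
by apply: near_sub ns _ => y _; apply: line_coords.
Qed.

Lemma morphism_intro X Y f : (forall x, X x -> Y (f x)) ->
  (forall p, X p -> exists d (s : 'I_m.+1 -> T -> K),
    (forall i, form d (s i)) /\
    near X p (fun y => exists c, forall i, coords (f y) i = c * s i y)) -> morphism X Y f.
Proof.
move=> XY H; split=> // p /H[d [s [hs ns]]]; exists d, s; split=> //.
by apply: near_sub ns _ => y _ [c]; apply: coords_line.
Qed.

Lemma near_comp X Y f p Q : morphism X Y f -> X p -> near Y (f p) Q -> near X p (fun y => Q (f y)).
Proof.
move=> mf Xp /nearE[k [c [hc c0 cQ]]].
have [d [s [hs ns]]] := morphism_local mf Xp.
case: hc => R hR cR; have [lam l0 E] := near_at Xp ns.
have eqn0 y : (exists2 a, a != 0 & forall i, coords (f y) i = a * s i y) ->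
    (c (f y) != 0) = (R.@[fun i => s i y] != 0).
  move=> [a a0 Ey]; rewrite cR (meval_eq _ Ey) (homog_scale _ _ hR) mulf_eq0 expf_eq0 (negPf a0).
  by rewrite andbF.
have := near_form X (form_comp G hs hR) (p := p).
rewrite -eqn0; last by exists lam.
move=> /(_ c0) /(near_and G ns)/near_sub; apply => y Xy [/eqn0 E1]; rewrite -E1 => cy.
exact: cQ (mf.1 _ Xy) cy.
Qed.

Lemma regular_comp X Y f p w : morphism X Y f -> X p -> regular_at Y (f p) w ->
  regular_at X p (fun y => w (f y)).
Proof.
move=> mf Xp [k [a [b [[A hA aA] [B hB bB] n]]]].
have [d [s [hs ns]]] := morphism_local mf Xp.
exists (dmul dadd deg0 k d), (fun y => A.@[fun i => s i y]), (fun y => B.@[fun i => s i y]).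
split; [exact: (form_comp G)|exact: (form_comp G)|].
apply: near_sub (near_and G ns (near_comp mf Xp n)) _ => y _ [[c c0 E]].
rewrite aA bB !(meval_eq _ E) !(homog_scale _ _ hA) !(homog_scale _ _ hB) => -[bn ->].
have [ck Bn] : c ^+ k != 0 /\ B.@[fun i => s i y] != 0.
  by move: bn; rewrite mulf_eq0 negb_or => /andP[].
by split=> //; field; rewrite ck Bn.
Qed.
End Morphisms.

Section Isomorphisms.
Variables (K : fieldType).

Lemma morphism_id n (X Y : proj K n -> Prop) : (forall x, X x -> Y x) -> morphism X Y id.
Proof.
move=> XY; apply: morphism_intro => // p Xp; exists 1%N, (fun i x => coords x i).
split=> [i|]; first exact: form_coord.
by apply: (near_all (@proj_graded K n)) => y _; exists 1 => i; rewrite mul1r.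
Qed.

Lemma morphism_comp n m l (X : proj K n -> Prop) (Y : proj K m -> Prop) (Z : proj K l -> Prop) f g :
  morphism X Y f -> morphism Y Z g -> morphism X Z (g \o f).
Proof.
move=> mf mg; apply: morphism_intro => [x /mf.1/mg.1 //|p Xp].
have [d [s [hs ns]]] := morphism_local mf Xp.
have [e [t [ht nt]]] := morphism_local mg (mf.1 _ Xp).
have /choice[R HR] : forall i, exists R : {mpoly K[m.+1]},
    R \is e.-homog /\ forall y, t i y = R.@[coords y].
  by move=> i; have [R hR tR] := ht i; exists R.
exists (@dmul K (proj K n) addn 0%N e d), (fun i y => (R i).@[fun j => s j y]); split=> [i|].
  exact: (form_comp (@proj_graded K n) hs (HR i).1).
have nt' := near_comp (@proj_graded K n) mf Xp nt.
apply: near_sub (near_and (@proj_graded K n) ns nt') _ => y _ [[c c0 E] [c' c0' E']].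
exists (c' * c ^+ e) => i.
by rewrite /= E' (HR i).2 (meval_eq _ E) (homog_scale _ _ (HR i).1) mulrA.
Qed.

Lemma iso_id n (X : proj K n -> Prop) : isomorphism X X id.
Proof. by split; [exact: morphism_id|exists id; split=> //; exact: morphism_id]. Qed.

Lemma iso_comp n m l (X : proj K n -> Prop) (Y : proj K m -> Prop) (Z : proj K l -> Prop) f g :
  isomorphism X Y f -> isomorphism Y Z g -> isomorphism X Z (g \o f).
Proof.
move=> [mf [f' [mf' fK f'K]]] [mg [g' [mg' gK g'K]]]; split; first exact: morphism_comp mf mg.
exists (f' \o g'); split; first exact: morphism_comp mg' mf'.
  by move=> x Xx /=; rewrite gK ?fK //; apply: mf.1.
by move=> z Zz /=; rewrite f'K ?g'K //; apply: mg'.1.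
Qed.

Lemma iso_inv n m (X : proj K n -> Prop) (Y : proj K m -> Prop) f : isomorphism X Y f ->
  exists f', [/\ isomorphism Y X f', forall x, X x -> f' (f x) = x & forall y, Y y -> f (f' y) = y].
Proof. by move=> [mf [f' [mf' fK f'K]]]; exists f'; split=> //; split=> //; exists f. Qed.

Lemma uniformizer_iso n m (X : proj K n -> Prop) (Y : proj K m -> Prop) f p t :
  isomorphism X Y f -> X p -> uniformizer Y (f p) t -> uniformizer X p (fun y => t (f y)).
Proof.
move=> [mf [f' [mf' fK f'K]]] Xp [rt t0 ut]; have Yfp := mf.1 _ Xp.
have Gn := @proj_graded K n; have Gm := @proj_graded K m.
split=> // [|g rg g0]; first exact: (regular_comp Gn mf Xp rt).
have rg' : regular_at Y (f p) (fun y => g (f' y)).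
  by apply: (regular_comp Gm mf' Yfp); rewrite fK.
have [|v rv nv] := ut _ rg'; first by rewrite fK.
exists (fun y => v (f y)); first exact: (regular_comp Gn mf Xp rv).
by apply: near_sub (near_comp Gn mf Xp nv) _ => y Xy; rewrite fK.
Qed.

Lemma uniformizer_scale n (X : proj K n -> Prop) p (c : K) (t : proj K n -> K) : c != 0 -> uniformizer X p t ->
  uniformizer X p (fun y => c * t y).
Proof.
move=> ce [rt t0 ut]; have G := @proj_graded K n; split; last first.
- move=> f rf f0; have [v rv nv] := ut f rf f0; exists (fun y => c^-1 * v y).
    exact: (regular_mul G (regular_const G _ _ _) rv).
  by apply: near_sub nv _ => y _ ->; field.
- by rewrite t0 mulr0.
exact: (regular_mul G (regular_const G _ _ _) rt).
Qed.

Lemma uniformizer_near n (X : proj K n -> Prop) p (t t' : proj K n -> K) : X p -> uniformizer X p t ->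
  near X p (fun y => t y = t' y) -> uniformizer X p t'.
Proof.
move=> Xp [rt t0 ut] e; have G := @proj_graded K n; split.
- exact: (regular_near G rt e).
- by rewrite -(near_at Xp e).
move=> f rf f0; have [v rv nv] := ut f rf f0; exists v => //.
by apply: near_sub (near_and G nv e) _ => y _ [-> ->].
Qed.
End Isomorphisms.

(** * The projective line *)

Section Line.
Variable K : fieldType.
Local Notation L := (proj K 1).
Local Notation pform := (@form K L).
Let GL := @proj_graded K 1.
Implicit Types (q r y z : proj K 1) (u v : K).

Definition c0 y : K := coords y ord0.
Definition c1 y : K := coords y ord_max.

Lemma ord2 (i : 'I_2) : i = ord0 \/ i = ord_max.
Proof. by case: i => [[|[]]] // ?; [left|right]; apply: val_inj. Qed.

Lemma form_c0 : pform 1%N c0. Proof. exact: form_coord. Qed.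
Lemma form_c1 : pform 1%N c1. Proof. exact: form_coord. Qed.

Lemma c01_neq0 y : (c0 y != 0) || (c1 y != 0).
Proof. by have [i yi] := coords_neq0 y; case: (ord2 i) yi => -> ->; rewrite ?orbT. Qed.

Definition om q y : K := c0 q * c1 y - c1 q * c0 y.

Lemma form_om q : pform 1%N (om q).
Proof. by apply: (form_sub GL); apply: (form_scale GL); apply: form_coord. Qed.

Lemma om_eq0 q y : om q y = 0 <-> y = q.
Proof.
split=> [/eqP|->]; last by rewrite /om mulrC subrr.
rewrite subr_eq0 => /eqP E; apply/esym/point_eq_cross => i j.
by case: (ord2 i) => ->; case: (ord2 j) => ->; rewrite -/(c0 _) -/(c1 _) ?E // [LHS]mulrC.
Qed.

Definition ppt_vec u v : 'I_2 -> K := fun i => if i == ord0 then u else v.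

Lemma ppt_ex u v : exists y, (u, v) != (0, 0) ->
  exists2 c, c != 0 & c0 y = c * u /\ c1 y = c * v.
Proof.
case: (altP ((u, v) =P (0, 0))) => [_|uv].
  by have [|y _] := @point_ex K 1 (fun=> 1); [exists ord0; exact: oner_neq0|exists y].
have [|y [c ce E]] := @point_ex K 1 (ppt_vec u v).
  apply: contrapT => H; move/negP: uv; apply; apply/eqP; congr pair;
  apply/eqP/negPn/negP => ne; apply: H; [by exists ord0|by exists ord_max].
by exists y => _; exists c => //; rewrite /c0 /c1 !E.
Qed.

(* The point [u : v], and an arbitrary point when u = v = 0. *)
Definition ppt u v : proj K 1 := projT1 (cid (ppt_ex u v)).

Lemma pptE u v : (u, v) != (0, 0) -> exists2 c, c != 0 & c0 (ppt u v) = c * u /\ c1 (ppt u v) = c * v.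
Proof. exact: (projT2 (cid (ppt_ex u v))). Qed.

Section Factor.
Variables (q : proj K 1) (r0 r1 : K).
Hypothesis det1 : c0 q * r1 - c1 q * r0 = 1.

(** Together with [om q] these are the coordinates in the basis q, r of determinant 1: y = om' y * q
    + om q y * r. *)
Definition om' y : K := c0 y * r1 - c1 y * r0.

Lemma form_om' : pform 1%N om'.
Proof.
apply: form_ext (form_lin GL r1 (- r0) form_c0 form_c1) _ => y.
by rewrite /om'; ring.
Qed.

Lemma c0E y : c0 y = om' y * c0 q + om q y * r0.
Proof. by rewrite /om' /om -[LHS]mulr1 -det1; ring. Qed.

Lemma c1E y : c1 y = om' y * c1 q + om q y * r1.
Proof. by rewrite /om' /om -[LHS]mulr1 -det1; ring. Qed.

(** A form of degree k - 1, read as zero when k = 0. *)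
Definition factor_form k (g : L -> K) := if k is k'.+1 then pform k' g else g =1 fun=> 0.
Definition expand k (f : L -> K) := exists c g, factor_form k g /\
  forall y, f y = c * om' y ^+ k + om q y * g y.

Lemma expand_ext k f g : expand k f -> f =1 g -> expand k g.
Proof. by move=> H /funext <-. Qed.

Lemma expand_const c : expand 0 (fun=> c).
Proof. by exists c, (fun=> 0); split=> // y; rewrite mulr0 addr0 mulr1. Qed.

Lemma expand_coord k f i : expand k f -> expand k.+1 (fun y => coords y i * f y).
Proof.
move=> [c [g [hg fE]]].
have [s [t E]] : exists s t, forall y, coords y i = om' y * s + om q y * t.
  by case: (ord2 i) => ->; [exists (c0 q), r0|exists (c1 q), r1] => y; [apply: c0E|apply: c1E].
exists (s * c), (fun y => t * c * om' y ^+ k + coords y i * g y); split=> [|y]; last first.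
  by rewrite fE E exprS; ring.
have hk : pform k (fun y => om' y ^+ k) by exact: form_expL form_om'.
apply: (form_add GL); first exact: (form_scale GL).
case: k hg {fE hk} => [g0|k hg]; last exact: (form_mul GL (form_coord _ i) hg).
by apply: form_ext (form_zero GL 0%N) _ => y; rewrite g0 mulr0.
Qed.

Lemma expand_lin k (f g : L -> K) a : expand k f -> expand k g -> expand k (fun y => a * f y + g y).
Proof.
move=> [c [h [hh fE]]] [d [e [he gE]]]; exists (a * c + d), (fun y => a * h y + e y); split.
  case: k hh he {fE gE} => [h0 e0 y|k hh he]; first by rewrite h0 e0 mulr0 addr0.
  exact: (form_add GL (form_scale GL a hh) he).
by move=> y; rewrite fE gE; ring.
Qed.

Lemma expand_ex k f : pform k f -> expand k f.
Proof.
move=> [Q hQ fQ].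
have mon (mm : 'X_{1..2}) (s : seq 'I_2) :
    expand (\sum_(i <- s) mm i) (fun y => \prod_(i <- s) coords y i ^+ mm i).
  elim: s => [|i s IH].
    by rewrite big_nil; apply: expand_ext (expand_const 1) _ => y; rewrite big_nil.
  suff: forall m, expand (m + \sum_(j <- s) mm j)
      (fun y => coords y i ^+ m * \prod_(j <- s) coords y j ^+ mm j).
    by move=> /(_ (mm i)) H; rewrite big_cons; apply: expand_ext H _ => y; rewrite big_cons.
  elim=> [|m IHm]; first by apply: expand_ext IH _ => y; rewrite mul1r.
  by rewrite addSn; apply: expand_ext (expand_coord i IHm) _ => y; rewrite exprS mulrA.
have sums (s : seq 'X_{1..2}) : (forall mm, mm \in s -> mdeg mm = k) ->
    expand k (fun y => \sum_(mm <- s) Q@_mm * \prod_i coords y i ^+ mm i).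
  elim: s => [|mm s IH] H.
    exists 0, (fun=> 0); split; last by move=> y; rewrite big_nil; ring.
    by case: (k) => // k'; exact: (form_zero GL).
  have A : expand k (fun y => \prod_i coords y i ^+ mm i).
    by rewrite -(H mm (mem_head _ _)) mdegE; apply: mon.
  have B := IH (fun x xs => H x (mem_behead (s := mm :: s) xs)).
  by apply: expand_ext (expand_lin Q@_mm A B) _ => y; rewrite big_cons.
rewrite (_ : f = fun y => \sum_(mm <- msupp Q) Q@_mm * \prod_i coords y i ^+ mm i).
  by apply: sums => mm; move/dhomogP: hQ => /(_ mm).
by apply/funext => y; rewrite fQ mevalE.
Qed.
End Factor.

Lemma det1_ex q : exists r0 r1 : K, c0 q * r1 - c1 q * r0 = 1.
Proof.
case/orP: (c01_neq0 q) => H; first by exists 0, (c0 q)^-1; rewrite mulr0 subr0 mulfV.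
by exists (- (c1 q)^-1), 0; rewrite mulr0 sub0r mulrN opprK mulfV.
Qed.

Lemma form_factor q k f : pform k f -> f q = 0 ->
  exists2 g, factor_form k g & forall y, f y = om q y * g y.
Proof.
move=> hf fq; have [r0 [r1 d1]] := det1_ex q.
have [c [g [hg E]]] := expand_ex d1 hf; exists g => // y.
suff c_eq0 : c = 0 by rewrite E c_eq0 mul0r add0r.
by move: fq; rewrite E /om' d1 expr1n mulr1 (om_eq0 q q).2 // mul0r addr0.
Qed.

Lemma form_many_zeros k f (pt : K -> proj K 1) : injective pt -> pform k f ->
  infinitely_many (fun l => f (pt l) = 0) -> forall y, f y = 0.
Proof.
move=> ip; elim: k f => [|k IH] f hf H y.
  have [l _ fl] := H [::]; have [g g0 ->] := form_factor hf fl.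
  by rewrite g0 mulr0.
have [l _ fl] := H [::]; have [g hg fE] := form_factor hf fl.
rewrite fE (IH g hg) ?mulr0 // => s; have [m ms fm] := H (l :: s).
move: ms; rewrite inE negb_or => /andP[ml ms]; exists m => //.
move/eqP: fm; rewrite fE mulf_eq0 => /orP[/eqP/om_eq0/ip E|/eqP //].
by rewrite E eqxx in ml.
Qed.

(** Induction on the degree: a common zero splits off the same linear form from all s i, and this
    must stop since one of them is not identically zero. *)
Lemma common_factor (I : Type) k (s : I -> L -> K) : (forall i, pform k (s i)) ->
  (exists i y, s i y != 0) -> exists k' (r : I -> L -> K) G,
  [/\ forall i, pform k' (r i), forall i y, s i y = G y * r i y & forall y, exists i, r i y != 0].
Proof.
elim: k s => [|k IH] s hs [j [z sz]]; case: (pselect (exists y, forall i, s i y = 0)).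
- move=> [y H]; have [g g0 E] := form_factor (hs j) (H j).
  by rewrite E g0 mulr0 eqxx in sz.
- move=> H; exists 0%N, s, (fun=> 1); split=> // [i y|y]; first by rewrite mul1r.
  by apply: contrapT => H'; apply: H; exists y => i; apply/eqP/negPn/negP => si; apply: H'; exists i.
- move=> [y H]; have /choice[g Hg] : forall i, exists g, pform k g /\ forall y', s i y' = om y y' * g y'.
    by move=> i; have [g hg E] := form_factor (hs i) (H i); exists g.
  have [i|| k' [r [G [hr E r0]]]] := IH g; first exact: (Hg i).1.
    exists j, z; apply: contraNN sz => /eqP gz.
    by rewrite (Hg j).2 gz mulr0.
  exists k', r, (fun y' => om y y' * G y'); split=> // i y'.
  by rewrite (Hg i).2 E mulrA.
- move=> H; exists k.+1, s, (fun=> 1); split=> // [i y|y]; first by rewrite mul1r.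
  by apply: contrapT => H'; apply: H; exists y => i; apply/eqP/negPn/negP => si; apply: H'; exists i.
Qed.

Lemma om_uniformizer q l : pform 1%N l -> l q != 0 ->
  uniformizer (@whole L) q (fun y => om q y / l y).
Proof.
move=> hl lq; split.
- exact: (regular_ratio _ (form_om q) hl lq).
- by rewrite (om_eq0 q q).2 // mul0r.
move=> f [k [s [t [hs ht n]]]] fq; have [t0 fE] := near_at (I : whole q) n.
have sq : s q = 0.
  by move/eqP: fq; rewrite fE mulf_eq0 invr_eq0 (negPf t0) orbF => /eqP.
have [g hg sE] := form_factor hs sq.
exists (fun y => g y * l y / t y).
  case: k hs ht hg {n} => [|k] hs ht hg.
    apply: (@regular_near _ _ _ _ GL _ _ (fun=> 0)); first exact: (regular_const GL).
    by apply: (near_all GL) => y _; rewrite hg !mul0r.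
  have hgl := form_mul GL hg hl; rewrite addn1 in hgl.
  exact: regular_ratio _ hgl ht t0.
apply: near_sub (near_and GL n (near_form _ hl lq)) _ => y _ [[ty ->] ly].
by rewrite sE; field; rewrite ty ly.
Qed.
End Line.

Lemma infinite_field (K : numFieldType) (s : seq K) : exists l, l \notin s.
Proof.
pose M := [seq (i%:R : K) | i <- iota 0 (size s).+1].
have uM : uniq M by rewrite map_inj_uniq ?iota_uniq //; apply: mulrIn; exact: oner_neq0.
apply: contrapT => H; have : (size M <= size s)%N.
  by apply: uniq_leq_size => // l lM; apply/negPn/negP => ls; apply: H; exists l.
by rewrite size_map size_iota ltnn.
Qed.

Section Affine.
Variable K : numFieldType.
Local Notation L := (proj K 1).
Local Notation W := (@whole L).
Let GL := @proj_graded K 1.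
Variables (q : L) (r0 r1 : K).
Hypothesis det1 : c0 q * r1 - c1 q * r0 = 1.
Implicit Types (y z : L) (t a b : K).
Local Notation omr := (om' r0 r1).

Lemma omr_q : omr q = 1. Proof. exact: det1. Qed.

Lemma om_neq0 y : y <> q -> om q y != 0.
Proof. by move=> yq; apply/eqP => /om_eq0. Qed.

(* Takes the junk value 0 at its pole q. *)
Definition acoord y : K := omr y / om q y.

Definition apoint a b : L := ppt (a * c0 q + b * r0) (a * c1 q + b * r1).

Lemma apointE a b : (a, b) != (0, 0) ->
  exists2 c, c != 0 & omr (apoint a b) = c * a /\ om q (apoint a b) = c * b.
Proof.
move=> ab; have [|c ce [E0 E1]] := @pptE K (a * c0 q + b * r0) (a * c1 q + b * r1).
  apply: contraNN ab => /eqP[E0 E1]; apply/eqP; congr pair.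
    have -> : a = (a * c0 q + b * r0) * r1 - (a * c1 q + b * r1) * r0 by rewrite -[LHS]mulr1 -det1; ring.
    by rewrite E0 E1; ring.
  have -> : b = (a * c1 q + b * r1) * c0 q - (a * c0 q + b * r0) * c1 q by rewrite -[LHS]mulr1 -det1; ring.
  by rewrite E0 E1; ring.
exists c => //; rewrite /om' /om E0 E1; split; rewrite -[RHS]mulr1 -det1; ring.
Qed.

Lemma pair1_neq0 t : (t, 1) != (0, 0) :> K * K.
Proof. by rewrite xpair_eqE oner_eq0 andbF. Qed.

Lemma apoint_neq t : apoint t 1 <> q.
Proof.
move=> /om_eq0/eqP; have [c ce [_ ->]] := apointE (pair1_neq0 t).
by rewrite mulr1 (negPf ce).
Qed.

Lemma apointK t : acoord (apoint t 1) = t.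
Proof.
have [c ce [E E']] := apointE (pair1_neq0 t).
by rewrite /acoord E E' mulr1 mulrAC mulfV // mul1r.
Qed.

Lemma om_inj y z : omr y * om q z = om q y * omr z -> y = z.
Proof.
move=> E; apply/esym/om_eq0; rewrite /om (c0E det1 y) (c0E det1 z) (c1E det1 y) (c1E det1 z).
transitivity ((omr y * om q z - om q y * omr z) * (c0 q * r1 - c1 q * r0)); first by ring.
by rewrite E subrr mul0r.
Qed.

Lemma acoordK y : y <> q -> apoint (acoord y) 1 = y.
Proof.
move=> yq; apply: om_inj; have [c ce [-> ->]] := apointE (pair1_neq0 (acoord y)).
by rewrite /acoord; field; apply: om_neq0.
Qed.

Lemma acoord_inj y z : y <> q -> z <> q -> acoord y = acoord z -> y = z.
Proof. by move=> yq zq E; rewrite -(acoordK yq) E acoordK. Qed.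

Lemma acoord_regular y : y <> q -> regular_at W y acoord.
Proof. by move=> /om_neq0; apply: (regular_ratio _ (form_om' _ _) (form_om q)). Qed.

Lemma acoord_uniformizer z : z <> q -> uniformizer W z (fun y => acoord y - acoord z).
Proof.
move=> zq; have oz := om_neq0 zq.
have u := uniformizer_scale (c := - (om q z)^-1) _ (om_uniformizer (form_om q) oz).
apply: (uniformizer_near (t := fun y => - (om q z)^-1 * (om z y / om q y))) => //.
  by apply: u; rewrite oppr_eq0 invr_eq0.
apply: near_sub (near_form _ (form_om q) oz) _ => y _ oy.
rewrite /acoord; have -> : om z y = omr z * om q y - om q z * omr y.
  rewrite [LHS]/om (c0E det1 y) (c0E det1 z) (c1E det1 y) (c1E det1 z) -[RHS]mulr1 -det1; ring.
by field; rewrite oz oy.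
Qed.

Lemma acoordV_uniformizer : uniformizer W q (fun y => (acoord y)^-1).
Proof.
have r_neq0 : omr q != 0 by rewrite omr_q oner_neq0.
apply: (uniformizer_near (t := fun y => om q y / omr y)) => //.
  exact: om_uniformizer (form_om' _ _) r_neq0.
by apply: (near_all GL) => y _; rewrite /acoord invf_div.
Qed.

Lemma line_nonisolated y Q : near W y Q -> exists2 z, z <> y & Q z.
Proof.
move=> /nearE[k [c [hc cy cQ]]]; apply: contrapT => H.
move/eqP: cy; apply; apply: (@form_many_zeros K k c (fun t => apoint t 1)) => //.
  by move=> s t E; rewrite -(apointK s) E apointK.
move=> s; have [l] := infinite_field (acoord y :: s).
rewrite inE negb_or => /andP[ly ls]; exists l => //.
apply/eqP/negPn/negP => cl; apply: H; exists (apoint l 1); last exact: cQ.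
by move=> E; rewrite -E apointK eqxx in ly.
Qed.

(* An automorphism of the line fixing q is affine, up to a function regular at q. *)
Lemma affine_at_pole be : isomorphism W W be -> be q = q ->
  exists2 a, a != 0 & exists2 w, regular_at W q w &
    near W q (fun y => y <> q -> acoord (be y) - a * acoord y = w y).
Proof.
move=> ib bq; pose V y := (acoord y)^-1.
have uV : uniformizer W q V := acoordV_uniformizer.
have uVb : uniformizer W q (fun y => V (be y)).
  by apply: (uniformizer_iso ib) => //; rewrite bq.
have [rV V0 dV] := uV; have [rVb Vb0 dVb] := uVb.
have [w rw nw] := dV _ rVb Vb0; have [w' rw' nw'] := dVb _ rV V0.
have nr : near W q (fun y => omr y != 0).
  by apply: near_form (form_om' _ _) _; rewrite omr_q oner_neq0.
have VA y : y <> q -> omr y != 0 -> V y != 0 /\ V y * acoord y = 1.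
  move=> /om_neq0 oy ry; rewrite /V /acoord; split; first by rewrite invr_eq0 mulf_neq0 ?invr_eq0.
  by field; rewrite ry oy.
(* w and w' are inverse to each other near q and off q. If w q = 0, then w = u V, and 1 - w' u V,
   whose value at q is 1, would vanish at nearby points. *)
have wq : w q != 0.
  apply/eqP => wq0; have [u ru nu] := dV _ rw wq0.
  pose e y := 1 + (-1) * (w' y * (u y * V y)).
  have re : regular_at W q e.
    apply: (regular_add GL (regular_const GL _ _ _)); apply: (regular_mul GL (regular_const GL _ _ _)).
    exact/(regular_mul GL rw')/(regular_mul GL ru).
  have e0 : e q != 0 by rewrite /e V0 !mulr0 addr0 oner_neq0.
  have ne := regular_neq0 GL (I : W q) re e0.
  have [y yq [[[[E1 E2] E3] E4] E5]] := line_nonisolated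
    (near_and GL (near_and GL (near_and GL (near_and GL nw nw') nu) ne) nr).
  have [Vy _] := VA y yq E5; move/eqP: E4; apply; rewrite /e.
  suff -> : w' y * (u y * V y) = 1 by ring.
  by apply: (mulIf Vy); rewrite mul1r [RHS]E2 E1 E3; ring.
pose a := (w q)^-1; pose h y := (w y)^-1 - a.
have rh : regular_at W q h.
  by apply: (regular_add GL (regular_inv GL _ rw wq) (regular_const GL _ _ _)).
have [v rv nv] := dV _ rh (subrr _).
exists a; first by rewrite invr_eq0.
exists v => //; apply: near_sub (near_and GL (near_and GL nw nv) nr) _ => y _ [[E1 E2] ry] yq.
have [Vy VAy] := VA y yq ry.
have -> : acoord (be y) = (w y)^-1 * acoord y by rewrite -[LHS]invrK -/(V _) E1 invfM invrK.
by rewrite -mulrBl -/(h y) E2 -mulrA VAy mulr1.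
Qed.
End Affine.

(** * Covers of the line *)

Section ProjectiveCurve.
Variables (K : numClosedFieldType) (N : nat) (C : proj K N -> Prop) (g : nat).
Hypotheses (C_closed : zclosed C) (C_connected : zconnected C) (C_genus : genus C g).
Hypothesis C_unif : forall p, C p -> exists t, uniformizer C p t.
Hypothesis C_nontrivial : forall p, exists2 x, C x & x <> p.

Let G := @proj_graded K N.

Definition cpt : eqType := {classic {x : proj K N | C x}}.
Implicit Types (p y : cpt).
Definition cval p : proj K N := projT1 (p : {x : proj K N | C x}).
Definition cmk x (Cx : C x) : cpt := exist C x Cx.

Lemma cvalP p : C (cval p). Proof. exact: (projT2 (p : {x | C x})). Qed.

Lemma cval_inj : injective cval.
Proof. by move=> [x Cx] [y Cy]; rewrite /cval /= => E; subst y; rewrite (Prop_irrelevance Cx Cy). Qed.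

Lemma cvalK x (Cx : C x) : cval (cmk Cx) = x. Proof. by []. Qed.

Lemma cval_ex x : C x -> exists p, cval p = x.
Proof. by move=> Cx; exists (cmk Cx). Qed.

Definition cco p (i : 'I_N.+1) : K := coords (cval p) i.

Lemma fm_form k F : fm cco k F <-> exists2 f, @form K (proj K N) k f & forall p, F p = f (cval p).
Proof.
split=> [[Q hQ E]|[f [Q hQ fE] E]]; last by exists Q => // y; rewrite E fE.
by exists (fun x => Q.@[coords x]) => //; exists Q.
Qed.

Lemma form_fm k f : @form K (proj K N) k f -> fm cco k (fun p => f (cval p)).
Proof. by move=> hf; apply/fm_form; exists f. Qed.

Lemma nbhd_near p (Q : proj K N -> Prop) :
  near C (cval p) Q <-> nbhd cco p (fun y => Q (cval y)).
Proof.
split=> [/nearE[k [c [hc cp cQ]]]|[k [c [/fm_form[f hf E] cp cQ]]]].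
  exists k, (fun y => c (cval y)); split=> //; first exact: form_fm.
  by move=> y; apply/cQ/cvalP.
apply/nearE; exists k, f; split=> //; first by rewrite -E.
by move=> x Cx; rewrite -(cvalK Cx) -E => /cQ.
Qed.

Lemma cco_neq0 p : exists i, cco p i != 0. Proof. exact: coords_neq0. Qed.

Lemma cco_inj p q : (forall i j, cco p i * cco q j = cco p j * cco q i) -> p = q.
Proof. by move=> E; apply/cval_inj/point_eq_cross. Qed.

(** The numerator of a uniformizer serves as the form a. A form of degree m vanishing at p becomes a
    function on division by the m-th power of a coordinate; this is a multiple of the uniformizer,
    and clearing denominators gives the relation between forms. *)
Lemma cco_unif p : exists t : nat * (cpt -> K) * (cpt -> K), unif_form cco p t.1.1 t.1.2 t.2.
Proof.
have [t [[k [s [s' [hs hs' n]]]] t0 ut]] := C_unif (cvalP p).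
have [s'0 tE] := near_at (cvalP p) n.
have sp : s (cval p) = 0.
  by move/eqP: t0; rewrite tE mulf_eq0 invr_eq0 (negPf s'0) orbF => /eqP.
exists (k, fun y => s (cval y), fun y => s' (cval y)); split=> //=; try exact: form_fm.
move=> m F /fm_form[f hf FE] Fp; have [i pi] := coords_neq0 (cval p).
pose l (x : proj K N) := coords x i ^+ m.
have hl : @form K (proj K N) m l := form_expL m (form_coord _ i).
have lp : l (cval p) != 0 by rewrite expf_neq0.
have [||v [e [a [b [ha hb nv]]]] nE] := ut (fun x => f x / l x).
- exact: (regular_ratio _ hf hl lp).
- by rewrite -FE Fp mul0r.
have [j [c [hc cp cQ]]] := (nearE _ _ _).1
  (near_and G (near_and G (near_and G n nv) nE) (near_form C hl lp)).
have [bp _] := near_at (cvalP p) nv.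
exists (e + k + j)%N, (fun y => b (cval y) * s' (cval y) * c (cval y)).
exists (m + e + j)%N, (fun y => l (cval y) * a (cval y) * c (cval y)); split.
- exact: (form_fm (form_mul G (form_mul G hb hs') hc)).
- by rewrite !mulf_neq0.
- exact: (form_fm (form_mul G (form_mul G hl ha) hc)).
- lia.
move=> y; have [->|cy] := eqVneq (c (cval y)) 0; first by rewrite !mulr0 mul0r.
have [[[[s'y ty] [by0 vy]] E] ly] := cQ _ (cvalP y) cy.
have {}E : F y = a (cval y) / b (cval y) * (s (cval y) / s' (cval y)) * l (cval y).
  by rewrite -vy -ty -E FE; field.
by rewrite E; field; rewrite s'y by0.
Qed.

Definition unif_data p := projT1 (cid (cco_unif p)).
Definition udeg p := (unif_data p).1.1.
Definition unum p := (unif_data p).1.2.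
Definition uden p := (unif_data p).2.

Lemma unif_dataP p : unif_form cco p (udeg p) (unum p) (uden p).
Proof. exact: (projT2 (cid (cco_unif p))). Qed.

(** An isolated p would split C into p and the zero locus of a form; [C_nontrivial] rules out that C
    is p alone. *)
Lemma cco_nonisolated p Q : nbhd cco p Q -> exists2 y, y != p & Q y.
Proof.
move=> [k [c [/fm_form[f hf E] cp cQ]]]; apply: contrapT => H.
have cl : zclosed (fun x => f x = 0).
  exists (eq f) => [_ <-|x]; first by exists k.
  by split=> [fx _ <-|/(_ _ erefl)].
case: (C_connected.2 _ _ cl (point_closed (cval p))) => [x Cx|x Cx [fx xp]|F|F].
- have [->|/eqP fx] := eqVneq (f x) 0; [by left|right].
  rewrite -(cvalK Cx); congr cval; apply/eqP/negPn/negP => ne; apply: H.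
  by exists (cmk Cx) => //; apply: cQ; rewrite E; apply/eqP.
- by move: cp; rewrite E -xp fx eqxx.
- by move: cp; rewrite E F ?eqxx //; apply: cvalP.
have [x Cx xp] := C_nontrivial (cval p); exact/xp/F.
Qed.

Definition gen_deg := projT1 (cid C_genus).
Definition gen_k0 := projT1 (cid (projT2 (cid C_genus))).

Lemma cco_hilbert k : (gen_k0 <= k)%N -> exists2 h, form_basis cco k h & (h + g = gen_deg * k + 1)%N.
Proof.
move=> hk; have [h [s [hs inds ss]] E] := projT2 (cid (projT2 (cid C_genus))) k hk.
exists h => //; exists (fun i p => s i (cval p)); split.
- by move=> i; apply/form_fm/hs.
- move=> c H; apply: inds => x Cx; exact: (H (cmk Cx)).
- move=> F /fm_form[f hf FE]; have [c cE] := ss f hf; exists c => y.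
  by rewrite FE cE //; apply: cvalP.
Qed.

Lemma cco_connected (S1 S2 : (cpt -> K) -> Prop) :
  (forall F, S1 F -> exists k, fm cco k F) -> (forall F, S2 F -> exists k, fm cco k F) ->
  (forall p, zeros_of S1 p \/ zeros_of S2 p) -> (forall p, ~ (zeros_of S1 p /\ zeros_of S2 p)) ->
  (forall p, zeros_of S1 p) \/ (forall p, zeros_of S2 p).
Proof.
move=> h1 h2 cov dis.
pose ext (S : (cpt -> K) -> Prop) (f : proj K N -> K) :=
  (exists k, form k f) /\ S (fun p => f (cval p)).
have extP S p : (forall F, S F -> exists k, fm cco k F) ->
    (forall f, ext S f -> f (cval p) = 0) <-> zeros_of S p.
  move=> hS; split=> [H F SF|H f [_ /H //]].
  have [k /fm_form[f hf E]] := hS _ SF; rewrite E; apply: H; split; first by exists k.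
  by rewrite (_ : (fun p => _) = F) //; apply/funext => y; rewrite E.
have cl S : zclosed (fun x => forall f, ext S f -> f x = 0).
  by exists (ext S) => // f [].
case: (C_connected.2 _ _ (cl S1) (cl S2)) => [x Cx|x Cx [z1 z2]|H|H].
- by case: (cov (cmk Cx)) => /extP H; [left|right]; apply: H.
- by apply: (dis (cmk Cx)); split; apply/extP.
- by left=> p; apply/extP => // f; apply: H; apply: cvalP.
- by right=> p; apply/extP => // f; apply: H; apply: cvalP.
Qed.

Lemma cco_closed (xi : 'I_N.+1 -> K) : (exists i, xi i != 0) ->
  (forall k (Q : {mpoly K[N.+1]}), Q \is k.-homog -> (forall y, Q.@[cco y] = 0) -> Q.@[xi] = 0) ->
  exists y c, forall i, xi i = c * cco y i.
Proof.
move=> /point_ex[x [c ce E]] H; have [S hS SE] := C_closed.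
have Cx : C x.
  apply/SE => f Sf; have [k [Q hQ fQ]] := hS f Sf.
  rewrite fQ (meval_eq _ E) (homog_scale _ _ hQ) (H k Q hQ) ?mulr0 // => y.
  by rewrite -fQ; apply: (SE _).1 Sf; apply: cvalP.
exists (cmk Cx), c^-1 => i.
by rewrite /cco cvalK E mulKf.
Qed.

Definition base_pt : cpt := let: exist x Cx := cid C_connected.1 in cmk Cx.

Definition pcurve : abs_curve K :=
  form_curve cco_neq0 cco_inj unif_dataP cco_nonisolated base_pt cco_hilbert cco_connected cco_closed.

Lemma pcurve_riemann : riemann_ineq pcurve g.
Proof. exact: form_curve_riemann. Qed.

Lemma pcurve_fg : finitely_generated pcurve.
Proof. exact: form_curve_fg. Qed.

Lemma near_cofin p (Q : proj K N -> Prop) : near C (cval p) Q -> cofin (fun y : pcurve => Q (cval y)).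
Proof.
move=> /nbhd_near[k [c [hc cp cQ]]]; apply: cofin_sub cQ.
apply: (fm_cofin cco_neq0 cco_inj unif_dataP cco_nonisolated cco_hilbert cco_connected hc).
by exists p.
Qed.

Lemma cofin_near p (Q : proj K N -> Prop) :
  cofin (fun y : pcurve => Q (cval y)) -> Q (cval p) -> near C (cval p) Q.
Proof.
move=> [s sQ] Qp; apply/nbhd_near.
have [|k [c [hc cp cs]]] := avoid_points cco_inj (p := p) (s := [seq y <- s | y != p]).
  by rewrite mem_filter eqxx.
exists k, c; split=> // y cy; have [->//|yp] := eqVneq y p; apply: sQ.
by apply: contraNN cy => ys; rewrite cs // mem_filter yp.
Qed.

Lemma hv_forms p (F : pcurve -> K) a : hv (a0 := pcurve) p F a -> exists k s t,
  [/\ @form K (proj K N) k s, @form K (proj K N) k t, t (cval p) != 0, s (cval p) = a * t (cval p) &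
      cofin (fun y : pcurve => t (cval y) != 0 /\ F y = s (cval y) / t (cval y))].
Proof.
move=> [k [S [T [/fm_form[s hs sE] /fm_form[t ht tE] T0 ST E]]]]; exists k, s, t.
rewrite -sE -tE; split=> //.
have tn : near C (cval p) (fun x => t x != 0) by apply: near_form ht _; rewrite -tE.
apply: cofin_sub (cofin_and E (near_cofin tn)) _ => y [FE ty].
by split=> //; rewrite -sE -FE tE mulfK.
Qed.

Lemma regular_hv p (F : proj K N -> K) :
  regular_at C (cval p) F <-> hv (a0 := pcurve) p (fun y => F (cval y)) (F (cval p)).
Proof.
split=> [[k [s [t [hs ht n]]]]|/hv_forms[k [s [t [hs ht t0 st E]]]]].
  exists k, (fun y => s (cval y)), (fun y => t (cval y)); have [t0 FE] := near_at (cvalP p) n.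
  split=> //; try exact: form_fm; first by rewrite FE divfK.
  by apply: cofin_sub (near_cofin n) _ => y [ty ->]; rewrite divfK.
exists k, s, t; split=> //.
apply: cofin_near; first by apply: cofin_sub E _.
by rewrite st mulfK.
Qed.

Definition cext (F : pcurve -> K) (x : proj K N) : K :=
  if pselect (C x) is left Cx then F (cmk Cx) else 0.

Lemma cextE F p : cext F (cval p) = F p.
Proof.
rewrite /cext; case: pselect => [Cx|]; last by move/(_ (cvalP p)).
by congr F; apply: cval_inj; rewrite cvalK.
Qed.

Lemma cext_regular p F : hv (a0 := pcurve) p F (F p) -> regular_at C (cval p) (cext F).
Proof.
move=> H; apply/regular_hv; rewrite cextE.
by apply: hv_ext H _ _ => // y; rewrite cextE.
Qed.

(** The order of t is at least 1, and the abstract uniformizer is a regular multiple of t, so it is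
    at most 1. *)
Lemma uniformizer_ord p t : uniformizer C (cval p) t ->
  ordeq (X := pcurve) p 1 (fun y => t (cval y)).
Proof.
move=> [rt t0 ut]; move/regular_hv: (rt); rewrite t0 => /hv_ordge1 t1.
have u0 : cext (unif (a0 := pcurve) p) (cval p) = 0.
  rewrite cextE /= /funif; have [_ _ -> _ _] := unif_dataP p; exact: mul0r.
have ru : regular_at C (cval p) (cext (unif (a0 := pcurve) p)).
  apply: cext_regular; have := hv_unif (a0 := pcurve) p.
  by rewrite -{1}u0 cextE.
have [v /regular_hv rv /near_cofin nv] := ut _ ru u0.
have o1 := ordeq_unif (X := pcurve) p 1.
have [n nt] : exists n, ordeq (X := pcurve) p n (fun y => t (cval y)).
  apply: ordeq_ex; first exact: ordge_rat t1.
  move=> t_ae0; apply: (ordeq_not0 o1); apply: cofin_sub (cofin_and nv t_ae0) _ => y [].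
  by rewrite cextE => -> ->; rewrite mulr0 expr1z.
have n1 := ordge_eq_le t1 nt.
suff : (n <= 1)%R by move=> n2; have <- : n = 1 by lia.
rewrite -[n]add0r; apply: ordge_eq_le o1.
have v0 : ordge (X := pcurve) p 0 (fun y => v (cval y)).
  by apply/ordge0E; exists (v (cval p)).
apply: ordge_ae (ordgeM v0 (ordeq_ge nt)) _.
by apply: cofin_sub nv _ => y; rewrite cextE => ->; rewrite expr1z.
Qed.

Lemma cext_unif p : uniformizer C (cval p) (cext (unif (a0 := pcurve) p)).
Proof.
have u0 : unif (a0 := pcurve) p p = 0.
  by rewrite /= /funif; have [_ _ -> _ _] := unif_dataP p; exact: mul0r.
split; [|by rewrite cextE|move=> f /regular_hv rf f0].
  by apply: cext_regular; rewrite [X in hv _ _ X]u0; apply: hv_unif.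
move: rf; rewrite f0 => /hv_ordge1[a /hv_forms[k [s [t [hs ht t0 st E]]]]].
exists (fun x => s x / t x); first exact: (regular_ratio _ hs ht t0).
apply: cofin_near; last by rewrite cextE u0 mulr0.
apply: cofin_sub (cofin_and E (unif_ne0 (a0 := pcurve) p)) _ => y [[ty H] uy].
by rewrite -H cextE exprN1 divfK.
Qed.
End ProjectiveCurve.

(** * Ramification indices as orders, and covers defined by functions *)

Section CoverCurve.
Variables (K : numClosedFieldType) (N : nat) (C : proj K N -> Prop) (g : nat).
Hypotheses (C_closed : zclosed C) (C_connected : zconnected C) (C_genus : genus C g).
Hypothesis C_unif : forall p, C p -> exists t, uniformizer C p t.
Hypothesis C_nontrivial : forall p, exists2 x, C x & x <> p.
Local Notation X := (pcurve C_closed C_connected C_genus C_unif C_nontrivial).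
Local Notation L := (proj K 1).
Local Notation W := (@whole L).
Local Notation cval := (@cval K N C).

Let G := @proj_graded K N.

Let regular_value (p : X) F : regular_at C (cval p) F -> hv p (fun y : X => F (cval y)) (F (cval p)).
Proof. by move/regular_hv; apply. Qed.

Let near_generic (p : X) Q : near C (cval p) Q -> cofin (fun y : X => Q (cval y)).
Proof. exact: near_cofin. Qed.

Let generic_near (p : X) Q : cofin (fun y : X => Q (cval y)) -> Q (cval p) -> near C (cval p) Q.
Proof. exact: cofin_near. Qed.

Section Ramification.
Variable pi : proj K N -> L.
Implicit Types (p y : X) (q : L).

(** Two local parameters are regular multiples of each other. This frees the ramification index from
    the parameter chosen in its definition. *)
Lemma ord_uniformizer p z z' (n : int) : morphism C W pi ->
  uniformizer W (pi (cval p)) z -> uniformizer W (pi (cval p)) z' ->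
  ordeq p n (fun y => z (pi (cval y))) -> ordeq p n (fun y => z' (pi (cval y))).
Proof.
move=> mpi [rz z0 dz] [rz' z'0 dz'] on; have Cp := cvalP p.
have [w rw nw] := dz' _ rz z0; have [w' rw' nw'] := dz _ rz' z'0.
have pull u : regular_at W (pi (cval p)) u -> ordge p 0 (fun y => u (pi (cval y))).
  move=> ru; apply/ordge0E; exists (u (pi (cval p))).
  exact: (regular_value (regular_comp G mpi Cp ru)).
have e := near_generic (near_comp G mpi Cp nw).
have e' := near_generic (near_comp G mpi Cp nw').
have ge : ordge p n (fun y => z' (pi (cval y))).
  rewrite -[n]add0r; apply: ordge_ae (ordgeM (pull _ rw') (ordeq_ge on)) _.
  by apply: cofin_sub e' _ => y ->.
have [m om] : exists m, ordeq p m (fun y => z' (pi (cval y))).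
  apply: ordeq_ex (ordge_rat ge) _ => H; apply: (ordeq_not0 on).
  by apply: cofin_sub (cofin_and e H) _ => y [-> ->]; rewrite mulr0.
suff mn : (m <= n)%R by have <- : m = n; [have := ordge_eq_le ge om; lia|].
apply: ordge_eq_le on; rewrite -[m]add0r; apply: ordge_ae (ordgeM (pull _ rw) (ordeq_ge om)) _.
by apply: cofin_sub e _ => y ->.
Qed.

Lemma ram_ord p e z : morphism C W pi -> ramification_index C pi (cval p) e ->
  uniformizer W (pi (cval p)) z -> ordeq p e%:Z (fun y => z (pi (cval y))).
Proof.
move=> mpi [z' [t [v [uz' ut rv v0 n]]]] uz; apply: (ord_uniformizer mpi uz' uz).
have ot := uniformizer_ord C_closed C_connected C_genus C_unif C_nontrivial ut.
have ov : ordeq p 0 (fun y : X => v (cval y)).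
  by apply/ordeq0E; exists (v (cval p)) => //; exact: (regular_value rv).
have := ordeqM ov (ordeq_exp e ot); rewrite add0r mul1r => /ordeq_ae; apply.
by apply: cofin_sub (near_generic n) _ => y ->.
Qed.

Lemma ord_ram p (e : nat) z : (0 < e)%N -> uniformizer W (pi (cval p)) z ->
  ordeq p e%:Z (fun y => z (pi (cval y))) -> ramification_index C pi (cval p) e.
Proof.
move=> e0 uz [a a0 /hv_forms[k [s [t [hs ht t0 st E]]]]].
exists z, (cext (unif (a0 := X) p)), (fun x => s x / t x); split=> //.
- exact: cext_unif.
- exact: (regular_ratio _ hs ht t0).
- by rewrite st mulfK.
have [_ z0 _] := uz; have [_ u0 _] := cext_unif C_closed C_connected C_genus C_unif C_nontrivial p.
apply: generic_near; last by rewrite z0 u0 expr0n eqn0Ngt e0 mulr0.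
apply: cofin_sub (cofin_and E (unif_ne0 p)) _ => y [[ty <-] uy].
by rewrite cextE -[unif p y ^+ e]/(unif p y ^ e%:Z) -mulrA -expfzDr // addNr expr0z mulr1.
Qed.

Lemma profile_list q s : profile C pi q s -> exists T : seq X,
  [/\ uniq T, size T = size s, forall p, p \in T <-> pi (cval p) = q &
      forall p, p \in T -> ramification_index C pi (cval p) (nth 0%N s (index p T))].
Proof.
move=> [a [ia fa ra]].
have /choice[b Hb] : forall i, exists p : X, cval p = a i.
  by move=> i; have [Ca _] := (fa (a i)).2 (ex_intro _ i erefl); apply: (cval_ex Ca).
have ib : injective b by move=> i j E; apply: ia; rewrite -!Hb E.
exists [seq b i | i <- enum 'I_(size s)]; split.
- by rewrite map_inj_uniq ?enum_uniq.
- by rewrite size_map size_enum_ord.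
- move=> p; split=> [/mapP[i _ ->]|E].
    by rewrite Hb; have [] := (fa (a i)).2 (ex_intro _ i erefl).
  have [i E'] := (fa (cval p)).1 (conj (cvalP p) E).
  by apply/mapP; exists i; rewrite ?mem_enum //; apply: cval_inj; rewrite Hb.
- by move=> p /mapP[i _ ->]; rewrite index_map // index_enum_ord Hb.
Qed.

Lemma list_profile q (T : seq X) (e : X -> nat) : uniq T ->
  (forall p, p \in T <-> pi (cval p) = q) ->
  (forall p, p \in T -> ramification_index C pi (cval p) (e p)) -> profile C pi q (map e T).
Proof.
move=> uT fT rT; have p0 : X := base_pt C_connected.
have sT (i : 'I_(size (map e T))) : (i < size T)%N by rewrite -(size_map e).
exists (fun i => cval (nth p0 T i)); split.
- move=> i j /cval_inj/eqP; rewrite nth_uniq // => /eqP; exact: val_inj.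
- move=> x; split=> [[Cx E]|[i ->]]; last by split; [exact: cvalP|apply/fT; rewrite mem_nth].
  have xT : cmk Cx \in T by apply/fT.
  have xi : (index (cmk Cx) T < size (map e T))%N by rewrite size_map index_mem.
  by exists (Ordinal xi); rewrite /= nth_index.
- by move=> i; rewrite (nth_map p0) //; apply/rT/mem_nth.
Qed.
End Ramification.

Section MapOfFunction.
Variables (q : L) (r0 r1 : K).
Hypothesis det1 : c0 q * r1 - c1 q * r0 = 1.
Local Notation A := (acoord q r0 r1).
Implicit Types (D : seq X) (F f h : X -> K) (p y : X).

(* The map to the line with affine coordinate F and fibre D over q. *)
Definition fun_map D F (x : proj K N) : L :=
  if pselect (C x) is left Cx then
    if (cmk Cx : X) \in D then q else apoint q r0 r1 (F (cmk Cx)) 1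
  else q.

Lemma fun_mapE D F p : fun_map D F (cval p) = if p \in D then q else apoint q r0 r1 (F p) 1.
Proof.
rewrite /fun_map; case: pselect => [Cx|]; last by move/(_ (cvalP p)).
by rewrite (_ : cmk Cx = p) //; apply: cval_inj; rewrite cvalK.
Qed.

Lemma fun_map_q D F p : p \in D <-> fun_map D F (cval p) = q.
Proof. by rewrite fun_mapE; case: ifP => // _; split=> // /(apoint_neq det1). Qed.

Lemma fun_map_fin D F p : p \notin D -> fun_map D F (cval p) <> q /\ A (fun_map D F (cval p)) = F p.
Proof. by move=> pD; rewrite fun_mapE (negPf pD) (apointK det1); split=> //; apply: apoint_neq. Qed.

(** Near p one has f = u / w and h = v / w with forms independent of l, so the cover of f + l h is
    [u + l v : w] for all l at once. This serves each single cover and, with l as a variable, the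
    family over the line. At a point of D, full pole order keeps u + l v nonzero. *)
Lemma local_pencil D f h p :
  (forall y, y \notin D -> hv y f (f y)) -> (forall y, y \notin D -> hv y h (h y)) ->
  LL D f -> LL D h ->
  exists k (u v w : proj K N -> K), [/\ @form K (proj K N) k u, @form K (proj K N) k v,
    @form K (proj K N) k w,
    p \in D -> forall l, ordeq p (- (count_mem p D)%:Z) (pencil f h l) ->
      u (cval p) + l * v (cval p) != 0 &
    near C (cval p) (fun x => forall y, cval y = x -> if y \in D then y = p /\ w x = 0
      else [/\ w x != 0, f y = u x / w x & h y = v x / w x])].
Proof.
move=> vf vh Lf Lh; have [pD|pD] := boolP (p \in D); last first.
  have [k [s [t [hs ht t0 st E]]]] := hv_forms (vf p pD).
  have [k' [s' [t' [hs' ht' t0' st' E']]]] := hv_forms (vh p pD).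
  exists (k + k')%N, (fun x => s x * t' x), (fun x => t x * s' x), (fun x => t x * t' x).
  split=> //; try exact: (form_mul G).
  apply: generic_near; last first.
    move=> y /cval_inj ->; rewrite (negPf pD) mulf_neq0 //; split=> //; rewrite ?st ?st'; field;
    by rewrite t0 t0'.
  apply: cofin_sub (cofin_and (cofin_notin D) (cofin_and E E')) _ => z [zD [[tz fz] [tz' hz]]].
  move=> y /cval_inj ->; rewrite (negPf zD) mulf_neq0 //; split=> //; rewrite ?fz ?hz; field;
  by rewrite tz tz'.
(* The n-th power of the uniformizer U / V clears the poles of f and h; its numerator goes into the
   common denominator w. *)
pose n := count_mem p D; have n0 : (0 < n)%N by rewrite -has_count has_pred1.
have [a fa] := Lf p; have [b hb] := Lh p.
have [k [s [t [hs ht t0 st E]]]] := hv_forms fa.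
have [k' [s' [t' [hs' ht' t0' st' E']]]] := hv_forms hb.
have [/fm_form[U hU UE] /fm_form[V hV VE] U0 V0 _] := unif_dataP C_unif p.
have hVn := form_exp G n hV; have hUn := form_exp G n hU.
exists (k + k' + @dmul K (proj K N) addn 0%N n (udeg C_unif p))%N, (fun x => s x * t' x * V x ^+ n),
  (fun x => t x * s' x * V x ^+ n), (fun x => t x * t' x * U x ^+ n).
split; try by do 2?apply: (form_mul G).
  move=> _ l [c ce hc].
  have Eab : a + l * b = c.
    apply: hv_uniq (hv_add fa (hv_mul (hv_const p l) hb)) (hv_ext hc _ _) => // y.
    by rewrite /pencil mulrDl mulrA.
  have V0' : V (cval p) ^+ n != 0 by rewrite expf_neq0 // -VE.
  move: t0 t0' V0'; move: st st'; rewrite /=.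
  move: (s _) (t _) (s' _) (t' _) (_ ^+ n) => s0 t1 s1 t1' Vn -> -> nt nt' nV.
  have -> : a * t1 * t1' * Vn + l * (t1 * (b * t1') * Vn) = (a + l * b) * (t1 * t1' * Vn) by ring.
  by rewrite Eab !mulf_neq0.
apply: generic_near; last first.
  by move=> y /cval_inj ->; rewrite pD -UE U0 expr0n eqn0Ngt n0 mulr0.
apply: cofin_sub (cofin_and (cofin_notin D) (cofin_and (unif_ne0 p) (cofin_and E E'))) _.
move=> z [zD [uz [[tz fz] [tz' hz]]]] y /cval_inj ->; rewrite (negPf zD).
have uzE : unif p z = U (cval z) / V (cval z) by rewrite -UE -VE.
have [Uz Vz] : U (cval z) != 0 /\ V (cval z) != 0.
  by move: uz; rewrite uzE mulf_eq0 invr_eq0 negb_or => /andP[].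
have uzn : unif p z ^ (- - n%:Z) = U (cval z) ^+ n / V (cval z) ^+ n.
  by rewrite opprK uzE -exprnP expr_div_n.
move: fz hz; rewrite -/n uzn => fz hz.
have [Un Vn] : U (cval z) ^+ n != 0 /\ V (cval z) ^+ n != 0 by rewrite !expf_neq0.
have solve (u v c d : K) : u != 0 -> v != 0 -> c * (u / v) = d -> c = d * (v / u).
  by move=> x0 y0 <-; field; rewrite x0 y0.
rewrite (solve _ _ _ _ Un Vn fz) (solve _ _ _ _ Un Vn hz) {solve fz hz uzn uzE}.
move: tz tz' Un Vn; rewrite /=.
move: (s _) (t _) (s' _) (t' _) (U _ ^+ n) (V _ ^+ n) => s0 t1 s1 t1' Un Vn nt nt' nU nV.
by split; [rewrite !mulf_neq0|field|field]; rewrite ?nt ?nt' ?nU.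
Qed.
Lemma apoint_coords a b : (a, b) != (0, 0) -> exists2 c, c != 0 &
  c0 (apoint q r0 r1 a b) = c * (a * c0 q + b * r0) /\ c1 (apoint q r0 r1 a b) = c * (a * c1 q + b * r1).
Proof.
move=> ab; have [c ce [E E']] := apointE det1 ab; exists c => //.
by rewrite [LHS](c0E det1) [X in _ /\ X = _](c1E det1) E E'; split; ring.
Qed.

Definition rvec (i : 'I_2) : K := if i == ord0 then r0 else r1.

Lemma fun_map_coords D F y (u w : K) :
  (if y \in D then u != 0 /\ w = 0 else w != 0 /\ F y = u / w) ->
  exists c, forall i, coords (fun_map D F (cval y)) i = c * (u * coords q i + w * rvec i).
Proof.
rewrite fun_mapE; case: (y \in D) => -[].
  by move=> u0 ->; exists u^-1 => i; rewrite mul0r addr0 mulKf.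
move=> w0 ->; have [c ce [E0 E1]] := apoint_coords (pair1_neq0 (u / w)).
exists (c / w) => i; by case: (ord2 i) => ->; [apply: etrans E0 _|apply: etrans E1 _]; rewrite /rvec /c0 /c1 /=; field.
Qed.

Lemma fun_map_morphism D f h l :
  (forall y, y \notin D -> hv y f (f y)) -> (forall y, y \notin D -> hv y h (h y)) ->
  LL D f -> LL D h -> poles D (pencil f h l) -> morphism C W (fun_map D (pencil f h l)).
Proof.
move=> vf vh Lf Lh pl; apply: morphism_intro => // x Cx.
have [k [u [v [w [hu hv' hw np nx]]]]] := local_pencil (cmk Cx : X) vf vh Lf Lh.
exists k, (fun i t => (u t + l * v t) * coords q i + w t * rvec i); split=> [i|].
  apply: form_ext (form_lin G (coords q i) (rvec i) (form_add G hu (form_scale G l hv')) hw) _ => t.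
  by rewrite [coords q i * _]mulrC [rvec i * _]mulrC.
apply: near_sub nx _ => t Ct /(_ (cmk Ct) erefl) H.
apply: (fun_map_coords (y := cmk Ct)); move: H; case: ifP => [tD [E ->]|tD [w0 fE hE]]; last first.
  by split=> //; rewrite /pencil fE hE; field.
split=> //; have Et : t = cval (cmk Cx : X) by rewrite -E.
by rewrite E in tD; rewrite Et; apply: np => //; apply: pl.
Qed.

Lemma sumn_count_undup (Z : seq X) : sumn [seq count_mem z Z | z <- undup Z] = size Z.
Proof.
rewrite sumnE big_map -sum1_size.
under eq_bigr => z _ do rewrite -sum1_count big_mkcond.
rewrite exchange_big /=; apply: eq_big_seq => x xZ.
rewrite -big_mkcond sum1_count (@eq_count _ _ (pred1 x)) => [|z]; last by rewrite /= eq_sym.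
by rewrite count_uniq_mem ?undup_uniq // mem_undup xZ.
Qed.

Section Fibres.
Variables (D : seq X) (F : X -> K).
Hypotheses (vF : forall y, y \notin D -> hv y F (F y)) (pF : poles D F) (D0 : D != [::]).
Local Notation m := (fun_map D F).

Lemma fun_map_ram p (e : nat) : p \notin D -> (0 < e)%N ->
  ordeq p e%:Z (fun x => F x - F p) -> ramification_index C m (cval p) e.
Proof.
move=> pD e0 oe; have [mq mA] := fun_map_fin F pD.
apply: (ord_ram e0 (acoord_uniformizer det1 mq)).
apply: ordeq_ae oe _; apply: cofin_sub (cofin_notin D) _ => y yD.
by have [_ ->] := fun_map_fin F yD; rewrite mA.
Qed.

Lemma fun_map_ram_pole p : p \in D -> ramification_index C m (cval p) (count_mem p D).
Proof.
move=> pD; have mq : m (cval p) = q by apply/fun_map_q.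
have e0 : (0 < count_mem p D)%N by rewrite -has_count has_pred1.
have uq : uniformizer W (m (cval p)) (fun t => (A t)^-1) by rewrite mq; exact: acoordV_uniformizer.
apply: (ord_ram e0 uq).
rewrite -[_%:Z]opprK; apply: ordeq_ae (ordeqV (pF pD)) _.
apply: cofin_sub (cofin_notin D) _ => y yD.
by have [_ ->] := fun_map_fin F yD.
Qed.

Lemma fibre_value Z c : (forall p, p \in D -> p \notin Z) ->
  (forall p, p \notin D -> ordeq p (count_mem p Z) (fun x => F x - c)) ->
  forall p, p \in Z <-> m (cval p) = apoint q r0 r1 c 1.
Proof.
move=> DZ oZ p; have vFc : p \notin D -> hv p (fun x => F x - c) (F p - c).
  by move=> pD; apply: hv_sub (vF pD) (hv_const p c).
split=> [pZ|E].
  have pD : p \notin D by apply: contraL pZ; apply: DZ.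
  rewrite fun_mapE (negPf pD); congr apoint; apply/eqP; rewrite -subr_eq0; apply/eqP.
  apply: hv_uniq (vFc pD) (ordge1_hv (ordge_le _ (ordeq_ge (oZ p pD)))).
  by rewrite lez_nat -has_count has_pred1.
have pD : p \notin D.
  by apply/negP => /(fun_map_q D F) mq; apply: (@apoint_neq _ _ _ _ det1 c); rewrite -E.
have [_] := fun_map_fin F pD; rewrite E (apointK det1) => Fp.
rewrite -has_pred1 has_count lt0n; apply/eqP => c_eq0.
have := oZ p pD; rewrite c_eq0 => /ordeq0E[a a0 /hv_uniq/(_ (vFc pD)) E'].
by rewrite E' Fp subrr eqxx in a0.
Qed.

Let RR := @pcurve_riemann K N C g C_closed C_connected C_genus C_unif C_nontrivial.

Lemma fun_map_fibre q' : q' <> q -> exists Z : seq X,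
  [/\ size Z = size D, forall p, p \in Z <-> m (cval p) = q',
      forall p, p \in Z -> p \notin D /\ ordeq p (count_mem p Z) (fun x => F x - F p) &
      forall p, p \in Z -> ramification_index C m (cval p) (count_mem p Z)].
Proof.
move=> qq; have [|Z [sZ DZ oZ]] := fibre_divisor RR (A q') D0 pF.
  by move=> p pD; exists (F p); apply: vF.
have fZ := fibre_value DZ oZ; rewrite (acoordK det1 qq) in fZ.
have pZ p : p \in Z -> p \notin D /\ ordeq p (count_mem p Z) (fun x => F x - F p).
  move=> pZ; have pD : p \notin D by apply: contraL pZ; apply: DZ.
  split=> //; have [_] := fun_map_fin F pD; rewrite (fZ p).1 // => <-; exact: oZ.
exists Z; split=> // p /[dup] pZ' /pZ[pD o]; apply: fun_map_ram o => //.
by rewrite -has_count has_pred1.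
Qed.

Lemma fun_map_degree : has_degree C m (size D).
Proof.
move=> q'; have [->|qq] := pselect (q' = q).
  exists [seq count_mem p D | p <- undup D]; last exact: sumn_count_undup.
  apply: list_profile; first exact: undup_uniq.
    by move=> p; rewrite mem_undup; apply: fun_map_q.
  by move=> p; rewrite mem_undup; apply: fun_map_ram_pole.
have [Z [sZ fZ _ rZ]] := fun_map_fibre qq.
exists [seq count_mem p Z | p <- undup Z]; last by rewrite sumn_count_undup.
apply: list_profile; first exact: undup_uniq.
  by move=> p; rewrite mem_undup; apply: fZ.
by move=> p; rewrite mem_undup; apply: rZ.
Qed.

Lemma simple_list_profile q' p (Z : seq X) : count_mem p Z = 2 ->
  (forall z, z \in Z -> z != p -> count_mem z Z = 1%N) ->
  (forall z, z \in Z <-> m (cval z) = q') ->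
  (forall z, z \in Z -> ramification_index C m (cval z) (count_mem z Z)) ->
  profile C m q' (2 :: nseq (size Z - 2) 1)%N.
Proof.
move=> cp cz fZ rZ; pose T := [seq z <- Z | z != p].
have pZ : p \in Z by rewrite -has_pred1 has_count cp.
have -> : (2 :: nseq (size Z - 2) 1)%N = [seq count_mem z Z | z <- p :: T].
  rewrite /= cp; congr cons; apply: (@eq_from_nth _ 0%N).
    by rewrite size_map size_nseq size_filter -(count_predC (pred1 p) Z) cp addKn.
  move=> i; rewrite size_nseq => iT.
  have sT : (size Z - 2)%N = size T by rewrite size_filter -(count_predC (pred1 p) Z) cp addKn.
  rewrite nth_nseq iT (nth_map p) -?sT //.
  have : nth p T i \in T by rewrite mem_nth -?sT.
  by rewrite mem_filter => /andP[ne zZ]; rewrite cz.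
have memT z : (z \in p :: T) = (z \in Z).
  rewrite inE mem_filter; have [->|//] := eqVneq z p; by rewrite pZ.
apply: list_profile => [|z|z]; rewrite ?memT //; try by [apply: fZ|apply: rZ].
rewrite /= mem_filter eqxx /=; apply: count_mem_uniq => z; rewrite count_filter mem_filter.
have [->|zp] := eqVneq z p; first by rewrite /= -(@eq_count _ pred0) ?count_pred0 // => y /=; case: eqP.
rewrite (@eq_count _ _ (pred1 z)); last by move=> y /=; case: eqP => // ->; rewrite zp.
have [zZ|zZ] := boolP (z \in Z); first by rewrite cz.
by apply/eqP; rewrite -leqn0 leqNgt -has_count has_pred1.
Qed.

(** Over q the profile is read off D. Over any other branch point [no_triple] bounds the
    multiplicities by 2 and [sep_ram] leaves room for one double point only. *)
Lemma fun_map_branch p1 (s : seq X) q' : D = [:: p1, p1 & s] -> uniq (p1 :: s) ->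
  morphism C W m -> no_triple D F -> sep_ram D F -> branch_point C m q' ->
  profile C m q' (2 :: nseq (size D - 2) 1)%N.
Proof.
move=> DE u mm nt sr [x [e [Cx mx rx e1]]].
have [qq|qq] := pselect (q' = q).
  have c1' z : z \in D -> z != p1 -> count_mem z D = 1%N.
    rewrite DE /= !inE eq_sym => + zp; rewrite (negPf zp) !orFb add0n add0n => zs.
    by move: u => /= /andP[_ us]; rewrite count_uniq_mem ?zs.
  apply: (simple_list_profile (p := p1)) => //.
  - move: u; rewrite DE /= eqxx => /andP[p1s _]; rewrite (_ : count_mem p1 s = 0)%N //.
    by apply/eqP; rewrite -leqn0 leqNgt -has_count has_pred1.
  - by rewrite qq; exact: fun_map_q.
  - exact: fun_map_ram_pole.
have [Z [sZ fZ oZ rZ]] := fun_map_fibre qq.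
have le2 z : z \in Z -> (count_mem z Z <= 2)%N.
  move=> /oZ[zD o]; rewrite leqNgt; apply/negP => H; apply: (nt z zD).
  by apply: ordge_le (ordeq_ge o); rewrite lez_nat.
have ram2 z : z \in Z -> (1 < count_mem z Z)%N -> ramif F z.
  by move=> /oZ[zD o] H; apply: ordge_le (ordeq_ge o); rewrite lez_nat.
have Fval z : z \in Z -> F z = A q'.
  by move=> /[dup]/oZ[zD _] /fZ E; have [_ <-] := fun_map_fin F zD; rewrite E.
have pos z : z \in Z -> (0 < count_mem z Z)%N by rewrite -has_count has_pred1.
have [p pE] := cval_ex Cx; have pZ : p \in Z by apply/fZ; rewrite pE.
have cp : count_mem p Z = 2.
  apply/eqP; rewrite eqn_leq le2 //; rewrite -pE in rx.
  have [mq _] := fun_map_fin F (oZ p pZ).1.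
  have o1 := ram_ord mm rx (acoord_uniformizer det1 mq).
  have o2 := ram_ord mm (rZ p pZ) (acoord_uniformizer det1 mq).
  by have [<-] := ordeq_uniq o1 o2.
rewrite -sZ; apply: (simple_list_profile (p := p)) => // z zZ zp.
apply/eqP; rewrite eqn_leq pos // andbT leqNgt; apply/negP => c2.
move/eqP: zp; apply; apply: sr (oZ z zZ).1 (oZ p pZ).1 (ram2 z zZ c2) (ram2 p pZ _) _.
  by rewrite cp.
by rewrite !Fval.
Qed.
End Fibres.
End MapOfFunction.
End CoverCurve.

(** * The function attached to a simple cover and a point of the line *)

Section SimpleCover.
Variables (K : numClosedFieldType) (g d N : nat) (C : proj K N -> Prop) (pi : proj K N -> proj K 1).
Hypotheses (d3 : (2 < d)%N) (hc : simple_cover g d (Cover N C pi)).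
Local Notation L := (proj K 1).
Local Notation W := (@whole L).
Let G := @proj_graded K N.

Lemma cov_closed : zclosed C. Proof. by case: hc => -[]. Qed.
Lemma cov_connected : zconnected C. Proof. by case: hc => -[]. Qed.
Lemma cov_genus : genus C g. Proof. by case: hc => -[]. Qed.
Lemma cov_morphism : morphism C W pi. Proof. by case: hc. Qed.
Lemma cov_degree : has_degree C pi d. Proof. by case: hc. Qed.
Lemma cov_branch q : branch_point C pi q -> profile C pi q (2 :: nseq (d - 2) 1)%N.
Proof. by case: hc => _ _ _ /(_ q). Qed.

(** The definition of a ramification index contains a uniformizer of C, and [cov_degree] gives every
    point an index. *)
Lemma cov_unif p : C p -> exists t, uniformizer C p t.
Proof.
move=> Cp; have [s [a [_ fa ra]] _] := cov_degree (pi p).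
have [i E] := (fa p).1 (conj Cp erefl).
by have [z [t [v [_ ut _ _ _]]]] := ra i; exists t; rewrite E.
Qed.

Lemma cov_nontrivial p : exists2 x, C x & x <> p.
Proof.
have [z zq _] : exists2 z, z <> pi p & True.
  have [r0 [r1 det1]] := det1_ex (pi p).
  by exists (apoint (pi p) r0 r1 0 1) => //; apply: apoint_neq.
have [s [a [_ fa _]] sd] := cov_degree z.
case: s a fa sd => [|e s] a fa sd; first by move: d3; rewrite -sd.
have [Cx xz] := (fa (a ord0)).2 (ex_intro _ ord0 erefl).
by exists (a ord0) => // E; apply: zq; rewrite -E xz.
Qed.

Local Notation X := (pcurve cov_closed cov_connected cov_genus cov_unif cov_nontrivial).
Local Notation cval := (@cval K N C).
Implicit Types (p y : X).

Section Pole.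
Variables (q : L) (r0 r1 : K).
Hypothesis det1 : c0 q * r1 - c1 q * r0 = 1.
Local Notation A := (acoord q r0 r1).

Definition cov_fun : X -> K := fun y => A (pi (cval y)).

Lemma cov_value p : pi (cval p) <> q -> hv p cov_fun (cov_fun p).
Proof.
move=> pq; have := (regular_hv cov_closed cov_connected cov_genus cov_unif cov_nontrivial p
  (fun x => A (pi x))).1; apply.
by apply: (regular_comp G cov_morphism (cvalP p)); exact: acoord_regular.
Qed.

Lemma cov_ord_fin p e : pi (cval p) <> q -> ramification_index C pi (cval p) e ->
  ordeq p e%:Z (fun x => cov_fun x - cov_fun p).
Proof. by move=> pq rp; apply: (ram_ord cov_morphism rp (acoord_uniformizer det1 pq)). Qed.

Lemma cov_ord_pole p e : pi (cval p) = q -> ramification_index C pi (cval p) e ->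
  ordeq p (- e%:Z) cov_fun.
Proof.
move=> pq rp; have uq : uniformizer W (pi (cval p)) (fun t => (A t)^-1).
  by rewrite pq; exact: acoordV_uniformizer.
apply: (ordeq_ae (ordeqV (ram_ord cov_morphism rp uq))).
by apply: cofin_all => y; rewrite invrK.
Qed.

Lemma cov_ramif p e : pi (cval p) <> q -> ramif cov_fun p ->
  ramification_index C pi (cval p) e -> (1 < e)%N.
Proof. by move=> pq rp /(cov_ord_fin pq) o; have := ordge_eq_le rp o; rewrite lez_nat. Qed.

Lemma cov_index p : exists e, ramification_index C pi (cval p) e.
Proof.
have [s ps _] := cov_degree (pi (cval p)); have [T [_ _ fT rT]] := profile_list
  cov_closed cov_connected cov_genus cov_unif cov_nontrivial ps.
by exists (nth 0%N s (index p T)); apply/rT/fT.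
Qed.

Lemma cov_index_gt0 p e : pi (cval p) = q -> ramification_index C pi (cval p) e -> (0 < e)%N.
Proof.
move=> pq [z [t [v [[_ z0 _] _ _ v0 n]]]]; rewrite lt0n; apply/eqP => e0.
have := near_at (cvalP p) n; rewrite z0 e0 expr0 mulr1 => /esym/eqP.
by rewrite (negPf v0).
Qed.

Lemma cov_branch_ramif p : pi (cval p) <> q -> ramif cov_fun p -> branch_point C pi (pi (cval p)).
Proof.
move=> pq rp; have [e re] := cov_index p; exists (cval p), e; split=> //; first exact: cvalP.
exact: cov_ramif rp re.
Qed.
End Pole.

Lemma simple_fibre q : branch_point C pi q -> exists p1 (s : seq X),
  [/\ uniq (p1 :: s), size s = (d - 2)%N, forall p, p \in p1 :: s <-> pi (cval p) = q,
      ramification_index C pi (cval p1) 2 &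
      forall p, p \in s -> ramification_index C pi (cval p) 1].
Proof.
move=> /cov_branch ps; have [[|p1 s] [uT sT fT rT]] := profile_list
  cov_closed cov_connected cov_genus cov_unif cov_nontrivial ps; first by [].
exists p1, s; split=> //.
- by move: sT; rewrite /= size_nseq => -[].
- by have := rT p1 (mem_head _ _); rewrite /= eqxx.
move=> p ps'; have := rT p; rewrite inE ps' orbT => /(_ isT) /=.
have -> : (p1 == p) = false by apply/eqP => E; move: uT; rewrite E /= ps'.
move: sT => /= [sT]; rewrite nth_nseq; rewrite size_nseq in sT.
by rewrite -sT index_mem ps'.
Qed.

Section Divisor.
Variables (q : L) (r0 r1 : K) (D : seq X).
Hypothesis det1 : c0 q * r1 - c1 q * r0 = 1.
Hypothesis fD : forall p, p \in D <-> pi (cval p) = q.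
Local Notation f := (cov_fun q r0 r1).

Lemma cov_notin p : p \notin D -> pi (cval p) <> q.
Proof. by move=> pD /fD E; rewrite E in pD. Qed.

Lemma cov_no_triple : no_triple D f.
Proof.
move=> p /cov_notin pq t3; have rp : ramif f p by apply: ordge_le t3.
have [p1 [s [_ _ fs r2 r1']]] := simple_fibre (cov_branch_ramif det1 pq rp).
have [e re le2] : exists2 e, ramification_index C pi (cval p) e & (e <= 2)%N.
  have := (fs p).2 erefl; rewrite inE => /orP[/eqP->|/r1' H]; [by exists 2|by exists 1%N].
have := ordge_eq_le t3 (cov_ord_fin det1 pq re).
by rewrite lez_nat ltnNge le2.
Qed.

(** Points outside D with the same value of f lie in one fibre, and a fibre of a simple cover
    contains at most one ramified point. *)
Lemma cov_sep_ram : sep_ram D f.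
Proof.
move=> p p' /cov_notin pq /cov_notin pq' rp rp' E.
have Epi : pi (cval p) = pi (cval p') by exact: (acoord_inj det1 pq pq' E).
have [p1 [s [_ _ fs r2 r1']]] := simple_fibre (cov_branch_ramif det1 pq rp).
have is_p1 y : pi (cval y) <> q -> ramif f y -> pi (cval y) = pi (cval p) -> y = p1.
  move=> yq ry /fs; rewrite inE => /orP[/eqP //|/r1' /(cov_ramif det1 yq ry)].
  by rewrite ltnn.
by rewrite (is_p1 p) // (is_p1 p').
Qed.

Lemma cov_values y : y \notin D -> hv y f (f y).
Proof. by move/cov_notin; apply: cov_value. Qed.
End Divisor.

Let RR := @pcurve_riemann K N C g cov_closed cov_connected cov_genus cov_unif cov_nontrivial.
Let FG := pcurve_fg cov_closed cov_connected cov_genus cov_unif cov_nontrivial.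

(** If a chosen q is not a branch point, its fibre is d distinct points, and [ramification_ex]
    applied to it finds ramification elsewhere. *)
Lemma branch_ex : (g + 1 < d)%N -> exists q, branch_point C pi q.
Proof.
move=> gd; have q : L := ppt 1 0; apply: contrapT => nb; apply: nb.
have [r0 [r1 det1]] := det1_ex q.
have [bq|nb] := pselect (branch_point C pi q); first by exists q.
have [s ps sd] := cov_degree q; have [T [uT sT fT rT]] := profile_list
  cov_closed cov_connected cov_genus cov_unif cov_nontrivial ps.
have e1 p : p \in T -> ramification_index C pi (cval p) 1.
  move=> pT; have := rT p pT; set e := nth _ _ _ => re; have pq := (fT p).1 pT.
  have e0 := cov_index_gt0 pq re; suff <- : e = 1%N by [].
  apply/eqP; rewrite eqn_leq e0 andbT leqNgt; apply/negP => e1; apply: nb.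
  by exists (cval p), e; split=> //; exact: cvalP.
have sT' : size T = d.
  rewrite sT -sd -sum1_size sumnE (big_nth 0%N) [RHS](big_nth 0%N) !big_mkord.
  apply: eq_bigr => i _; have iT : (i < size T)%N by rewrite sT.
  have p0 : X := base_pt cov_connected.
  have pT : nth p0 T i \in T by rewrite mem_nth.
  have := rT _ pT; rewrite index_uniq // => ri.
  have /ordeq_uniq := cov_ord_pole det1 ((fT _).1 pT) ri.
  by move=> /(_ _ (cov_ord_pole det1 ((fT _).1 pT) (e1 _ pT))) /oppr_inj[->].
have pT : poles T (cov_fun q r0 r1).
  move=> p pT; rewrite count_uniq_mem // pT.
  exact: (cov_ord_pole det1 ((fT _).1 pT) (e1 _ pT)).
have [|||||p pD rp] := ramification_ex RR FG (D := T) (f := cov_fun q r0 r1) => //.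
- by rewrite -size_eq0 sT' -lt0n; apply: leq_trans d3.
- by rewrite sT'.
- exact: (cov_values _ _ fT).
- exact: (cov_no_triple det1 fT).
exists (pi (cval p)); apply: (cov_branch_ramif det1) rp; exact: (cov_notin fT).
Qed.
End SimpleCover.

Lemma ram_iso (K : fieldType) n n' (C : proj K n -> Prop) (C' : proj K n' -> Prop) pi pi' al be x e :
  isomorphism (@whole (proj K 1)) (@whole _) be -> isomorphism C C' al ->
  (forall y, C y -> pi' (al y) = be (pi y)) -> C x ->
  ramification_index C' pi' (al x) e -> ramification_index C pi x e.
Proof.
move=> ib ia E Cx [z [t [v [uz ut rv v0 n0]]]]; have [ma _] := ia; have G := @proj_graded K n.
exists (fun y => z (be y)), (fun y => t (al y)), (fun y => v (al y)); split=> //.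
- by apply: (uniformizer_iso ib) => //; rewrite -E.
- exact: (uniformizer_iso ia).
- exact: (regular_comp G ma Cx rv).
by apply: near_sub (near_comp G ma Cx n0) _ => y Cy; rewrite E.
Qed.

(* [1 : l] lies in [line_base B] when l is not in B. *)
Definition par (K : fieldType) (b : proj K 1) : K := c1 b / c0 b.
Definition line_base (K : fieldType) (B : seq K) (b : proj K 1) : Prop := c0 b != 0 /\ par b \notin B.

(** * The pencil of covers of a fixed curve *)

Section PencilMaps.
Variables (K : numClosedFieldType) (g d N : nat) (C : proj K N -> Prop) (pi : proj K N -> proj K 1).
Hypotheses (d3 : (2 < d)%N) (hc : simple_cover g d (Cover N C pi)).
Local Notation L := (proj K 1).
Local Notation W := (@whole L).
Let G := @proj_graded K N.
Let GL := @proj_graded K 1.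
Local Notation X := (pcurve (cov_closed hc) (cov_connected hc) (cov_genus hc) (cov_unif hc) (cov_nontrivial d3 hc)).
Local Notation cval := (@cval K N C).
Variables (q : L) (r0 r1 : K) (D : seq X) (p1 : X) (s : seq X).
Hypothesis det1 : c0 q * r1 - c1 q * r0 = 1.
Local Notation f := (@cov_fun K g d N C pi d3 hc q r0 r1).
Local Notation A := (acoord q r0 r1).
Hypotheses (DE : D = [:: p1, p1 & s]) (us : uniq (p1 :: s)) (sD : size D = d).
Hypothesis fD : forall p, p \in D <-> pi (cval p) = q.
Hypothesis pf : poles D f.
Variables (h : X -> K) (B : seq K).
Hypotheses (Lh : LL D h) (vh : forall p, p \notin D -> hv p h (h p)).
Hypothesis goodB : forall l, l \notin B ->
  [/\ poles D (pencil f h l), no_triple D (pencil f h l) & sep_ram D (pencil f h l)].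
Implicit Types (p y : X) (l m : K).

Let FG := pcurve_fg (cov_closed hc) (cov_connected hc) (cov_genus hc) (cov_unif hc) (cov_nontrivial d3 hc).

Let regular_value p F : regular_at C (cval p) F -> hv p (fun y => F (cval y)) (F (cval p)).
Proof. by move/(regular_hv (cov_closed hc) (cov_connected hc) (cov_genus hc) (cov_unif hc) (cov_nontrivial d3 hc)). Qed.

Let D0 : D != [::]. Proof. by rewrite DE. Qed.

Definition pmap l : proj K N -> L := fun_map q r0 r1 D (pencil f h l).

Let vf p : p \notin D -> hv p f (f p). Proof. exact: cov_values fD p. Qed.

Let Lf : LL D f.
Proof.
move=> p; have [pD|pD] := boolP (p \in D); first exact: ordeq_ge (pf pD).
by rewrite (count_memPn pD); apply/ordge0E; exists (f p); apply: vf.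
Qed.

Lemma pencil_value l p : p \notin D -> hv p (pencil f h l) (pencil f h l p).
Proof. by move=> pD; apply: hv_add (vf pD) (hv_mul (hv_const p l) (vh pD)). Qed.

Lemma pmap_morphism l : l \notin B -> morphism C W (pmap l).
Proof. by move=> /goodB[pl _ _]; apply: (fun_map_morphism det1 vf vh Lf Lh pl). Qed.

Lemma pmap_simple l : l \notin B -> simple_cover g d (Cover N C (pmap l)).
Proof.
move=> lB; have [pl nt sr] := goodB lB; have vl := @pencil_value l.
split=> /=; [by case: hc|exact: pmap_morphism| |].
  by have := fun_map_degree det1 vl pl D0; rewrite sD.
move=> q' bq; have := fun_map_branch det1 vl pl D0 DE us (pmap_morphism lB) nt sr bq.
by rewrite sD.
Qed.

Lemma pmap_ram l : l \notin B -> ramification_index C (pmap l) (cval p1) 2.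
Proof.
move=> lB; have [pl _ _] := goodB lB; have p1D : p1 \in D by rewrite DE mem_head.
have := fun_map_ram_pole det1 pl p1D; rewrite {2}DE /= eqxx (_ : count_mem p1 s = 0%N) //.
by apply/eqP; rewrite -leqn0 leqNgt -has_count has_pred1; case/andP: us.
Qed.

Lemma pmap_p1 l : pmap l (cval p1) = q.
Proof. by apply/(fun_map_q det1); rewrite DE mem_head. Qed.

Lemma pmap_branch l : l \notin B -> branch_point C (pmap l) q.
Proof.
move=> lB; exists (cval p1), 2; split=> //; [exact: cvalP|exact: pmap_p1|exact: pmap_ram].
Qed.

Lemma pmap0 x : C x -> pmap 0 x = pi x.
Proof.
move=> Cx; have [p <-] := cval_ex Cx; rewrite /pmap fun_mapE; case: ifP => [/fD -> //|pD].
rewrite /pencil mul0r addr0 /cov_fun (acoordK det1) // => /fD; by rewrite pD.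
Qed.

Lemma auto_of_iso al al' : morphism C C al -> morphism C C al' ->
  (forall x, C x -> al' (al x) = x) -> (forall x, C x -> al (al' x) = x) ->
  exists a a' : X -> X, auto a a' /\ forall y, cval (a y) = al (cval y).
Proof.
move=> ma ma' aK a'K.
have lift be : morphism C C be -> exists b : X -> X, forall y, cval (b y) = be (cval y).
  move=> mb; have /choice[b bE] : forall y, exists z : X, cval z = be (cval y).
    by move=> y; apply: cval_ex; apply: mb.1; apply: cvalP.
  by exists b.
have [a aE] := lift _ ma; have [a' aE'] := lift _ ma'.
have k1 : cancel a a' by move=> y; apply: cval_inj; rewrite aE' aE aK //; apply: cvalP.
have k2 : cancel a' a by move=> y; apply: cval_inj; rewrite aE aE' a'K //; apply: cvalP.
have pull b b' be : morphism C C be -> (forall y, cval (b y) = be (cval y)) -> cancel b b' ->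
    pullback_ok (X := X) b.
  move=> mb bE bK u c p /hv_forms[k [S [T [hS hT T0 ST [lst E]]]]].
  have rST : regular_at C (be (cval p)) (fun x => S x / T x).
    by rewrite bE in T0; exact: (regular_ratio _ hS hT T0).
  have := regular_value (regular_comp G mb (cvalP p) rST).
  rewrite -bE ST mulfK // => /hv_ae; apply; exists [seq b' x | x <- lst] => y ny.
  rewrite -bE; have [|_ <- //] := E (b y).
  by apply: contraNN ny => /(map_f b'); rewrite bK.
exists a, a'; split=> //; split=> //; [exact: pull ma aE k1|exact: pull ma' aE' k2].
Qed.

(** [affine_at_pole] makes be affine only up to a function regular at q. Pulled back to the curve,
    this error has no pole in D, nor elsewhere because be fixes q and so maps no other point to it;
    hence it is constant. *)
Lemma isotrivial_of_iso l m be : l \notin B -> m \notin B ->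
  cover_iso_via (Cover N C (pmap l)) (Cover N C (pmap m)) be -> be q = q ->
  isotrivial_pair (pencil f h m) (pencil f h l).
Proof.
move=> lB mB [ib [al [ma [al' [ma' aK a'K]]] E]] bq.
have [a [a' [aut aE]]] := auto_of_iso ma ma' aK a'K.
have [e e0 [w rw nw]] := affine_at_pole det1 ib bq.
have [mb [be' [_ bK _]]] := ib.
have bneq z : z <> q -> be z <> q.
  by move=> zq bz; apply: zq; rewrite -(bK z I) bz -bq bK.
have fin k y : y \notin D -> pmap k (cval y) <> q /\ A (pmap k (cval y)) = pencil f h k y.
  exact: (fun_map_fin det1).
pose phi y := A (be (pmap l (cval y))) - e * pencil f h l y.
have rphi p : exists c, hv p phi c.
  have [pD|pD] := boolP (p \in D).
    have mq : pmap l (cval p) = q by apply/(fun_map_q det1).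
    have mpl := pmap_morphism lB.
    have rw' : regular_at W (pmap l (cval p)) w by rewrite mq.
    have nq : near W (pmap l (cval p)) (fun z => z <> q -> A (be z) - e * A z = w z).
      by rewrite mq.
    have nw' := near_comp G mpl (cvalP p) nq.
    exists (w (pmap l (cval p))).
    apply: hv_ae (regular_value (regular_comp G mpl (cvalP p) rw')) _.
    have cw := near_cofin (cov_closed hc) (cov_connected hc) (cov_genus hc) (cov_unif hc) (cov_nontrivial d3 hc) nw'.
    apply: cofin_sub (cofin_and cw (cofin_notin D)) _ => y [H yD].
    by have [mq' mA] := fin l y yD; rewrite /phi -mA H.
  have [mq _] := fin l p pD.
  have r1' : regular_at W (pmap l (cval p)) (fun z => A (be z)).
    by apply: (regular_comp GL mb) => //; apply: acoord_regular; apply: bneq.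
  eexists; apply: hv_sub (regular_value (regular_comp G (pmap_morphism lB) (cvalP p) r1')) _.
  exact: hv_mul (hv_const p e) (pencil_value l pD).
have [c cE] : exists c, cofin (fun y => phi y = c).
  by apply: liouville => //; have [c /hv_rat] := rphi p1.
exists a, a', e, c; split=> //.
apply: cofin_sub (cofin_and cE (cofin_notin D)) _ => y [phiE yD].
have [mq _] := fin l y yD; have Ey := E _ (cvalP y); rewrite /= in Ey.
have ayD : a y \notin D.
  by apply/negP => /(fun_map_q det1 D (pencil f h m)); rewrite aE -/(pmap m) Ey; apply: bneq.
have [_ <-] := fin m _ ayD; rewrite aE Ey -phiE /phi; ring.
Qed.

Hypothesis not_isotrivial : forall Lam : K -> Prop, infinitely_many Lam ->
  (forall l, Lam l -> l \notin B) ->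
  ~ (forall l m, Lam l -> Lam m -> isotrivial_pair (pencil f h l) (pencil f h m)).

Lemma pmap_not_marked_iso (Lam : K -> Prop) : infinitely_many Lam ->
  (forall l, Lam l -> l \notin B) ->
  ~ (forall l m, Lam l -> Lam m -> exists2 be,
       cover_iso_via (Cover N C (pmap l)) (Cover N C (pmap m)) be & be q = q).
Proof.
move=> iL LB H; apply: (not_isotrivial iL LB) => l m Ll Lm.
by have [be ib bq] := H m l Lm Ll; apply: isotrivial_of_iso ib bq; apply: LB.
Qed.

Lemma pmap_ram_finite l : l \notin B -> exists R : seq X, forall p,
  ramification_index C (pmap l) (cval p) 2 -> p \in R.
Proof.
move=> lB; have [pl _ _] := goodB lB; have mpl := pmap_morphism lB.
have rF : rat (pencil f h l) by apply: ordeq_rat (pl p1 _); rewrite DE mem_head.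
have nF : nonconst (pencil f h l) by apply: (poles_nonconst D0 pl).
have [R HR] := unramified_cofin FG rF nF.
exists (D ++ R) => p rp; rewrite mem_cat; apply/negPn/negP; rewrite negb_or => /andP[pD pR].
have [b b0 jb] := HR p pR; have [mq mA] := fun_map_fin det1 (pencil f h l) pD.
move/negP: b0; apply; apply/eqP/(ramif_jet jb).
apply: ordge_ae (ordeq_ge (ram_ord mpl rp (acoord_uniformizer det1 mq))) _.
apply: cofin_sub (cofin_notin D) _ => y yD.
have [_ mAy] := fun_map_fin det1 (pencil f h l) yD.
by rewrite -mA -mAy.
Qed.

(** Compare all covers with a fixed l0: the isomorphism pulls the double point p1 back to one of the
    finitely many ramification points of l0. Infinitely many l share this point, and for two of them
    the composite through l0 maps p1 to p1, hence fixes q. *)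
Lemma pmap_not_iso (Lam : K -> Prop) : infinitely_many Lam -> (forall l, Lam l -> l \notin B) ->
  ~ (forall l m, Lam l -> Lam m -> cover_iso (Cover N C (pmap l)) (Cover N C (pmap m))).
Proof.
move=> iL LB H; have [l0 _ Ll0] := iL [::]; have l0B := LB _ Ll0.
have [R HR] := pmap_ram_finite l0B.
pose rel l p := exists be al, [/\ isomorphism W W be, isomorphism C C al,
  forall x, C x -> pmap l (al x) = be (pmap l0 x) & al (cval p) = cval p1].
have [l Ll|p _ iL'] := pigeonhole (vals := R) (R := rel) iL.
  have [be [ib [al ia E]]] := H l0 l Ll0 Ll; have [al' [ial' _ a2]] := iso_inv ia.
  have [p pE] := cval_ex (ial'.1.1 _ (cvalP p1)).
  have alp : al (cval p) = cval p1 by rewrite pE; exact: (a2 _ (cvalP p1)).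
  exists p; last by exists be, al.
  apply: HR; apply: (ram_iso ib ia E (cvalP p)).
  by rewrite /= alp; exact/pmap_ram/LB.
apply: (pmap_not_marked_iso iL') => [l [Ll _]|l m]; first exact: LB.
move=> [_ [be [al [ib ia E alp]]]] [_ [be2 [al2 [ib2 ia2 E2 alp2]]]].
have [be' [ibe' b1 b2]] := iso_inv ib; have [al' [ial' a1 a2]] := iso_inv ia.
exists (be2 \o be').
  split; first exact: iso_comp ibe' ib2.
  exists (al2 \o al'); first exact: iso_comp ial' ia2.
  move=> x /= Cx; have Cx' := ial'.1.1 _ Cx.
  by rewrite E2 // -{2}(a2 _ Cx) E // b1.
have -> : q = be (pmap l0 (cval p)) by rewrite -E ?alp ?pmap_p1 //; apply: cvalP.
rewrite /= b1 // -E2; last exact: cvalP.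
by rewrite alp2 pmap_p1 -E ?alp ?pmap_p1 //; apply: cvalP.
Qed.
Definition pencil_family : cover_family K 1 :=
  @CoverFamily K 1 N (fun z => line_base B z.1 /\ C z.2) (fun z => pmap (par z.1) z.2).

Lemma fibre_pencil_family b : line_base B b ->
  fibre pencil_family b = Cover N C (pmap (par b)).
Proof.
move=> hb; rewrite /fibre /=; congr (Cover N _ _); apply/funext => x; apply/propext.
by split=> [[]|].
Qed.

(** With l = c1 / c0, multiplying the forms of [local_pencil] by c0 makes them bihomogeneous: the
    map is [c0 u + c1 v : c0 w] in the basis q, r. *)
Lemma pencil_family_morphism : @morphism K (biproj K 1 N) 1
  (fun z => line_base B z.1 /\ C z.2) W (fun z => pmap (par z.1) z.2).
Proof.
have GB := @biproj_graded K 1 N.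
apply: morphism_intro => // z [bz Cz].
have [k [u [v [w [hu hv' hw np nx]]]]] := local_pencil (cmk Cz : X) vf vh Lf Lh.
exists (1%N, k), (fun i (t : biproj K 1 N) =>
  (c0 t.1 * u t.2 + c1 t.1 * v t.2) * coords q i + c0 t.1 * w t.2 * rvec r0 r1 i); split=> [i|].
  have mul1 a0 a1 : @form K L 1%N a0 -> @form K (proj K N) k a1 ->
      @form K (biproj K 1 N) (1%N, k) (fun t => a0 t.1 * a1 t.2).
    by move=> h0 h1; have := form_mul GB (form_fst N h0) (form_snd 1 h1).
  apply: form_ext (form_lin GB (coords q i) (rvec r0 r1 i) (form_add GB (mul1 _ _ (form_c0 K) hu)
    (mul1 _ _ (form_c1 K) hv')) (mul1 _ _ (form_c0 K) hw)) _ => t.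
  by rewrite [coords q i * _]mulrC [rvec r0 r1 i * _]mulrC.
move/nearE: nx => [e [c [he cz cx]]]; apply/nearE.
exists (0%N, e), (fun t => c t.2); split=> //; first exact: (form_snd 1 he).
move=> t [[t0 tB] Ct] /(cx _ Ct)/(_ (cmk Ct) erefl) H.
rewrite /= /pmap; apply: (fun_map_coords (C_closed := cov_closed hc) (C_connected := cov_connected hc)
  (C_genus := cov_genus hc) (C_unif := cov_unif hc) (C_nontrivial := cov_nontrivial d3 hc) det1 (y := cmk Ct)).
move: H; case: ifP => [tD [E ->]|tD [w0 fE hE]].
  rewrite mulr0; split=> //; have Et : t.2 = cval (cmk Cz : X) by rewrite -E.
  have [pl _ _] := goodB tB; rewrite E in tD.
  have := np tD _ (pl _ tD); rewrite -Et => uv0.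
  rewrite (_ : _ + _ = c0 t.1 * (u t.2 + c1 t.1 / c0 t.1 * v t.2)); first by rewrite mulf_neq0.
  by move: (u _) (v _) (c1 _) (c0 _) t0 {uv0} => u' v' x' y' y0; field.
rewrite mulf_neq0 //; split=> //; rewrite /pencil fE hE /par.
move: (u _) (v _) (w _) (c1 _) (c0 _) t0 w0 => u' v' w' x' y' y0 w0; field; by rewrite y0 w0.
Qed.

(** Only the map varies with b, so closedness and the relative Jacobian criterion follow from
    equations of C that are constant along the base. *)
Lemma pencil_family_simple : simple_cover_family g d (line_base B) pencil_family.
Proof.
have GB := @biproj_graded K 1 N; have [[clC _ smC _] _ _ _] := hc.
split; last by move=> b hb; rewrite fibre_pencil_family //; apply: pmap_simple; case: hb.
- exists (fun z => C z.2) => //; case: clC => S hS SE.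
  exists (fun F => exists2 f, S f & F = fun z : biproj K 1 N => f z.2).
    by move=> _ [f0 /hS[k hk] ->]; exists (0%N, k); exact: (form_snd 1 hk).
  move=> z; split=> [/SE H _ [f0 Sf ->]|H]; first exact: H.
  by apply/SE => f0 Sf; exact: (H (fun t => f0 t.2) (ex_intro2 _ _ f0 Sf erefl)).
- move=> z [bz /smC[r [F [rN hF rk nF]]]].
  exists r, (fun i => map_mpoly (@mpolyC 2 K) (F i)); split=> //.
  + by move=> i; have [e he] := hF i; exists 0%N, e; apply: bihomog_const.
  + by rewrite (_ : (fun i => _) = F) //; apply/funext => i; rewrite specialize_const.
  move/nearE: nF => [k [c [hk cz cF]]]; apply/nearE.
  exists (0%N, k), (fun t => c t.2); split=> //; first exact: (form_snd 1 hk).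
  move=> t bt /(cF _ I) E; rewrite /=; split=> [[_ /E H] i|H]; first by rewrite specialize_const.
  by split=> //; apply/E => i; have := H i; rewrite specialize_const.
exact: pencil_family_morphism.
Qed.
End PencilMaps.

Section BranchFamily.
Variables (K : numClosedFieldType) (g d N : nat) (C : proj K N -> Prop) (pi : proj K N -> proj K 1).
Hypotheses (gd : (g + 1 < d)%N) (d3 : (2 < d)%N) (hc : simple_cover g d (Cover N C pi)).

(** The function theory is hidden here: the moduli argument sees only a family over the line minus
    finitely many points, its member at 0, and the absence of infinitely many isomorphic members,
    marked or not. *)
Lemma branch_family q : branch_point C pi q -> exists (E : cover_family K 1) (B : seq K),
  [/\ 0 \notin B, simple_cover_family g d (line_base B) E,
      forall b, line_base B b -> branch_point (@curve K (fibre E b)) (@cmap K (fibre E b)) q,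
      forall b, line_base B b -> par b = 0 -> cover_iso_via (Cover N C pi) (fibre E b) id &
      forall Lam : K -> Prop, infinitely_many Lam -> (forall l, Lam l -> l \notin B) ->
        forall pt : K -> proj K 1, (forall l, Lam l -> line_base B (pt l) /\ par (pt l) = l) ->
        ~ (forall l m, Lam l -> Lam m -> exists2 be, cover_iso_via (fibre E (pt l)) (fibre E (pt m)) be & be q = q) /\
        ~ (forall l m, Lam l -> Lam m -> cover_iso (fibre E (pt l)) (fibre E (pt m)))].
Proof.
move=> bq; have [r0 [r1 det1]] := det1_ex q.
have [p1 [s [us ss fs ram1 rams]]] := simple_fibre d3 hc bq.
pose X := pcurve (cov_closed hc) (cov_connected hc) (cov_genus hc) (cov_unif hc) (cov_nontrivial d3 hc).
have RR : riemann_ineq X g by exact: pcurve_riemann.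
have FG : finitely_generated X by exact: pcurve_fg.
pose D : seq X := [:: p1, p1 & s]; pose f : X -> K := @cov_fun K g d N C pi d3 hc q r0 r1.
have fD p : p \in D <-> pi (cval p) = q by rewrite -(fs p) /D !inE orbA orbb.
have p1s : p1 \notin s by case/andP: us.
have pf : poles D f.
  move=> p pD; have pq := (fD p).1 pD; have [pp|pp] := eqVneq p p1.
    have -> : count_mem p D = 2 by rewrite pp /D /= eqxx (count_memPn p1s).
    by subst p; apply: (cov_ord_pole det1 pq ram1).
  have ps : p \in s by move: pD; rewrite /D !inE (negPf pp).
  have -> : count_mem p D = 1%N.
    by rewrite /D /= eq_sym (negPf pp) /= count_uniq_mem ?ps //; case/andP: us.
  exact: (cov_ord_pole det1 pq (rams p ps)).
have sD : size D = d by rewrite /D /= ss; lia.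
have s0 : s != [::] by rewrite -size_eq0 ss; lia.
have [|||||h [B [Lh vh B0 gB nB]]] := good_pencil RR (f := f) FG us s0.
- by rewrite -/D sD.
- exact: pf.
- exact: (cov_values _ _ fD).
- exact: (cov_no_triple det1 fD).
- exact: (cov_sep_ram det1 fD).
have E0 : D = [:: p1, p1 & s] by [].
have fib b := fibre_pencil_family (d3 := d3) (hc := hc) q r0 r1 D h (B := B) (b := b).
exists (pencil_family q r0 r1 D h B), B; split=> //.
- exact: (pencil_family_simple det1 E0 us sD fD pf Lh vh gB).
- move=> b /[dup] hb [b0 bB]; rewrite fib //.
  exact: (pmap_branch det1 E0 us gB bB).
- move=> b hb pb; rewrite fib // pb; split; first exact: iso_id.
  exists id; first exact: iso_id.
  move=> x Cx; exact: (pmap0 det1 fD h Cx).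
move=> Lam iL LB pt Hpt; split=> H.
  apply: (pmap_not_marked_iso p1 det1 fD pf Lh vh gB nB iL LB) => l m Ll Lm.
  have [[hl el] [hm em]] := (Hpt l Ll, Hpt m Lm).
  by have := H l m Ll Lm; rewrite !fib // el em.
apply: (pmap_not_iso det1 E0 us fD pf Lh vh gB nB iL LB) => l m Ll Lm.
have [[hl el] [hm em]] := (Hpt l Ll, Hpt m Lm).
by have := H l m Ll Lm; rewrite !fib // el em.
Qed.
End BranchFamily.

(** * Rational curves in moduli spaces *)

Section RationalCurves.
Variables (K : numFieldType) (n : nat).
Local Notation L := (proj K 1).
Implicit Types (H : proj K n -> Prop) (B : seq K) (b : L) (l : K).
Let GL := @proj_graded K 1.

Definition zclosure H (y : proj K n) : Prop :=
  forall k f, @form K (proj K n) k f -> (forall x, H x -> f x = 0) -> f y = 0.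

Lemma zclosure_closed H : zclosed (zclosure H).
Proof.
exists (fun f => (exists k, @form K (proj K n) k f) /\ forall x, H x -> f x = 0).
  by move=> f [].
by move=> y; split=> [cy f [[k hf] fH]|cy k f hf fH]; [apply: cy hf fH|apply: cy; split=> //; exists k].
Qed.

Definition lpt l : L := ppt 1 l.

Lemma lptP l : c0 (lpt l) != 0 /\ par (lpt l) = l.
Proof.
have [|c ce [E0 E1]] := @pptE K 1 l; first by rewrite xpair_eqE oner_eq0.
by rewrite /par /lpt E0 E1 mulr1; split=> //; rewrite mulrAC mulfV ?mul1r.
Qed.

Lemma lpt_inj : injective lpt.
Proof. by move=> l m E; rewrite -(lptP l).2 E (lptP m).2. Qed.

Lemma line_base_lpt B l : l \notin B -> line_base B (lpt l).
Proof. by have [l0 E] := lptP l; rewrite /line_base E. Qed.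

Lemma line_base_locally_closed B : locally_closed (line_base B).
Proof.
exists (@whole L), (line_base B); split; last by move=> x; split=> [|[]].
  by exists (fun=> False) => // x; split.
pose F b := c0 b * \prod_(e <- B) (c1 b - e * c0 b).
have hF : @form K L (1 + size B)%N F.
  apply: (form_mul GL (form_c0 K)).
  elim: B {F} => [|e B IH]; first by apply: form_ext (form_const GL 1) _ => b; rewrite big_nil.
  apply: form_ext (form_mul GL (form_sub GL (form_c1 K) (form_scale GL e (form_c0 K))) IH) _ => b.
  by rewrite big_cons.
have FE b : line_base B b <-> F b != 0.
  rewrite /line_base /F mulf_eq0 negb_or; split=> [[b0 bB]|/andP[b0 bB]]; rewrite ?b0 //=.
    apply: contraNN bB; rewrite prodf_seq_eq0 => /hasP[e eB] /=.
    by rewrite subr_eq0 /par => /eqP ->; rewrite mulfK.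
  split=> //; apply: contraNN bB => pB; rewrite prodf_seq_eq0; apply/hasP; exists (par b) => //=.
  by rewrite /par divfK // subrr.
exists (eq F) => [_ <-|b]; first by exists (1 + size B)%N.
by rewrite FE; split=> [H _ <-|/(_ _ erefl) ->]; [apply/eqP/negPn/negP|rewrite eqxx].
Qed.

Lemma cofin_infinitely_many (Q : K -> Prop) : cofin Q -> infinitely_many Q.
Proof.
move=> [t tQ] s; have [l] := infinite_field (s ++ t).
by rewrite mem_cat negb_or => /andP[ls lt]; exists l => //; apply: tQ.
Qed.

Lemma form_cofin k f b : @form K L k f -> f b != 0 -> cofin (fun l => f (lpt l) != 0).
Proof.
move=> hf fb; apply: contrapT => nc; move/eqP: fb; apply.
apply: (form_many_zeros lpt_inj hf) => s; apply: contrapT => H; apply: nc; exists s => l ls.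
by apply/eqP => E; apply: H; exists l.
Qed.

(* Local equations of the map at a point extend to all of the line once their common factor is
   removed. *)
Lemma rational_extension H B (psi : L -> proj K n) : 0 \notin B ->
  morphism (line_base B) H psi -> exists Psi : L -> proj K n,
    [/\ morphism (@whole L) (zclosure H) Psi, Psi (lpt 0) = psi (lpt 0) &
        cofin (fun l => l \notin B /\ Psi (lpt l) = psi (lpt l))].
Proof.
move=> B0 mpsi; have base0 := line_base_lpt B0.
have [e [s [hs /nearE[k [c [hc c_0 cE]]]]]] := morphism_local mpsi base0.
have [|k' [r [F [hr sE r0]]]] := common_factor hs.
  have [a a0 E] := cE _ base0 c_0; have [j] := coords_neq0 (psi (lpt 0)).
  by rewrite E mulf_eq0 negb_or => /andP[_ sj]; exists j, (lpt 0).
have /choice[Psi PsiE] : forall y, exists x : proj K n, exists2 a, a != 0 & forall i, coords x i = a * r i y.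
  by move=> y; apply: point_ex.
have agree y : line_base B y -> c y != 0 -> Psi y = psi y.
  move=> by0 cy; have [a a0 E] := cE y by0 cy; have [a' a'0 E'] := PsiE y.
  apply/esym/(@point_eq_coords _ _ _ _ (a * F y / a')) => i.
  by rewrite E sE E'; field.
have cof : cofin (fun l => l \notin B /\ Psi (lpt l) = psi (lpt l)).
  apply: cofin_sub (cofin_and (cofin_notin B) (form_cofin hc c_0)) _ => l [lB cl].
  by split=> //; apply: agree => //; apply: line_base_lpt.
exists Psi; split=> //; last by apply: agree.
apply: morphism_intro => [y _|y _]; last first.
  exists k', r; split=> //; apply: (near_all GL) => z _.
  by have [a _ E] := PsiE z; exists a.
move=> m f [Q hQ fQ] fH; have [a a0 E] := PsiE y.
rewrite fQ (meval_eq _ E) (homog_scale _ _ hQ).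
rewrite (form_many_zeros lpt_inj (form_comp GL hr hQ)) ?mulr0 //.
apply: cofin_infinitely_many; apply: cofin_sub cof _ => l [lB El].
have [a' a'0 E'] := PsiE (lpt l).
have := fH _ (mpsi.1 _ (line_base_lpt lB)); rewrite -El fQ (meval_eq _ E') (homog_scale _ _ hQ).
by move/eqP; rewrite mulf_eq0 expf_eq0 (negPf a'0) andbF => /eqP.
Qed.

(** The closure of H is the projective model; H is open and dense in it because it is locally
    closed. *)
Lemma uniruled_of_curves H : locally_closed H ->
  (forall x, H x -> rational_curve_through (zclosure H) x) -> uniruled H.
Proof.
move=> [Z [U [clZ oU HE]]] curves.
have sub x : H x -> zclosure H x by move=> Hx k f _; apply.
have HU x : zclosure H x -> U x -> H x.
  move=> cx Ux; apply/HE; split=> //; case: clZ => S hS SE; apply/SE => f Sf.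
  have [k hf] := hS f Sf; apply: cx hf _ => y /HE[Zy _]; exact: (SE y).1.
have dense : dense_in (zclosure H) U.
  move=> V [S hS SE] [y [cy Vy]].
  have [f Sf fy] : exists2 f, S f & f y != 0.
    apply: contrapT => N; apply: ((SE y).2 _ Vy) => f Sf.
    by apply/eqP/negPn/negP => fy; apply: N; exists f.
  have [k hf] := hS f Sf; have [x Hx fx] : exists2 x, H x & f x != 0.
    apply: contrapT => N; move/eqP: fy; apply; apply: cy hf _ => x Hx.
    by apply/eqP/negPn/negP => fx; apply: N; exists x.
  exists x; split; [exact: sub|by case/HE: Hx|].
  by apply: contrapT => /SE/(_ f Sf) E; rewrite E eqxx in fx.
exists n, (zclosure H); split; first exact: zclosure_closed.
  exists U, U; split=> //.
    by move=> V oV [x [Hx Vx]]; exists x; split=> //; case/HE: Hx.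
  exists id; split; first by apply: morphism_id => x [/sub].
  by exists id; split=> //; apply: morphism_id => x [cx Ux]; split=> //; apply: HU.
exists U; split=> // y cy Uy; apply: curves; exact: HU.
Qed.

Variables (O : Type) (obj : O -> Prop) (iso : O -> O -> Prop)
  (family : forall m, (proj K m -> Prop) -> (proj K m -> O) -> Prop).

(** The curve passes through the given point because the member at 0 is isomorphic to the given
    object. If it were constant, infinitely many members would have the same image under [phi],
    hence be isomorphic. *)
Lemma uniruled_of_families H : coarse_moduli_space obj iso family H ->
  (forall a, obj a -> exists (F : L -> O) (B : seq K),
    [/\ 0 \notin B, family (line_base B) F, forall b, line_base B b -> obj (F b),
        iso a (F (lpt 0)) &
        forall Lam : K -> Prop, infinitely_many Lam -> (forall l, Lam l -> l \notin B) ->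
          ~ (forall l m, Lam l -> Lam m -> iso (F (lpt l)) (F (lpt m)))]) -> uniruled H.
Proof.
move=> [lcH [phi [[objH isoE famE] surj inj _]]] fams.
apply: uniruled_of_curves lcH _ => x /surj[a oa <-].
have [F [B [B0 fF oF ia nF]]] := fams a oa.
have mpsi := famE _ _ _ (line_base_locally_closed B) fF.
have [Psi [mPsi Psi0 cof]] := rational_extension B0 mpsi.
have oF0 := oF _ (line_base_lpt B0).
exists Psi; split=> //; last by exists (lpt 0); rewrite Psi0 (isoE _ _ oa oF0 ia).
apply: contrapT => H'; apply: (nF _ (cofin_infinitely_many cof)) => [l [] //|l m [lB El] [mB Em]].
apply: inj; [exact/oF/line_base_lpt|exact/oF/line_base_lpt|].
by rewrite -El -Em; apply: contrapT => ne; apply: H'; exists (lpt l), (lpt m).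
Qed.
End RationalCurves.

Section Hurwitz.
Variables (K : numClosedFieldType) (g d n : nat).
Hypotheses (hdim : (5 <= 2 * g + 2 * d)%N) (gd : (g + 1 < d)%N).
(** d = 2 would force g = 0, against [hdim]; d >= 3 puts a second point in the fibre over q. *)
Let d3 : (2 < d)%N. Proof. by move: hdim gd; lia. Qed.

Lemma marked_hurwitz_uniruled (H : proj K n -> Prop) : marked_hurwitz_space g d H -> uniruled H.
Proof.
move=> /uniruled_of_families; apply => -[[N C pi] q] [/= hc bq].
have [E [B [B0 fE bE isoE nE]]] := branch_family gd d3 hc bq.
exists (fun b => (fibre E b, q)), B; split=> //.
- exists E, (fun=> q); split=> //; apply: morphism_intro => // b _.
  exists 0%N, (fun i _ => coords q i); split=> [i|]; first exact: (form_const (@proj_graded K 1)).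
  by apply: (near_all (@proj_graded K 1)) => y _; exists 1 => i; rewrite mul1r.
- by move=> b hb; split=> /=; [case: fE => _ _ _; apply|apply: bE].
- exists id => //=; apply: isoE; first exact: line_base_lpt.
  exact: (lptP _).2.
move=> Lam iL LB; apply: (nE Lam iL LB (@lpt K) _).1 => l /LB lB.
by split; [exact: line_base_lpt|exact: (lptP _).2].
Qed.

Lemma hurwitz_uniruled (H : proj K n -> Prop) : hurwitz_space g d H -> uniruled H.
Proof.
move=> /uniruled_of_families; apply => -[N C pi] hc.
have [q bq] := branch_ex d3 hc gd.
have [E [B [B0 fE bE isoE nE]]] := branch_family gd d3 hc bq.
exists (fibre E), B; split=> //.
- by exists E.
- by move=> b hb; case: fE => _ _ _; apply.
- exists id; apply: isoE; first exact: line_base_lpt.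
  exact: (lptP _).2.
move=> Lam iL LB; apply: (nE Lam iL LB (@lpt K) _).2 => l /LB lB.
by split; [exact: line_base_lpt|exact: (lptP _).2].
Qed.
End Hurwitz.

(* hdim says that the dimension 2g+2d-5 of the Hurwitz space is nonnegative.   *)
(* It only excludes (g, d) = (0, 2), where the coarse space is a single point. *)
Theorem lemma1p2 (R : realType) (g d : nat)
  (hdim : (5 <= 2 * g + 2 * d)%N) (hd : (g + 1 < d)%N)
  (n np : nat) (H : proj R[i] n -> Prop) (Hp : proj R[i] np -> Prop)
  (hH : hurwitz_space g d H) (hHp : marked_hurwitz_space g d Hp) :
  uniruled Hp /\ uniruled H.
Proof.
split; first exact: (marked_hurwitz_uniruled (K := R[i]) hdim hd hHp).
exact: (hurwitz_uniruled (K := R[i]) hdim hd hH).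
Qed.
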